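(* Let $T$ be a weakly pointwise dual ergodic, conservative ergodic measure preserving transformation on a $\sigma$-finite measure space $(X,\mathcal B,m)$. If its return sequence $(a_n(T))_{n\ge1}$ is regularly varying of index $\gamma\in[0,1]$, then for every $f\in L^1_+(m)$, $$\frac{S_n(f)}{a_n(T)}\ \text{ converges strongly in distribution to }\ m(f)\,Y_\gamma\quad\text{as }n\to\infty,$$ where $S_n(f):=\sum_{k=0}^{n-1}f\circ T^k$ and $Y_\gamma$ has the normalised Mittag-Leffler distribution of order $\gamma$.
   Context: $T$ need not be invertible. The transfer operator $\widehat T:L^1(m)\to L^1(m)$ is given by $\int_A\widehat Tf\,dm=\int_{T^{-1}A}f\,dm$ ($A\in\mathcal B$). $L^1_+(m):=\{f\in L^1(m):f\ge0,\ m(f)>0\}$, $m(f)=\int_X f\,dm$. Convergence in measure $\overset{m}\to$ means convergence in $\nu$-measure for every finite $\nu\ll m$. $T$ is weakly pointwise dual ergodic if there are constants $a_n(T)>0$ such that for all $f\in L^1_+(m)$: $\frac1{a_n(T)}\sum_{k=0}^{n-1}\widehat T^kf\overset{m}\to\int_Xf\,dm$, and $\limsup_{n\to\infty}\frac1{a_n(T)}\sum_{k=0}^{n-1}\widehat T^kf=\int_Xf\,dm$ a.e. on $X$. The return sequence $(a_n(T))$ is unique up to asymptotic equivalence and can be taken non-decreasing. Strong convergence in distribution of measurable $F_n:X\to[0,\infty]$ to a random variable $Y\ge0$ means: $\int_Xg(F_n)\,dQ\to\mathbb E(g(Y))$ for all $g\in C([0,\infty])$ and all probability measures $Q\ll m$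 on $(X,\mathcal B)$. The normalised Mittag-Leffler distribution of order $\gamma\in[0,1]$ is the law on $[0,\infty)$ with moments $\mathbb E(Y_\gamma^p)=\frac{p!\,\Gamma(1+\gamma)^p}{\Gamma(1+p\gamma)}$, $p\ge0$ integer. A sequence $a_n$ is regularly varying of index $\gamma$ if $a_{\lfloor cn\rfloor}/a_n\to c^\gamma$ for all $c>0$. *)

(* Defs.v *)
From HB Require Import structures.
From mathcomp Require Import all_boot all_order all_algebra.
From mathcomp Require Import all_classical all_reals all_analysis.

Set Implicit Arguments.
Unset Strict Implicit.
Unset Printing Implicit Defensive.
Import Order.TTheory GRing.Theory Num.Theory.
Import numFieldNormedType.Exports.

Local Open Scope classical_set_scope.
Local Open Scope ring_scope.

Section Transformations.
Context (d : measure_display) (X : measurableType d) (R : realType).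
Variables (m : {measure set X -> \bar R}) (T : {mfun X >-> X}).

Definition measure_preserving : Prop :=
  forall A : set X, measurable A -> m (T @^-1` A) = m A.

Definition conservative : Prop :=
  forall W : set X, measurable W ->
    trivIset [set: nat] (fun n => iter n T @^-1` W) -> m W = 0%E.

Definition ergodic : Prop :=
  forall A : set X, measurable A -> T @^-1` A = A ->
    m A = 0%E \/ m (~` A) = 0%E.

Definition is_L1 (f : X -> R) : Prop := m.-integrable [set: X] (EFin \o f).

(* Elements of L^1 are represented by real-valued functions, identified up to
   m-null sets; hence the sign condition is only required almost everywhere. *)
Definition is_L1plus (f : X -> R) : Prop :=
  [/\ is_L1 f, {ae m, forall x, 0 <= f x} & 0 < \int[m]_x f x].

Definition is_transfer (f h : X -> R) : Prop :=
  is_L1 h /\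
  forall A : set X, measurable A ->
    \int[m]_(x in A) h x = \int[m]_(x in T @^-1` A) f x.

(* A version of the transfer operator: is_transfer determines h up to m-null
   sets, and one such h is chosen. Junk value 0 when there is none; for
   integrable f and nonsingular T over a sigma-finite m see transferP. *)
Definition transfer (f : X -> R) : X -> R := xget (cst 0) [set h | is_transfer f h].

Definition cvg_in_measure (u : nat -> X -> R) (l : X -> R) : Prop :=
  forall nu : {finite_measure set X -> \bar R}, nu `<< m ->
  forall e : R, 0 < e ->
    nu [set x | e < `|u n x - l x|] @[n --> \oo] --> 0%E.

(* T is weakly pointwise dual ergodic iff it has a return sequence. The value
   a 0 is irrelevant. *)
Definition return_sequence (a : nat -> R) : Prop :=
  (forall n, (0 < n)%N -> 0 < a n) /\
  forall f : X -> R, is_L1plus f ->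
    let avg n x := (\sum_(k < n) iter k transfer f x) / a n in
    cvg_in_measure avg (cst (\int[m]_y f y)) /\
    {ae m, forall x, limn_esup (fun n => (avg n x)%:E) = (\int[m]_y f y)%:E}.

Definition weakly_pointwise_dual_ergodic : Prop :=
  exists a : nat -> R, return_sequence a.

Definition birkhoff_sum (f : X -> R) (n : nat) (x : X) : R :=
  \sum_(k < n) f (iter k T x).

(* A test function in C([0, oo]) is given by its values on [0, oo]; what g does
   elsewhere is immaterial when the F n and Y are a.e. nonnegative. *)
Definition strong_cvg_in_distribution (F : nat -> X -> \bar R)
    (d' : measure_display) (W : measurableType d') (P : probability W R)
    (Y : W -> R) : Prop :=
  forall g : \bar R -> R, {within [set y | (0 <= y)%E], continuous g} ->
  forall Q : probability X R, Q `<< m ->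
    (\int[Q]_x (g (F n x))%:E)%E @[n --> \oo] --> ('E_P[fun w => g (Y w)%:E])%E.

End Transformations.

Section TransferExists.
Context (d : measure_display) (X : measurableType d) (R : realType).
Variables (m : {sigma_finite_measure set X -> \bar R}) (T : {mfun X >-> X}).

Lemma transferP (f : X -> R) :
  (forall A : set X, measurable A -> m A = 0%E -> m (T @^-1` A) = 0%E) ->
  is_L1 m f -> is_transfer m T f (transfer m T f).
Proof.
move=> nsT intf.
have mT : measurable_fun [set: X] T by [].
have mTA (A : set X) : measurable A -> measurable (T @^-1` A).
  by move=> mA; rewrite -[X in measurable X]setTI; exact: mT.
pose nu0 : {charge set X -> \bar R} := induced_charge intf.
pose nu : {charge set X -> \bar R} :=
  measure_function_pushforward__canonical__charge_Charge nu0 mT.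
have num : nu `<< m.
  apply/null_content_dominatesP => A mA mA0.
  apply: null_set_integral; [exact: mTA| |exact: nsT].
  exact: (measurable_int m (integrableS measurableT (mTA _ mA) (@subsetT _ _) intf)).
have RNfin x : Radon_Nikodym nu m x \is a fin_num by exact: Radon_Nikodym_fin_num.
have RNE : EFin \o (fun x => fine (Radon_Nikodym nu m x)) = Radon_Nikodym nu m.
  by apply/funext => x /=; rewrite fineK.
apply: (@xgetPex _ _ [set h | is_transfer m T f h]).
exists (fun x => fine (Radon_Nikodym nu m x)); split.
  by rewrite /is_L1 RNE; exact: Radon_Nikodym_integrable.
move=> A mA; rewrite /Rintegral; congr fine.
transitivity (nu A); last by [].
rewrite (Radon_Nikodym_integral num mA).
by apply: eq_integral => x _; rewrite fineK.
Qed.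

End TransferExists.

Section Distributions.
Context (R : realType).

Definition Gamma (s : R) : R :=
  \int[lebesgue_measure]_(t in `]0, +oo[) (t `^ (s - 1) * expR (- t)).

(* The normalised Mittag-Leffler law of order gamma: carried by [0, oo) and
   characterised by its moments. *)
Definition mittag_leffler (gamma : R) (d : measure_display)
    (W : measurableType d) (P : probability W R) (Y : {RV P >-> R}) : Prop :=
  distribution P Y `[0, +oo[ = 1%E /\
  forall p : nat,
    ('E_P[fun w => (Y w ^+ p)%R])%E =
    (p`!%:R * Gamma (1 + gamma) ^+ p / Gamma (1 + p%:R * gamma))%:E.

Definition regularly_varying (a : nat -> R) (gamma : R) : Prop :=
  forall c : R, 0 < c ->
    a (Num.truncn (c * n%:R)) / a n @[n --> \oo] --> c `^ gamma.

End Distributions.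

(* Main.v *)
(* The proof is by moments against nice weights. Write [U_n = \sum_(k < n) T^^k] and
   call [u] nice if [U_n u <= C a_n] everywhere. Since [limsup U_n f / a_n] is finite a.e.,
   restricting [f >= 0] to the set where [U_n f <= j a_n] for all [n] gives, by the maximum
   principle, nice functions below [f] which converge to [f] in L^1.

   For nice [u] and [f], [S_n(f) ^ (q + 1)] is, up to lower order,
   [(q + 1) \sum_(k < n) (f * S_(n-k)(f) ^ q) o T^k]. Cutting [0, n) into [L] blocks,
   weak dual ergodicity and monotonicity in [n - k] sandwich the integral of this sum
   against [u] between two Riemann-Stieltjes sums of the Beta integral
   [\int_0^1 (1 - x)^(q gamma) d(x^gamma)]; the limit of these is identified on a discrete
   example, where Chu-Vandermonde gives the convolution explicitly. Induction on [q]
   yields the Mittag-Leffler moments.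

   Those are at most [q! C ^ q], so Taylor expansion in steps shorter than [1 / C] turns
   them into convergence of Laplace transforms, which extends by L^1 density to all [f]
   and all densities of [Q]. Polynomials in [e^-x] are dense in C([0, oo]). *)

Require Import Defs.
From mathcomp Require Import all_boot all_order all_algebra.
From mathcomp Require Import all_classical all_reals all_analysis.
From mathcomp Require Import measurable_realfun ring lra.
Import Order.TTheory GRing.Theory Num.Theory.
Import numFieldNormedType.Exports.

Local Open Scope classical_set_scope.
Local Open Scope ring_scope.

Set Implicit Arguments.
Unset Strict Implicit.
Unset Printing Implicit Defensive.

(** Dual ergodicity is only convergence in measure, while the functions tested against it,
    [f * S_j(f) ^ q], change with j and grow. The bound carried by nice functions resolves this: it
    makes every moment of order q at most a constant times [a_j ^ q], and the moment of order 2q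
    then controls the mass on the exceptional set, uniformly in j. So k and j may grow together, as
    the block argument requires. The bound is kept in dual form, against nonnegative test functions,
    so that versions of the transfer operator need not be compared. The sequence [a] is not assumed
    monotone or divergent. That [a n --> +oo] and [a n.+1 / a n --> 1] comes from the
    autocorrelation [\int f S_n(f)], which is monotone with bounded increments, is asymptotic to
    [(\int f)^2 a_n], and is unbounded by conservativity. Divergence is also what makes the
    lower-order terms negligible. For gamma = 0 the measure d(x^gamma) is the unit mass at 0; the
    conventions at index 0 below let the same argument cover this case. *)

Lemma eqW (disp : Order.disp_t) (T : porderType disp) (x y : T) : x = y -> (x <= y)%O.
Proof. by move=> ->. Qed.

(** * The Gamma function *)

Section GammaFunction.
Context {R : realType}.
Implicit Types s t c : R.
Notation mu := (@lebesgue_measure R).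

Lemma powR_continuous_gt0 s t : 0 < t -> {for t, continuous (fun x : R => x `^ s)}.
Proof.
move=> t0; apply: differentiable_continuous; apply/derivable1_diffP.
by apply: derivable_powR; rewrite in_itv/= t0.
Qed.

Lemma powR_addr1 t s : 0 < t -> t `^ (s + 1) = t * t `^ s.
Proof.
move=> t0; rewrite powRD; last by rewrite (gt_eqF t0) implybT.
by rewrite powRr1 ?ltW// mulrC.
Qed.

Lemma powR_cvg_at_right0 s : 0 <= s -> x `^ s @[x --> 0^'+] --> (0 : R) `^ s.
Proof.
rewrite le_eqVlt => /predU1P[<-|s0].
  by rewrite powRr0; under eq_fun do rewrite powRr0; exact: cvg_cst.
by rewrite powR0 ?gt_eqF//; exact: powR_cvg0.
Qed.

Lemma expRN_continuous : continuous (fun x : R => expR (- x)).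
Proof.
move=> x; apply: continuous_comp; first exact: continuousN.
exact: continuous_expR.
Qed.

Lemma is_derive_expRN (x : R) : is_derive x 1 (fun x => expR (- x)) (- expR (- x)).
Proof.
have d : is_derive x 1 (fun x : R => - x) (-1) by exact: is_deriveNid.
have := @is_derive1_comp _ expR (fun x : R => - x) x _ _ (is_derive_expR (- x)) d.
by rewrite mulrN1.
Qed.

(** A single term of the exponential series, t^(k+1)/(k+1)! <= e^t with k >= s, already gives the
    bound (k+1)!/t for t >= 1. *)
Lemma powRM_expRN_cvg0 s : t `^ s * expR (- t) @[t --> +oo] --> (0 : R).
Proof.
pose k := Num.bound `|s|.
apply: (@squeeze_cvgr _ _ _ _ (cst 0) (fun t : R => (k.+1)`!%:R * t^-1)).
- near=> t; rewrite mulr_ge0 ?powR_ge0 ?expR_ge0//=.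
  have t1 : 1 <= t by near: t; exact: nbhs_pinfty_ge.
  have t0 : 0 < t by exact: lt_le_trans t1.
  rewrite expRN ler_pdivrMr ?expR_gt0// -mulrA.
  have sk : t `^ s <= t ^+ k.
    have sk : s <= k%:R.
      by rewrite (le_trans (ler_norm _))// ltW// archi_boundP.
    rewrite -powR_mulrn; last exact: ltW.
    exact: (ler_powR t1 sk).
  apply: (le_trans sk).
  have := expR_ge1Dxn k (ltW t0); rewrite -lerBrDl => h.
  have : t ^+ k.+1 / (k.+1)`!%:R <= expR t by rewrite (le_trans h)// lerBlDl lerDr.
  rewrite ler_pdivrMr ?ltr0n ?fact_gt0// exprS => h2.
  by rewrite mulrCA ler_pdivlMl// mulrC [leRHS]mulrC mulrC.
- exact: cvg_cst.
- rewrite -(mulr0 ((k.+1)`!%:R)); apply: cvgMr.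
  apply/gtr0_cvgV0; last exact: cvg_id.
  exact: nbhs_pinfty_gt.
Unshelve. all: by end_near. Qed.

(** Gamma at s + 1 with values in [0, +oo], so that the functional equation can be proved with
    nonnegative integrals before finiteness is known. The shift keeps the integrand bounded near 0
    for s >= 0. *)
Definition eGamma s : \bar R := (\int[mu]_(t in `[0%R, +oo[) (t `^ s * expR (- t))%:E)%E.

Lemma measurable_Gamma_integrand s (D : set R) :
  measurable_fun D (fun t : R => t `^ s * expR (- t)).
Proof.
apply: measurable_funTS; apply: measurable_funM; first exact: measurable_powR.
by apply: continuous_measurable_fun => x; exact: expRN_continuous.
Qed.

Lemma GammaE s : Gamma (1 + s) = fine (eGamma s).
Proof.
rewrite /Gamma /Rintegral /eGamma -integral_itv_obnd_cbnd.
  by congr fine; apply: eq_integral => t _; rewrite (_ : 1 + s - 1 = s)//; ring.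
by apply/measurable_EFinP; exact: measurable_Gamma_integrand.
Qed.

Lemma eGamma0 : eGamma 0 = 1%E.
Proof.
rewrite /eGamma.
under eq_integral do rewrite powRr0 mul1r.
rewrite (@ge0_continuous_FTC2y _ _ (fun x => - expR (- x)) _ 0)//.
- by rewrite oppr0 expR0 sub0e EFinN oppeK.
- by apply: continuous_subspaceT => x; exact: expRN_continuous.
- by rewrite -oppr0; apply: cvgN; exact: cvgr_expR.
- apply: cvg_at_right_filter; apply: cvgN; exact: expRN_continuous.
- move=> x _; rewrite derive1E.
  by have /@derive_val-> := is_deriveN (is_derive_expRN x); rewrite opprK.
Qed.

(* [x^s - (s+1) x^(s-1)] is bounded below by [-(s+1)^(s+1)]; adding that constant
   makes the derivative of [- x^(s+1) e^(-x)] nonnegative. *)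
Lemma eGammaS s : 0 <= s -> eGamma (s + 1) = ((s + 1)%:E * eGamma s)%E.
Proof.
move=> s0.
pose c : R := (s + 1) `^ (s + 1).
have c0 : 0 <= c by exact: powR_ge0.
pose h t : R := (t `^ (s + 1) + c - (s + 1) * t `^ s) * expR (- t).
have s10 : 0 < s + 1 by rewrite ltr_wpDl.
have h0 t : 0 <= t -> 0 <= h t.
  move=> t0; rewrite mulr_ge0 ?expR_ge0// subr_ge0.
  have [st|ts] := leP (s + 1) t.
    have t0' : 0 < t by exact: lt_le_trans st.
    rewrite (@le_trans _ _ (t `^ (s + 1)))// ?lerDl//.
    by rewrite powR_addr1// ler_wpM2r ?powR_ge0.
  rewrite (@le_trans _ _ c)// ?lerDr ?powR_ge0//.
  rewrite /c powR_addr1// ler_wpM2l ?(ltW s10)//.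
  by apply: ge0_ler_powR => //; rewrite ?nnegrE ?(ltW s10)// ltW.
have mh (D : set R) : measurable_fun D h.
  apply: measurable_funTS; apply: measurable_funM; last first.
    by apply: continuous_measurable_fun => x; exact: expRN_continuous.
  apply: measurable_funB.
    by apply: measurable_funD => //; exact: measurable_powR.
  by apply: measurable_funM => //; exact: measurable_powR.
have dF (x : R) : 0 < x ->
    is_derive x 1 (fun x => - (x `^ (s + 1) + c) * expR (- x)) (h x).
  move=> x0; have d1 := is_derive1_powR (s + 1) x0.
  have d3 := is_deriveM (is_deriveN (is_deriveD d1 (is_derive_cst c x 1)))
    (is_derive_expRN x).
  apply: is_derive_eq; have -> : s + 1 - 1 = s by ring.
  by rewrite /GRing.scale/= !fctE /h; ring.
have hE : (\int[mu]_(t in `[0%R, +oo[) (h t)%:E = c%:E)%E.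
  rewrite (@ge0_continuous_FTC2y _ _ (fun x => - (x `^ (s + 1) + c) * expR (- x)) _ 0)//.
  - by rewrite powR0 ?gt_eqF// oppr0 expR0 mulr1 !add0r EFinN oppeK.
  - apply/continuous_within_itvcyP; split.
      move=> x; rewrite in_itv/= andbT => x0.
      apply: cvgM; last exact: expRN_continuous.
      apply: cvgB; first by apply: cvgD; [exact: powR_continuous_gt0|exact: cvg_cst].
      by apply: cvgMr; exact: powR_continuous_gt0.
    apply: cvgM; last by apply: cvg_at_right_filter; exact: expRN_continuous.
    apply: cvgB.
      by apply: cvgD; [apply: powR_cvg_at_right0; exact: ltW|exact: cvg_cst].
    by apply: cvgMr; exact: powR_cvg_at_right0.
  - under eq_fun do rewrite mulNr mulrDl.
    rewrite -oppr0; apply: cvgN; rewrite -[X in _ --> X]addr0; apply: cvgD.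
      exact: powRM_expRN_cvg0.
    by rewrite -[X in _ --> X](mulr0 c); apply: cvgMr; exact: cvgr_expR.
  - by move=> x x0; have [] := dF x x0.
  - apply: cvgM; last by apply: cvg_at_right_filter; exact: expRN_continuous.
    apply: cvgN; apply: cvgD; last exact: cvg_cst.
    by apply: powR_cvg_at_right0; exact: ltW.
  - move=> x; rewrite in_itv/= andbT => x0.
    by rewrite derive1E; have /@derive_val -> := dF x x0.
have m1 : measurable_fun [set: R] (fun t : R => expR (- t)).
  by apply: continuous_measurable_fun => x; exact: expRN_continuous.
(* [E1] and [E2] evaluate one nonnegative integral in two ways. Only the finite constant [c] is
   cancelled at the end, never a possibly infinite [eGamma]. *)
have E1 : (\int[mu]_(t in `[0%R, +oo[) ((t `^ (s + 1) + c) * expR (- t))%:E =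
    eGamma (s + 1) + c%:E)%E.
  under eq_integral do rewrite mulrDl EFinD.
  rewrite ge0_integralD//; last 4 first.
  - by move=> t _; rewrite lee_fin mulr_ge0 ?powR_ge0 ?expR_ge0.
  - by apply/measurable_EFinP; exact: measurable_Gamma_integrand.
  - by move=> t _; rewrite lee_fin mulr_ge0 ?expR_ge0.
  - by apply/measurable_EFinP; apply: measurable_funM => //; exact: measurable_funTS.
  congr (_ + _)%E.
  under eq_integral do rewrite EFinM.
  rewrite ge0_integralZl_EFin//.
  - suff -> : (\int[mu]_(t in `[0%R, +oo[) (expR (- t))%:E = 1)%E by rewrite mule1.
    by rewrite -eGamma0; apply: eq_integral => t _; rewrite powRr0 mul1r.
  - by apply/measurable_EFinP; exact: measurable_funTS.
have E2 : (\int[mu]_(t in `[0%R, +oo[) ((t `^ (s + 1) + c) * expR (- t))%:E =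
    (s + 1)%:E * eGamma s + c%:E)%E.
  rewrite -hE /eGamma -ge0_integralZl_EFin//; last 3 first.
  - by move=> t _; rewrite lee_fin mulr_ge0 ?powR_ge0 ?expR_ge0.
  - by apply/measurable_EFinP; exact: measurable_Gamma_integrand.
  - exact: ltW.
  rewrite -ge0_integralD//.
  - by apply: eq_integral => t _; rewrite -EFinM -EFinD /h; congr EFin; ring.
  - by move=> t _; rewrite lee_fin !mulr_ge0 ?powR_ge0 ?expR_ge0 ?ltW.
  - apply: measurable_funeM.
    by apply/measurable_EFinP; exact: measurable_Gamma_integrand.
  - by move=> t /=; rewrite in_itv/= andbT lee_fin; exact: h0.
  - by apply/measurable_EFinP; exact: mh.
by rewrite -[LHS](@addeK _ c%:E)// -E1 E2 addeK.
Qed.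

Lemma eGamma_ge0 s : (0 <= eGamma s)%E.
Proof.
by apply: integral_ge0 => t _; rewrite lee_fin mulr_ge0 ?powR_ge0 ?expR_ge0.
Qed.

Lemma eGamma_nat (n : nat) : eGamma n%:R = (n`!%:R)%:E.
Proof.
elim: n => [|n IH]; first by rewrite eGamma0.
by rewrite -natr1 eGammaS// IH -EFinM natr1 -natrM factS.
Qed.

(** On [0, oo), t^s <= 1 + t^n for a natural n >= s, and at naturals [eGamma] is a factorial. *)
Lemma eGamma_lty s : 0 <= s -> (eGamma s < +oo)%E.
Proof.
move=> s0.
pose n := Num.bound s.
have sn : s <= n%:R by rewrite ltW// archi_boundP.
apply: (@le_lt_trans _ _ (eGamma 0 + eGamma n%:R)%E); last first.
  by rewrite eGamma0 eGamma_nat ltry.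
rewrite /eGamma -ge0_integralD//; last 4 first.
- by move=> t _; rewrite lee_fin mulr_ge0 ?powR_ge0 ?expR_ge0.
- by apply/measurable_EFinP; exact: measurable_Gamma_integrand.
- by move=> t _; rewrite lee_fin mulr_ge0 ?powR_ge0 ?expR_ge0.
- by apply/measurable_EFinP; exact: measurable_Gamma_integrand.
apply: ge0_le_integral => //.
- by move=> t _; rewrite lee_fin mulr_ge0 ?powR_ge0 ?expR_ge0.
- by apply/measurable_EFinP; exact: measurable_Gamma_integrand.
- by apply: emeasurable_funD; apply/measurable_EFinP; exact: measurable_Gamma_integrand.
- move=> t /=; rewrite in_itv/= andbT => t0.
  rewrite -EFinD lee_fin -mulrDl ler_wpM2r ?expR_ge0// powRr0.
  have [t1|t1] := leP 1 t.
    by rewrite (le_trans (ler_powR t1 sn))// lerDr.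
  rewrite (@le_trans _ _ 1)// ?lerDl ?powR_ge0//.
  rewrite -[leRHS](_ : 1 `^ s = 1); last by rewrite powR1.
  apply: ge0_ler_powR => //; rewrite ?nnegrE//.
  exact: ltW.
Qed.

Lemma eGamma_fineK s : 0 <= s -> ((Gamma (1 + s))%:E = eGamma s)%E.
Proof.
by move=> s0; rewrite GammaE fineK// ge0_fin_numE ?eGamma_ge0 ?eGamma_lty.
Qed.

Lemma Gamma1DS s : 0 <= s -> Gamma (1 + (s + 1)) = (s + 1) * Gamma (1 + s).
Proof.
move=> s0; apply: EFin_inj.
by rewrite EFinM !eGamma_fineK ?eGammaS// addr_ge0.
Qed.

Lemma Gamma1D_nat (n : nat) : Gamma (1 + n%:R) = n`!%:R :> R.
Proof. by rewrite GammaE eGamma_nat. Qed.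

Lemma powR_le_tangent (th c t : R) : 0 <= th <= 1 -> 0 < c -> 0 <= t ->
  t `^ th <= (1 - th) * c `^ th + th * (c `^ th / c) * t.
Proof.
move=> /andP[th0 th1] c0; rewrite le_eqVlt => /predU1P[<-|t0].
  rewrite mulr0 addr0; have [->|thn0] := eqVneq th 0.
    by rewrite !powRr0 subr0 mulr1.
  by rewrite powR0// mulr_ge0 ?powR_ge0// subr_ge0.
have tc0 : 0 < t / c by rewrite divr_gt0.
have h : (t / c) `^ th <= (1 - th) + th * (t / c).
  rewrite /powR (gt_eqF tc0); set l := ln (t / c).
  have -> : t / c = expR l by rewrite lnK.
  clearbody l.
  (* The tangent of exp at [th * l] is compared with exp at [l] and at 0; averaging with weights
     [th] and [1 - th] cancels the linear terms. *)
  have h1 : expR (th * l) * (1 + (1 - th) * l) <= expR l.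
    rewrite [X in _ <= expR X](_ : l = th * l + (1 - th) * l); last by ring.
    by rewrite expRD ler_wpM2l ?expR_ge0// expR_ge1Dx.
  have h2 : expR (th * l) * (1 - th * l) <= 1.
    rewrite -[leRHS]expR0 [X in _ <= expR X](_ : 0 = th * l - th * l); last by ring.
    by rewrite expRD ler_wpM2l ?expR_ge0// expR_ge1Dx.
  have th1' : 0 <= 1 - th by rewrite subr_ge0.
  have h3 := lerD (ler_wpM2l th0 h1) (ler_wpM2l th1' h2).
  rewrite addrC; apply: le_trans (le_trans _ h3) _; apply/eqW; ring.
have -> : t `^ th = c `^ th * (t / c) `^ th.
  by rewrite -powRM ?(ltW c0) ?(ltW tc0)// mulrCA divff ?gt_eqF// mulr1.
apply: le_trans (ler_wpM2l (powR_ge0 _ _) h) _.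
by apply/eqW; ring.
Qed.

(** Jensen's inequality for the concave function t^th under the density t^s e^(-t) / Gamma(1 + s).
    Its mean is s + 1 by the functional equation, hence the tangent is taken at c = s + 1. *)
Lemma Gamma1D_log_convex s th : 0 <= s -> 0 <= th <= 1 ->
  Gamma (1 + (s + th)) <= Gamma (1 + s) * (s + 1) `^ th.
Proof.
move=> s0 /andP[th0 th1].
have sth0 : 0 <= s + th by rewrite addr_ge0.
have c0 : 0 < s + 1 by rewrite ltr_wpDl.
set c := s + 1.
pose A := (1 - th) * c `^ th; pose B := th * (c `^ th / c).
have A0 : 0 <= A by rewrite mulr_ge0 ?powR_ge0// subr_ge0.
have B0 : 0 <= B by rewrite mulr_ge0// divr_ge0 ?powR_ge0// ltW.
suff : (eGamma (s + th) <= A%:E * eGamma s + B%:E * eGamma (s + 1))%E.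
  rewrite -!eGamma_fineK ?addr_ge0// -!EFinM -EFinD lee_fin Gamma1DS// => h.
  apply: (le_trans h); apply/eqW; rewrite /A /B -/c.
  by field; rewrite gt_eqF.
rewrite /eGamma -!ge0_integralZl_EFin//; last 4 first.
- by move=> t _; rewrite lee_fin mulr_ge0 ?powR_ge0 ?expR_ge0.
- by apply/measurable_EFinP; exact: measurable_Gamma_integrand.
- by move=> t _; rewrite lee_fin mulr_ge0 ?powR_ge0 ?expR_ge0.
- by apply/measurable_EFinP; exact: measurable_Gamma_integrand.
rewrite -ge0_integralD//; last 4 first.
- by move=> t _; rewrite lee_fin (mulr_ge0 A0)// mulr_ge0 ?powR_ge0 ?expR_ge0.
- by apply: measurable_funeM; apply/measurable_EFinP; exact: measurable_Gamma_integrand.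
- by move=> t _; rewrite lee_fin (mulr_ge0 B0)// mulr_ge0 ?powR_ge0 ?expR_ge0.
- by apply: measurable_funeM; apply/measurable_EFinP; exact: measurable_Gamma_integrand.
rewrite -!integral_itv_obnd_cbnd; last 2 first.
- by apply: emeasurable_funD; apply: measurable_funeM;
    apply/measurable_EFinP; exact: measurable_Gamma_integrand.
- by apply/measurable_EFinP; exact: measurable_Gamma_integrand.
apply: ge0_le_integral => //.
- by move=> t _; rewrite lee_fin mulr_ge0 ?powR_ge0 ?expR_ge0.
- by apply/measurable_EFinP; exact: measurable_Gamma_integrand.
- by apply: emeasurable_funD; apply: measurable_funeM;
    apply/measurable_EFinP; exact: measurable_Gamma_integrand.
- move=> t /=; rewrite in_itv/= andbT => t0.
  rewrite -!EFinM -EFinD lee_fin powR_addr1// !mulrA -mulrDl ler_wpM2r ?expR_ge0//.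
  rewrite powRD; last by rewrite (gt_eqF t0) implybT.
  rewrite -mulrDl mulrC ler_wpM2r ?powR_ge0//.
  by apply: powR_le_tangent; rewrite ?th0// ltW.
Qed.

(** A zero at 1 + s would propagate by log-convexity to the next integer, where Gamma is a
    factorial. *)
Lemma Gamma1D_gt0 s : 0 <= s -> 0 < Gamma (1 + s).
Proof.
move=> s0.
rewrite lt_neqAle; apply/andP; split; last first.
  by rewrite GammaE fine_ge0// eGamma_ge0.
apply/eqP => G0.
pose n := Num.truncn s.
have /andP[ns sn] := truncn_itv s0.
have th : 0 <= n.+1%:R - s <= 1.
  by rewrite subr_ge0 (ltW sn)/= lerBlDr -natr1 addrC lerD2l.
have := Gamma1D_log_convex s0 th.
rewrite -G0 mul0r (_ : s + (n.+1%:R - s) = n.+1%:R); last by ring.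
by rewrite Gamma1D_nat leNgt ltr0n fact_gt0.
Qed.

(** The coefficient of z^n in (1 - z)^(-x). *)
Definition rising (x : R) (n : nat) : R := (\prod_(i < n) (x + i%:R)) / n`!%:R.

Lemma risingE s (n : nat) : 0 <= s ->
  rising (1 + s) n = Gamma (1 + (s + n%:R)) / (Gamma (1 + s) * n`!%:R).
Proof.
move=> s0; rewrite /rising.
suff -> : \prod_(i < n) (1 + s + i%:R) = Gamma (1 + (s + n%:R)) / Gamma (1 + s).
  by rewrite invfM mulrA.
elim: n => [|n IH].
  by rewrite big_ord0 addr0 divff// gt_eqF// Gamma1D_gt0.
rewrite big_ord_recr/= IH -natr1 (addrA s) Gamma1DS ?addr_ge0//.
by ring.
Qed.

Lemma invn_cvg0 : (n%:R^-1 : R) @[n --> \oo] --> (0 : R).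
Proof. by apply/gtr0_cvgV0; [near=> n; rewrite ltr0n; near: n; exact: nbhs_infty_gt|exact: cvgr_idn]. Unshelve. all: by end_near. Qed.

(** Log-convexity used from n by a step s gives the upper bound; used from s + n by a step 1 - s,
    landing on the factorial (n + 1)!, it gives the lower one. *)
Lemma Gamma_ratio_cvg_le1 s : 0 <= s <= 1 ->
  Gamma (1 + (s + n%:R)) / (n`!%:R * n%:R `^ s) @[n --> \oo] --> (1 : R).
Proof.
move=> /andP[s0 s1].
apply: (@squeeze_cvgr _ _ _ _ (fun n : nat => 1 - n%:R^-1 : R)
  (fun n : nat => 1 + n%:R^-1 : R)).
- near=> n.
  have n0 : (0 < n)%N by near: n; exact: nbhs_infty_gt.
  have n0R : 0 < n%:R :> R by rewrite ltr0n.
  have d0 : 0 < n`!%:R * n%:R `^ s :> R.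
    by rewrite mulr_gt0 ?powR_gt0// ltr0n fact_gt0.
  have monos (x y : R) (r : R) : 0 <= r -> 0 <= x -> x <= y -> x `^ r <= y `^ r.
    move=> r0 x0 xy; apply: ge0_ler_powR => //; rewrite nnegrE//.
    exact: le_trans xy.
  apply/andP; split.
    rewrite ler_pdivlMr//.
    have /(_ _)/wrap[] := @Gamma1D_log_convex (s + n%:R) (1 - s).
      by rewrite addr_ge0.
    rewrite subr_ge0 s1 lerBlDr lerDl s0 => /(_ isT).
    rewrite (_ : s + n%:R + (1 - s) = n.+1%:R); last by rewrite -natr1; ring.
    rewrite Gamma1D_nat => h.
    have h2 : (n.+1)`!%:R <= Gamma (1 + (s + n%:R)) * (n.+2%:R) `^ (1 - s) :> R.
      apply: (le_trans h); apply: ler_wpM2l.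
        by rewrite ltW// Gamma1D_gt0// addr_ge0.
      apply: monos; rewrite ?subr_ge0 ?addr_ge0//.
      by rewrite -!natr1; lra.
    have n20 : 0 < n.+2%:R :> R by rewrite ltr0n.
    rewrite -(ler_pM2r (powR_gt0 (1 - s) n20)).
    apply: le_trans h2.
    (* This middle term fits below (n + 1)! because (1 - 1/n)(n + 2) = n + 1 - 2/n. *)
    rewrite (@le_trans _ _ ((1 - n%:R^-1) * (n`!%:R * n.+2%:R)))//.
      have [n1|n1] := ltnP 1 n; last first.
        have -> : n = 1%N by apply/eqP; rewrite eqn_leq n1.
        by rewrite invr1 subrr !mul0r.
      rewrite -!mulrA ler_wpM2l//.
        by rewrite subr_ge0 invf_le1// ler1n.
      rewrite ler_wpM2l//.
      rewrite [leRHS](_ : _ = n.+2%:R `^ s * n.+2%:R `^ (1 - s)); last first.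
        rewrite -powRD; last by rewrite subrKC oner_eq0.
        by rewrite subrKC powRr1.
      rewrite ler_wpM2r ?powR_ge0//.
      by rewrite monos// ler_nat -addn2 leq_addr.
    rewrite factS natrM mulrCA [leRHS]mulrC ler_wpM2l//.
    have vn : n%:R^-1 * n%:R = 1 :> R by rewrite mulVf ?gt_eqF.
    have v0 : 0 <= n%:R^-1 :> R by rewrite invr_ge0.
    rewrite -!natr1; move: (n%:R : R) (n%:R^-1 : R) vn v0 => y v vn v0.
    rewrite (_ : _ * _ = y + 2 - v * y - 2 * v); last by ring.
    by rewrite vn; lra.
  rewrite ler_pdivrMr//.
  have := @Gamma1D_log_convex n%:R s (ler0n _ _).
  rewrite s0 s1 => /(_ isT); rewrite Gamma1D_nat => h.
  rewrite (addrC s); apply: (le_trans h).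
  rewrite mulrCA ler_wpM2l//.
  have -> : (n%:R + 1 : R) = (1 + n%:R^-1) * n%:R.
    by rewrite mulrDl mul1r mulVf ?gt_eqF.
  rewrite powRM ?addr_ge0 ?invr_ge0// ler_wpM2r ?powR_ge0//.
  by apply: ler1_powR => //; rewrite lerDl invr_ge0.
- rewrite -[X in _ --> X]subr0; apply: cvgB; first exact: cvg_cst.
  exact: invn_cvg0.
- rewrite -[X in _ --> X]addr0; apply: cvgD; first exact: cvg_cst.
  exact: invn_cvg0.
Unshelve. all: by end_near. Qed.

(** The integer part of s is added one unit at a time; by the functional equation each unit costs a
    factor 1 + (th + N + 1)/n. *)
Lemma Gamma_ratio_cvg s : 0 <= s ->
  Gamma (1 + (s + n%:R)) / (n`!%:R * n%:R `^ s) @[n --> \oo] --> (1 : R).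
Proof.
move=> s0.
pose N := Num.truncn s.
have /andP[Ns sN] := truncn_itv s0.
have sN1 : 0 <= s - N%:R <= 1 by rewrite subr_ge0 Ns lerBlDl natr1 ltW.
suff H th : 0 <= th <= 1 ->
    Gamma (1 + (th + N%:R + n%:R)) / (n`!%:R * n%:R `^ (th + N%:R)) @[n --> \oo] --> (1 : R).
  by have := H _ sN1; rewrite subrK.
move=> th01; have th0 : 0 <= th by case/andP: th01.
elim: N {Ns sN sN1} => [|N IH].
  by under eq_fun do rewrite addr0; exact: Gamma_ratio_cvg_le1.
have thN0 : 0 <= th + N%:R by rewrite addr_ge0.
have h : Gamma (1 + (th + N%:R + n%:R)) / (n`!%:R * n%:R `^ (th + N%:R)) *
    (1 + (th + N%:R + 1) * n%:R^-1) @[n --> \oo] --> (1 : R).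
  rewrite -[X in _ --> X]mulr1; apply: cvgM => //.
  rewrite -[X in _ --> X]addr0; apply: cvgD; first exact: cvg_cst.
  by rewrite -[X in _ --> X](mulr0 (th + N%:R + 1)); apply: cvgMr; exact: invn_cvg0.
apply: cvg_trans h; apply: near_eq_cvg; near=> n.
have n0 : 0 < n%:R :> R by rewrite ltr0n; near: n; exact: nbhs_infty_gt.
rewrite -natr1 (addrA th) powR_addr1//.
rewrite (_ : th + N%:R + 1 + n%:R = th + N%:R + n%:R + 1); last by ring.
rewrite Gamma1DS ?addr_ge0//.
field; rewrite !gt_eqF// ?powR_gt0// ltr0n fact_gt0//.
Unshelve. all: by end_near. Qed.

Lemma rising_cvg s : 0 <= s ->
  rising (1 + s) n / n%:R `^ s @[n --> \oo] --> (Gamma (1 + s))^-1.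
Proof.
move=> s0.
rewrite (_ : (fun n : nat => _) = (fun n : nat =>
  Gamma (1 + (s + n%:R)) / (n`!%:R * n%:R `^ s) * (Gamma (1 + s))^-1)).
  by rewrite -[X in _ --> X]mul1r; apply: cvgMl; exact: Gamma_ratio_cvg.
by apply/funext => n; rewrite risingE// !invfM; ring.
Qed.

Lemma rising_ge0 (x : R) n : 0 <= x -> 0 <= rising x n.
Proof.
by move=> x0; rewrite /rising mulr_ge0 ?invr_ge0// prodr_ge0// => i _; rewrite addr_ge0.
Qed.

Lemma rising0 (x : R) : rising x 0 = 1.
Proof. by rewrite /rising big_ord0 divr1. Qed.

Lemma risingS (x : R) n : n.+1%:R * rising x n.+1 = (x + n%:R) * rising x n.
Proof.
rewrite /rising big_ord_recr/= factS natrM.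
by field; rewrite gt_eqF ?ltr0n ?fact_gt0//= addrC natr1 pnatr_eq0.
Qed.

Lemma rising_nondecreasing (s : R) : 0 <= s -> nondecreasing_seq (rising (1 + s)).
Proof.
move=> s0; apply/nondecreasing_seqP => n.
have n0 : 0 < n.+1%:R :> R by rewrite ltr0n.
rewrite -(ler_pM2l n0) risingS ler_wpM2r ?rising_ge0 ?addr_ge0//.
by rewrite -natr1 addrC -[leRHS]addrA lerD2l lerDr.
Qed.

(** Coefficient comparison in (1 - z)^(-x) (1 - z)^(-y). Writing n + 1 = k + (n + 1 - k) plays the
    part of the product rule for z d/dz and lets [risingS] act on each factor. *)
Lemma rising_Vandermonde (x y : R) n :
  \sum_(k < n.+1) rising x k * rising y (n - k) = rising (x + y) n.
Proof.
elim: n => [|n IH].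
  by rewrite big_ord_recr big_ord0/= add0r !rising0 mulr1.
apply: (@mulfI _ n.+1%:R); first by rewrite pnatr_eq0.
rewrite risingS -IH !mulr_sumr.
transitivity (\sum_(k < n.+2) (k%:R * rising x k * rising y (n.+1 - k) +
    rising x k * ((n.+1 - k)%:R * rising y (n.+1 - k)))).
  apply: eq_bigr => k _.
  have {1}-> : n.+1%:R = k%:R + (n.+1 - k)%:R :> R.
    by rewrite -natrD subnKC// -ltnS.
  by ring.
rewrite big_split/= big_ord_recl/= mul0r mul0r add0r.
rewrite [X in _ + X]big_ord_recr/= subnn mul0r mulr0 addr0.
rewrite -big_split/=; apply: eq_bigr => k _.
rewrite /bump/= add1n subSS risingS.
have kn : (k <= n)%N by rewrite -ltnS.
rewrite subSn// risingS natrB//.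
by ring.
Qed.

End GammaFunction.

(** * Convolution of regularly varying sequences *)

Section Convolution.
Context {R : realType}.

(** [B k j] is the contribution of time k when j steps remain. Moments lead to the diagonal j = n -
    k, whereas dual ergodicity controls the rectangles, where j is frozen. *)
Definition conv_diag (B : nat -> nat -> R) n : R := \sum_(k < n) B k (n - k)%N.
Definition conv_rect (B : nat -> nat -> R) n j : R := \sum_(k < n) B k j.
(** The function x^al at i/L, but with value 0 at i = 0 even for al = 0, where [powR] would give 1.
    Thus d(x^0) puts its unit mass in the first cell. *)
Definition grid_pow (al : R) L i : R := if i == 0%N then 0 else (i%:R / L%:R) `^ al.

Definition upper_sum al be L : R :=
  \sum_(i < L) (grid_pow al L i.+1 - grid_pow al L i) * grid_pow be L (L - i)%N.
Definition lower_sum al be L : R :=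
  \sum_(i < L) (grid_pow al L i.+1 - grid_pow al L i) * grid_pow be L (L - i.+1)%N.

(** For i N <= k < (i + 1) N the remaining time L N - k lies between (L - i - 1) N and (L - i) N;
    freezing it at either end of the block brackets the diagonal. *)
Lemma conv_diag_block (B : nat -> nat -> R) L N :
  (forall k, nondecreasing_seq (B k)) ->
  \sum_(i < L) (conv_rect B (i.+1 * N) ((L - i.+1) * N) -
                conv_rect B (i * N) ((L - i.+1) * N)) <= conv_diag B (L * N) /\
  conv_diag B (L * N) <=
  \sum_(i < L) (conv_rect B (i.+1 * N) ((L - i) * N) -
                conv_rect B (i * N) ((L - i) * N)).
Proof.
move=> Bnd.
have rectB i j : conv_rect B (i.+1 * N) j - conv_rect B (i * N) j =
    \sum_(i * N <= k < i.+1 * N) B k j.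
  rewrite /conv_rect -!(big_mkord xpredT (fun k => B k j)).
  by rewrite (@big_cat_nat _ _ _ (i * N) 0)//= ?leq_mul// [LHS]addrC addKr.
have diagE : conv_diag B (L * N) =
    \sum_(i < L) \sum_(i * N <= k < i.+1 * N) B k (L * N - k)%N.
  rewrite /conv_diag -(big_mkord xpredT (fun k => B k (L * N - k)%N)).
  pose F k := B k (L * N - k)%N.
  rewrite -[LHS]/(\sum_(0 <= k < L * N) F k).
  rewrite -[RHS]/(\sum_(i < L) \sum_(i * N <= k < i.+1 * N) F k).
  clearbody F; elim: L => [|l IH]; first by rewrite big_ord0 mul0n big_geq.
  by rewrite big_ord_recr/= -IH (@big_cat_nat _ _ _ (l * N) 0)//= leq_mul.
rewrite diagE; split; apply: ler_sum => i _; rewrite rectB;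
  rewrite big_nat_cond [leRHS]big_nat_cond;
  apply: ler_sum => k; rewrite andbT => /andP[ik ki]; apply: Bnd.
  by rewrite mulnBl leq_sub2l// ltnW.
by rewrite mulnBl leq_sub2l.
Qed.

Lemma cvg_sum_ord (n : nat) (u : 'I_n -> nat -> R) (l : 'I_n -> R) :
  (forall i, u i N @[N --> \oo] --> l i) ->
  (\sum_(i < n) u i N) @[N --> \oo] --> \sum_(i < n) l i.
Proof.
move=> h; elim: n u l h => [|n IH] u l h.
  by under eq_fun do rewrite big_ord0; rewrite big_ord0; exact: cvg_cst.
under eq_fun do rewrite big_ord_recr/=; rewrite big_ord_recr/=.
by apply: cvgD; [apply: IH => i|]; exact: h.
Qed.

Lemma conv_diag_sandwich (B : nat -> nat -> R) (s : nat -> R) (al be c : R) L (e : R) :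
  0 < e ->
  (forall k, nondecreasing_seq (B k)) -> (forall n, (0 < n)%N -> 0 < s n) ->
  (0 < L)%N ->
  (forall i j, (i <= L)%N -> (j <= L)%N ->
     conv_rect B (i * N) (j * N) / s (L * N)%N @[N --> \oo] -->
       c * (grid_pow al L i * grid_pow be L j)) ->
  \forall N \near \oo,
    c * lower_sum al be L - e <= conv_diag B (L * N) / s (L * N)%N <=
    c * upper_sum al be L + e.
Proof.
move=> e0 Bnd s0 L0 h.
pose sm (d : nat -> nat) N : R := \sum_(i < L)
  (conv_rect B (i.+1 * N) (d i * N) / s (L * N)%N -
   conv_rect B (i * N) (d i * N) / s (L * N)%N).
have smE (d : nat -> nat) : (forall i, (i < L)%N -> (d i <= L)%N) ->
    sm d N @[N --> \oo] --> c * \sum_(i < L)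
      (grid_pow al L i.+1 - grid_pow al L i) * grid_pow be L (d i).
  move=> dL; rewrite mulr_sumr; apply: cvg_sum_ord => i.
  rewrite mulrBl mulrBr; apply: cvgB; apply: h; rewrite ?dL//.
  exact: ltnW.
have hl := smE (fun i => L - i.+1)%N (fun i _ => leq_subr _ _).
have hu := smE (fun i => L - i)%N (fun i _ => leq_subr _ _).
near=> N.
have sN : 0 < s (L * N)%N.
  by apply: s0; rewrite muln_gt0 L0/=; near: N; exact: nbhs_infty_gt.
have [lo up] := conv_diag_block L N Bnd.
apply/andP; split.
  apply: (@le_trans _ _ (sm (fun i => L - i.+1)%N N)).
    by near: N; apply: (cvgr_ge _ hl); rewrite ltrBlDr ltrDl.
  by rewrite /sm; under eq_bigr do rewrite -mulrBl;
    rewrite -mulr_suml ler_pM2r ?invr_gt0.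
apply: (@le_trans _ _ (sm (fun i => L - i)%N N)).
  by rewrite /sm; under eq_bigr do rewrite -mulrBl;
    rewrite -mulr_suml ler_pM2r ?invr_gt0.
near: N; apply: (cvgr_le _ hu); rewrite ltrDl//.
Unshelve. all: by end_near. Qed.

(** The Beta integral of (1 - x)^be against d(x^al) over [0, 1]; at al = 0 it is 1, in accordance
    with the unit mass at 0. *)
Definition conv_limit (al be : R) : R :=
  Gamma (1 + al) * Gamma (1 + be) / Gamma (1 + (al + be)).

(* Cumulated weights [rising (1 + al)], shifted by one: the discrete analogue of
   [x ^ al / Gamma (1 + al)] for which the convolution is explicit. *)
Definition rising_cum (al : R) n : R := if n is n'.+1 then rising (1 + al) n' else 0.

(** Vandermonde against [rising 1], which is constantly 1. *)
Lemma rising_cum_sum (al : R) n : \sum_(k < n) rising al k = rising_cum al n.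
Proof.
case: n => [|n]; first by rewrite big_ord0.
rewrite /= addrC -rising_Vandermonde; apply: eq_bigr => k _.
suff -> : forall j, rising 1 j = 1 :> R by rewrite mulr1.
elim=> [|j IH]; first exact: rising0.
apply: (@mulfI _ j.+1%:R); first by rewrite pnatr_eq0.
by rewrite risingS IH !mulr1 -natr1 addrC.
Qed.

Lemma rising_cum_cvg (al : R) : 0 <= al ->
  rising_cum al n / n%:R `^ al @[n --> \oo] --> (Gamma (1 + al))^-1.
Proof.
move=> al0.
have h1 : 1 + al * n%:R^-1 @[n --> \oo] --> (1 : R).
  rewrite -[X in _ --> X]addr0; apply: cvgD; first exact: cvg_cst.
  by rewrite -[X in _ --> X](mulr0 al); apply: cvgMr; exact: invn_cvg0.
have h2 : rising (1 + al) n / n%:R `^ al * (1 + al * n%:R^-1)^-1 @[n --> \oo] -->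
    (Gamma (1 + al))^-1.
  rewrite -[X in _ --> X]mulr1 -[X in _ * X]invr1.
  by apply: cvgM; [exact: rising_cvg|apply: cvgV => //; exact: oner_neq0].
apply: cvg_trans h2; apply: near_eq_cvg; near=> n.
have n0 : (0 < n)%N by near: n; exact: nbhs_infty_gt.
rewrite -(prednK n0) /=; set k := n.-1.
have k0 : 0 < k.+1%:R :> R by rewrite ltr0n.
have nal : 0 < 1 + al + k%:R by rewrite -addrA addrCA ltr_wpDl// addrC natr1.
have -> : rising (1 + al) k.+1 = (1 + al + k%:R) / k.+1%:R * rising (1 + al) k.
  by rewrite mulrAC -risingS; field; rewrite addrC natr1 pnatr_eq0.
have p0 : 0 < k.+1%:R `^ al :> R by rewrite powR_gt0.
have -> : 1 + al / k.+1%:R = (1 + al + k%:R) / k.+1%:R.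
  by rewrite -natr1; field; rewrite natr1 pnatr_eq0.
by field; rewrite !gt_eqF.
Unshelve. all: by end_near. Qed.

Lemma muln_cvgy (i : nat) : (0 < i)%N -> (fun N => i * N)%N @ \oo --> \oo.
Proof.
move=> i0 A [n _ hn]; exists n => // m /= nm; apply: hn => /=.
by rewrite (leq_trans nm)// leq_pmull.
Qed.

Lemma rising_cum_grid (al : R) L i : 0 <= al -> (0 < L)%N ->
  rising_cum al (i * N) / (L * N)%:R `^ al @[N --> \oo] -->
    grid_pow al L i / Gamma (1 + al).
Proof.
move=> al0 L0; rewrite /grid_pow; case: eqVneq => [->|i0].
  by under eq_fun do rewrite mul0n/= mul0r; rewrite mul0r; exact: cvg_cst.
have i0' : (0 < i)%N by rewrite lt0n.
have h : (i%:R / L%:R) `^ al * (rising_cum al (i * N) / (i * N)%:R `^ al)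
    @[N --> \oo] --> (i%:R / L%:R) `^ al * (Gamma (1 + al))^-1.
  by apply: cvgMr; apply: cvg_comp (rising_cum_cvg al0); exact: muln_cvgy.
apply: cvg_trans h; apply: near_eq_cvg; near=> N.
have N0 : 0 < N%:R :> R by rewrite ltr0n; near: N; exact: nbhs_infty_gt.
have iR : 0 < i%:R :> R by rewrite ltr0n.
have LR : 0 < L%:R :> R by rewrite ltr0n.
have -> : (i * N)%:R `^ al = (i%:R / L%:R) `^ al * (L * N)%:R `^ al :> R.
  rewrite -powRM ?divr_ge0//; congr powR; rewrite !natrM.
  by field; rewrite gt_eqF.
by field; rewrite !gt_eqF// powR_gt0 ?divr_gt0// natrM mulr_gt0.
Unshelve. all: by end_near. Qed.

Lemma conv_limit_sandwich (al be : R) L : 0 <= al -> 0 <= be -> (0 < L)%N ->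
  lower_sum al be L <= conv_limit al be <= upper_sum al be L.
Proof.
move=> al0 be0 L0.
pose B (k j : nat) : R := rising al k * rising_cum be j.
pose s (n : nat) : R := n%:R `^ al * n%:R `^ be.
pose c : R := (Gamma (1 + al) * Gamma (1 + be))^-1.
have g1 : 0 < Gamma (1 + al) by exact: Gamma1D_gt0.
have g2 : 0 < Gamma (1 + be) by exact: Gamma1D_gt0.
have c0 : 0 < c by rewrite invr_gt0 mulr_gt0.
have Bnd k : nondecreasing_seq (B k).
  apply/nondecreasing_seqP => -[|n]; rewrite /B/=; apply: ler_wpM2l; rewrite ?rising_ge0//.
  - by rewrite addr_ge0.
  - exact: rising_nondecreasing.
have s0 n : (0 < n)%N -> 0 < s n by move=> n0; rewrite mulr_gt0 ?powR_gt0 ?ltr0n.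
have rectE n j : conv_rect B n j = rising_cum al n * rising_cum be j.
  by rewrite /conv_rect -mulr_suml rising_cum_sum.
have rect_cvg i j : (i <= L)%N -> (j <= L)%N ->
   conv_rect B (i * N) (j * N) / s (L * N)%N @[N --> \oo] -->
     c * (grid_pow al L i * grid_pow be L j).
  move=> _ _.
  have -> : c * (grid_pow al L i * grid_pow be L j) =
      grid_pow al L i / Gamma (1 + al) * (grid_pow be L j / Gamma (1 + be)).
    by rewrite /c mulrC -mulf_div.
  rewrite (_ : (fun N => _) = (fun N => (rising_cum al (i * N) / (L * N)%:R `^ al) *
      (rising_cum be (j * N) / (L * N)%:R `^ be))).
    by apply: cvgM; exact: rising_cum_grid.
  by apply/funext => N; rewrite rectE /s invfM; ring.
(* For k < n the shift in [rising_cum] turns its value at n - k into [rising (1 + be)] at n - 1 - k,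
   so Vandermonde applies with total n - 1. *)
have diagE n : conv_diag B n = rising_cum (al + be) n.
  case: n => [|n]; first by rewrite /conv_diag big_ord0.
  rewrite /= addrCA -rising_Vandermonde /conv_diag; apply: eq_bigr => k _.
  by rewrite /B subSn// -ltnS.
have diag_cvg : conv_diag B (L * N) / s (L * N)%N @[N --> \oo] -->
    c * conv_limit al be.
  have -> : c * conv_limit al be = grid_pow (al + be) L L / Gamma (1 + (al + be)).
    rewrite /grid_pow gtn_eqF// divff ?pnatr_eq0 -?lt0n// powR1 /c /conv_limit.
    by rewrite mulrA mulVf// gt_eqF// mulr_gt0.
  have := @rising_cum_grid (al + be) L L (addr_ge0 al0 be0) L0; apply: cvg_trans.
  apply: near_eq_cvg; near=> N; rewrite diagE /s -powRD//.
  have N0 : (0 < N)%N by near: N; exact: nbhs_infty_gt.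
  by rewrite pnatr_eq0 muln_eq0 !gtn_eqF// implybT.
have key (e : R) : 0 < e ->
    c * lower_sum al be L <= c * conv_limit al be + e /\
    c * conv_limit al be <= c * upper_sum al be L + e.
  move=> e0.
  have h := conv_diag_sandwich e0 Bnd s0 L0 rect_cvg.
  split.
    rewrite -lerBlDr; apply: cvgr_to_ge diag_cvg _.
    by apply: filterS h => N /andP[].
  apply: cvgr_to_le diag_cvg _.
  by apply: filterS h => N /andP[].
by apply/andP; split; rewrite -(ler_pM2l c0); apply/ler_addgt0Pr => e e0;
  have [] := key e e0.
Unshelve. all: by end_near. Qed.

(** By concavity the first increment is the largest one: (1 + 1/i)^al <= 1 + al/i, and al i^al <=
    i. *)
Lemma grid_pow_incr (al : R) L i : 0 < al <= 1 -> (0 < L)%N ->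
  0 <= grid_pow al L i.+1 - grid_pow al L i <= L%:R^-1 `^ al.
Proof.
move=> /andP[al0 al1] L0.
have LR : 0 < L%:R^-1 :> R by rewrite invr_gt0 ltr0n.
rewrite /grid_pow/=; case: eqVneq => [->|i0].
  by rewrite subr0 mul1r powR_ge0 lexx.
have iR : 0 < i%:R :> R by rewrite ltr0n lt0n.
have SiR : 0 < i.+1%:R :> R by rewrite ltr0n.
rewrite !powRM ?(ltW SiR) ?(ltW iR) ?(ltW LR)// -mulrBl.
have p0 : 0 < L%:R^-1 `^ al by exact: powR_gt0.
apply/andP; split.
  rewrite mulr_ge0 ?(ltW p0)// subr_ge0; apply: ge0_ler_powR; rewrite ?nnegrE ?ltW//.
  by rewrite ltr_nat.
rewrite ger_pMl// lerBlDl.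
have i1 : 1 + i%:R^-1 <= 1 + i%:R^-1 :> R by [].
have q1 : 1 <= 1 + i%:R^-1 :> R by rewrite lerDl invr_ge0 ltW.
have -> : i.+1%:R = i%:R * (1 + i%:R^-1) :> R.
  by rewrite mulrDr mulr1 divff ?gt_eqF// natr1.
rewrite powRM ?(ltW iR) ?(le_trans _ q1)//.
have h : (1 + i%:R^-1) `^ al <= 1 + al * i%:R^-1 :> R.
  have := @powR_le_tangent _ al 1 (1 + i%:R^-1).
  rewrite powR1 ltW//= al1 => /(_ isT ltr01 (le_trans ler01 q1)) h.
  by apply: (le_trans h); apply/eqW; field; rewrite gt_eqF.
apply: (le_trans (ler_wpM2l (powR_ge0 _ _) h)).
rewrite mulrDr mulr1 lerD2l.
have ia : i%:R `^ al <= i%:R :> R.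
  by apply: ler1_powR => //; rewrite ler1n lt0n.
rewrite (@le_trans _ _ (i%:R * (1 * i%:R^-1)))//.
  by rewrite ler_pM ?powR_ge0 ?mulr_ge0 ?invr_ge0 ?ler_pM2r ?invr_gt0 ?(ltW al0) ?(ltW iR).
by rewrite mul1r divff// gt_eqF.
Qed.

Lemma grid_pow_telescope (be : R) L : (0 < L)%N ->
  \sum_(i < L) (grid_pow be L (L - i)%N - grid_pow be L (L - i.+1)%N) = 1.
Proof.
move=> L0.
rewrite -(big_mkord xpredT (fun i => grid_pow be L (L - i)%N - grid_pow be L (L - i.+1)%N)).
rewrite -[LHS]opprK -sumrN.
under eq_bigr do rewrite opprB.
rewrite (telescope_sumr (fun i => grid_pow be L (L - i)%N))//.
by rewrite subnn subn0 /grid_pow eqxx gtn_eqF// divff ?pnatr_eq0 -?lt0n// powR1 sub0r opprK.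
Qed.

Lemma grid_pow_homo (be : R) L i j : 0 <= be -> (i <= j)%N ->
  grid_pow be L i <= grid_pow be L j.
Proof.
move=> be0 ij; rewrite /grid_pow; have [i0|i0] := eqVneq i 0%N.
  by case: ifPn => // _; exact: powR_ge0.
case: eqVneq => [j0|j0]; first by move: ij i0; rewrite j0 leqn0 => ->.
apply: ge0_ler_powR => //; rewrite ?nnegrE ?divr_ge0//.
by rewrite ler_wpM2r ?invr_ge0// ler_nat.
Qed.

(** The gap pairs increments of x^al, each at most L^(-al), with increments of (1 - x)^be, which sum
    to 1. *)
Lemma upper_lower_sum_gap (al be : R) (e : R) : 0 <= al <= 1 -> 0 <= be ->
  (al = 0 -> be = 0) -> 0 < e ->
  exists2 L, (0 < L)%N & upper_sum al be L - lower_sum al be L <= e.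
Proof.
move=> /andP[al0 al1] be0 albe e0.
have gapE L : upper_sum al be L - lower_sum al be L =
    \sum_(i < L) (grid_pow al L i.+1 - grid_pow al L i) *
      (grid_pow be L (L - i)%N - grid_pow be L (L - i.+1)%N).
  rewrite /upper_sum /lower_sum -sumrB; apply: eq_bigr => i _.
  by rewrite mulrBr.
move: al0; rewrite le_eqVlt => /predU1P[al0|al0].
  (* For al = be = 0 one factor jumps in the first cell only and the other in the last only; with
     two cells these differ and the gap is 0. *)
  exists 2%N => //; rewrite gapE !big_ord_recr big_ord0/= -al0 albe//.
  by rewrite /grid_pow/= !powRr0 !subrr !mul0r mulr0 !addr0 ltW.
have : (L%:R^-1 : R) `^ al @[L --> \oo] --> (0 : R).
  have /cvgrPdist_le h := @powR_cvg0 R al al0.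
  apply/cvgrPdist_le => /= d d0.
  have [r /= r0 hr] := h d d0.
  near=> L.
  have L0 : 0 < L%:R :> R by rewrite ltr0n; near: L; exact: nbhs_infty_gt.
  apply: hr; rewrite /= ?invr_gt0// sub0r normrN ger0_norm ?invr_ge0 ?ltW//.
  rewrite invf_plt ?posrE//.
  by near: L; exact: nbhs_infty_gtr.
move=> /cvgrPdist_le /(_ e e0)[L _ hL].
exists L.+1 => //.
rewrite gapE -[leRHS]mulr1 -(grid_pow_telescope be (ltn0Sn L)) mulr_sumr.
apply: ler_sum => i _.
apply: ler_wpM2r; first by rewrite subr_ge0 grid_pow_homo// leq_sub2l.
have /andP[_ h] := @grid_pow_incr al L.+1 i (introT andP (conj al0 al1)) (ltn0Sn L).
apply: (le_trans h); have /= := hL L.+1 (leqnSn L).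
by rewrite sub0r normrN ger0_norm// powR_ge0.
Unshelve. all: by end_near. Qed.

Lemma shift_ratio_cvg (s : nat -> R) r : (forall n, (0 < n)%N -> 0 < s n) ->
  s n.+1 / s n @[n --> \oo] --> (1 : R) -> s (n + r)%N / s n @[n --> \oo] --> (1 : R).
Proof.
move=> s0 h; elim: r => [|r IH].
  have : (1 : R) @[n --> \oo] --> (1 : R) by exact: cvg_cst.
  apply: cvg_trans; apply: near_eq_cvg; near=> n.
  by rewrite addn0 divff// gt_eqF// s0//; near: n; exact: nbhs_infty_gt.
have h1 : s (n + r).+1 / s (n + r)%N @[n --> \oo] --> (1 : R).
  exact: (cvg_comp (fun n => n + r)%N (fun n => s n.+1 / s n) (@cvg_addnr r) h).
have h2 : s (n + r).+1 / s (n + r)%N * (s (n + r)%N / s n) @[n --> \oo] --> (1 : R).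
  by rewrite -[X in _ --> X]mul1r; exact: cvgM.
apply: cvg_trans h2; apply: near_eq_cvg; near=> n.
have n0 : (0 < n)%N by near: n; exact: nbhs_infty_gt.
have x0 : 0 < s n by exact: s0.
have y0 : 0 < s (n + r)%N by rewrite s0// ltn_addr.
by rewrite addnS; field; rewrite !gt_eqF.
Unshelve. all: by end_near. Qed.

(** n exceeds a multiple of L by one of finitely many residues, so the limits for fixed shifts hold
    uniformly over them. *)
Lemma floor_ratio_cvg (s : nat -> R) L : (0 < L)%N -> (forall n, (0 < n)%N -> 0 < s n) ->
  s n.+1 / s n @[n --> \oo] --> (1 : R) ->
  s n / s (L * (n %/ L))%N @[n --> \oo] --> (1 : R).
Proof.
move=> L0 s0 h.
suff H (e : R) : 0 < e -> forall M, \forall n \near \oo,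
    forall r, (r < M)%N -> `|1 - s (n + r)%N / s n| <= e.
  apply/cvgrPdist_le => e e0; have [n0 _ hn] := H e e0 L.
  exists (L * n0)%N => // n /= Ln.
  have h1 : (n0 <= L * (n %/ L))%N.
    have : (n0 <= n %/ L)%N by rewrite leq_divRL// mulnC.
    by move/leq_trans; apply; rewrite leq_pmull.
  have := hn _ h1 (n %% L)%N; rewrite ltn_mod => /(_ L0).
  by rewrite mulnC -divn_eq.
move=> e0; elim=> [|M IH]; first by near=> n.
have /cvgrPdist_le/(_ e e0) hM := shift_ratio_cvg M s0 h.
near=> n => r; rewrite ltnS leq_eqVlt => /predU1P[->|].
  by near: n.
by move: r; near: n.
Unshelve. all: by end_near. Qed.

Lemma conv_diag_nondecreasing (B : nat -> nat -> R) :
  (forall k j, 0 <= B k j) -> (forall k, nondecreasing_seq (B k)) ->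
  nondecreasing_seq (conv_diag B).
Proof.
move=> B0 Bnd; apply/nondecreasing_seqP => n.
rewrite /conv_diag big_ord_recr/= -[leLHS]addr0 lerD//.
by apply: ler_sum => i _; apply: Bnd; rewrite leq_sub2r.
Qed.

(** L is fixed first, making the gap small; the sandwich then locates the diagonal along multiples
    of L. Its monotonicity, together with s(n + 1)/s(n) -> 1, carries the estimate to all n. *)
Lemma conv_diag_cvg (B : nat -> nat -> R) (s : nat -> R) (al be c : R) :
  0 <= al <= 1 -> 0 <= be -> (al = 0 -> be = 0) -> 0 <= c ->
  (forall k j, 0 <= B k j) -> (forall k, nondecreasing_seq (B k)) ->
  (forall n, (0 < n)%N -> 0 < s n) -> s n.+1 / s n @[n --> \oo] --> (1 : R) ->
  (forall L i j, (0 < L)%N -> (i <= L)%N -> (j <= L)%N ->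
     conv_rect B (i * N) (j * N) / s (L * N)%N @[N --> \oo] -->
       c * (grid_pow al L i * grid_pow be L j)) ->
  conv_diag B n / s n @[n --> \oo] --> c * conv_limit al be.
Proof.
move=> al01 be0 albe c0 B0 Bnd s0 s1 h.
have al0 : 0 <= al by case/andP: al01.
have c1 : 0 < c + 1 by rewrite ltr_wpDl.
apply/cvgrPdist_le => /= e e0.
(* One quarter of e goes to the gap and one to the sandwich; the rest absorbs the ratios of [s]. The
   denominator is c + 1 because c may be 0. *)
have e4 : 0 < e / 4 / (c + 1) by rewrite !divr_gt0.
have [L L0 gap] := upper_lower_sum_gap al01 be0 albe e4.
have /andP[lo up] := conv_limit_sandwich al0 be0 L0.
set q := c * conv_limit al be.
have e40 : 0 < e / 4 by rewrite divr_gt0.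
have cgap : c * (e / 4 / (c + 1)) <= e / 4.
  rewrite mulrCA ger_pMr// ler_pdivrMr// mul1r lerDl//.
have qlo : q - e / 4 <= c * lower_sum al be L.
  rewrite lerBlDr -lerBlDl -mulrBr (le_trans _ cgap)// ler_wpM2l//.
  by rewrite (le_trans _ gap)// lerD2r.
have qup : c * upper_sum al be L <= q + e / 4.
  rewrite -lerBlDl -mulrBr (le_trans _ cgap)// ler_wpM2l//.
  by rewrite (le_trans _ gap)// lerD2l lerN2.
have [N0 _ hN0] := conv_diag_sandwich e40 Bnd s0 L0 (fun i j => h L i j L0).
have r1 := floor_ratio_cvg L0 s0 s1.
have r1V : (s n / s (L * (n %/ L))%N)^-1 @[n --> \oo] --> (1 : R).
  by rewrite -[X in _ --> X]invr1; apply: cvgV => //; exact: oner_neq0.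
have r2 : s (n + L)%N / s n @[n --> \oo] --> (1 : R) by exact: shift_ratio_cvg.
have r2' : s (L * (n %/ L) + L)%N / s (L * (n %/ L))%N @[n --> \oo] --> (1 : R).
  apply: cvg_comp r2 => A [n _ hn]; exists (L * n)%N => // m /= nm; apply: hn => /=.
  have : (n <= m %/ L)%N by rewrite leq_divRL// mulnC.
  by move/leq_trans; apply; rewrite leq_pmull.
have r3 : s (L * (n %/ L) + L)%N / s (L * (n %/ L))%N *
    (s n / s (L * (n %/ L))%N)^-1 @[n --> \oo] --> (1 : R).
  by rewrite -[X in _ --> X]mulr1; exact: cvgM.
have lolim : (q - e / 4 - e / 4) * (s n / s (L * (n %/ L))%N)^-1 @[n --> \oo] -->
    q - e / 4 - e / 4.
  by rewrite -[X in _ --> X]mulr1; apply: cvgMr.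
have uplim : (q + e / 4 + e / 4) * (s (L * (n %/ L) + L)%N / s (L * (n %/ L))%N *
    (s n / s (L * (n %/ L))%N)^-1) @[n --> \oo] --> q + e / 4 + e / 4.
  by rewrite -[X in _ --> X]mulr1; apply: cvgMr.
near=> n.
have n0 : (0 < n)%N by near: n; exact: nbhs_infty_gt.
have nL : (N0.+1 <= n %/ L)%N.
  by rewrite leq_divRL//; near: n; exact: nbhs_infty_ge.
have sn : 0 < s n by exact: s0.
have sL : 0 < s (L * (n %/ L))%N by rewrite s0// muln_gt0 L0 (leq_trans _ nL).
have sL' : 0 < s (L * (n %/ L) + L)%N by rewrite s0// addn_gt0 L0 orbT.
have Tnd := conv_diag_nondecreasing B0 Bnd.
have lob : q - e <= conv_diag B n / s n.
  apply: (@le_trans _ _ ((q - e / 4 - e / 4) * (s n / s (L * (n %/ L))%N)^-1)).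
    near: n; apply: (cvgr_ge _ lolim); lra.
  rewrite invf_div mulrA ler_pM2r ?invr_gt0//.
  apply: (@le_trans _ _ (conv_diag B (L * (n %/ L)))).
    rewrite -ler_pdivlMr//.
    have /andP[+ _] := hN0 _ (ltnW nL); apply: le_trans; exact: lerB.
  by apply: Tnd; rewrite mulnC leq_trunc_div.
have upb : conv_diag B n / s n <= q + e.
  apply: (@le_trans _ _ ((q + e / 4 + e / 4) * (s (L * (n %/ L) + L)%N /
      s (L * (n %/ L))%N * (s n / s (L * (n %/ L))%N)^-1))).
    rewrite (_ : _ * (s n / s (L * (n %/ L))%N)^-1 = s (L * (n %/ L) + L)%N / s n).
      rewrite mulrA ler_pM2r ?invr_gt0//.
      apply: (@le_trans _ _ (conv_diag B (L * (n %/ L) + L))).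
        by apply: Tnd; rewrite -mulnSr mulnC ltnW// ltn_ceil.
      rewrite -ler_pdivrMr// -mulnSr.
      have /andP[_ +] := hN0 _ (leqW (ltnW nL)); move/le_trans; apply.
      by rewrite lerD2r.
    by field; rewrite !gt_eqF.
  near: n; apply: (cvgr_le _ uplim); lra.
by rewrite ler_distlC lob.
Unshelve. all: by end_near. Qed.

End Convolution.

(** * Approximation of test functions and Laplace transforms *)

Section Bernstein.
Context {R : realType}.
Local Open Scope ring_scope.

(* The Bernstein polynomial of degree [n] with nodes [f 0, ..., f n], built by
   conditioning on the first of [n] Bernoulli trials. *)
Fixpoint bernstein (n : nat) (f : nat -> R) : {poly R} :=
  if n is n'.+1 then 'X * bernstein n' (fun k => f k.+1) + (1 - 'X) * bernstein n' f
  else (f 0%N)%:P.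

Lemma bernsteinS n f y : (bernstein n.+1 f).[y] =
  y * (bernstein n (fun k => f k.+1)).[y] + (1 - y) * (bernstein n f).[y].
Proof. by rewrite /= !hornerE. Qed.

Lemma bernstein_le n (f g : nat -> R) (y : R) : 0 <= y <= 1 ->
  (forall k, (k <= n)%N -> f k <= g k) -> (bernstein n f).[y] <= (bernstein n g).[y].
Proof.
move=> /andP[y0 y1]; elim: n f g => [|n IH] f g fg; first by rewrite !hornerE fg.
rewrite !bernsteinS lerD// ler_wpM2l ?subr_ge0// IH// => k kn; rewrite fg//.
exact: leqW.
Qed.

(** The second moment of a binomial variable shifted by c; a general shift is needed because the
    recursion moves the nodes by one. *)
Lemma bernstein_quadratic n (y a b c : R) :
  (bernstein n (fun k => a + b * (k%:R + c) ^+ 2)).[y] =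
  a + b * ((n%:R * y + c) ^+ 2 + n%:R * (y * (1 - y))).
Proof.
elim: n c => [|n IH] c; first by rewrite !hornerE; ring.
rewrite bernsteinS IH.
rewrite (_ : (fun k : nat => _) = (fun k => a + b * (k%:R + (c + 1)) ^+ 2)); last first.
  by apply/funext => k; rewrite -natr1; ring.
by rewrite IH -natr1; ring.
Qed.

Lemma uniform_continuity_01 (h : R -> R) : continuous h ->
  forall e : R, 0 < e -> exists2 del : R, 0 < del & forall x y : R, 0 <= x <= 1 ->
    `|y - x| < del -> `|h y - h x| <= e.
Proof.
move=> ch e e0.
have e2 : 0 < e / 2 by rewrite divr_gt0.
have /compact_near_coveringP cov := @segment_compact R 0 1.
pose P (del x : R) := forall y : R, `|y - x| < del -> `|h y - h x| <= e.
have H : \forall del \near (0 : R)^'+, `[0, 1]%classic `<=` P del.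
  apply: cov => x _.
  have /cvgrPdist_le/(_ _ e2)[/= d d0 hd] := ch x.
  exists (ball x (d / 2), [set del | 0 < del /\ del < d / 2]) => /=.
    split; first by apply: nbhsx_ballx; rewrite divr_gt0.
    near=> del; split; near: del; first exact: nbhs_right_gt.
    by apply: nbhs_right_lt; rewrite divr_gt0.
  move=> [x' del]/= [xx' [del0 deld]] y yx'; rewrite /ball/= in xx'.
  have h1 : `|h x - h x'| <= e / 2.
    by apply: hd; rewrite /ball/= (lt_le_trans xx')// ler_pdivrMr// mulr_natr mulr2n lerDl ltW.
  have h2 : `|h x - h y| <= e / 2.
    apply: hd; rewrite /ball/=.
    rewrite (_ : x - y = (x - x') - (y - x')); last by ring.
    rewrite (le_lt_trans (ler_normB _ _))//.
    by have := ltrD xx' (lt_trans yx' deld); rewrite -splitr.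
  rewrite (_ : h y - h x' = (h x - h x') - (h x - h y)); last by ring.
  by rewrite (le_trans (ler_normB _ _))// [leRHS]splitr lerD.
have : \forall del \near (0 : R)^'+, 0 < del /\ forall x y, 0 <= x <= 1 ->
    `|y - x| < del -> `|h y - h x| <= e.
  near=> del; split; first by near: del; exact: nbhs_right_gt.
  move=> x y x01; have hx : `[0, 1]%classic x by rewrite /= in_itv.
  by move: y; move: x hx {x01}; near: del; exact: H.
by move=> /filter_ex[del [d0 hd]]; exists del.
Unshelve. all: by end_near. Qed.

(** With b = 2 M / del^2, |h y - h x| <= e/2 + b (y - x)^2 on [0, 1]: uniform continuity when x and
    y are close, the bound M of |h| otherwise. The Bernstein operator is monotone and knows
    quadratics exactly, and the variance y (1 - y) / n is small. *)
Lemma bernstein_approx (h : R -> R) : continuous h ->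
  forall e : R, 0 < e -> exists p : {poly R}, forall y : R, 0 <= y <= 1 -> `|h y - p.[y]| <= e.
Proof.
move=> ch e e0.
have [c c01 hc] : exists2 c, c \in `[0, 1] & forall t, t \in `[0, 1] ->
    `|h t| <= `|h c|.
  apply: (@EVT_max R (fun t => `|h t|)) => //.
  apply: continuous_subspaceT => x; apply: continuous_comp; first exact: ch.
  exact: norm_continuous.
pose M : R := `|h c|.
have M0 : 0 <= M by exact: normr_ge0.
have e2 : 0 < e / 2 by rewrite divr_gt0.
have [del d0 hdel] := uniform_continuity_01 ch e2.
pose b : R := 2 * M / del ^+ 2.
have b0 : 0 <= b by rewrite divr_ge0 ?sqr_ge0// mulr_ge0.
have ptw x y : 0 <= x <= 1 -> 0 <= y <= 1 ->
    `|h y - h x| <= e / 2 + b * (y - x) ^+ 2.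
  move=> x01 y01; have [xy|xy] := ltP `|y - x| del.
    by rewrite (le_trans (hdel _ _ x01 xy))// lerDl mulr_ge0// sqr_ge0.
  rewrite (@le_trans _ _ (2 * M))//.
    by rewrite (le_trans (ler_normB _ _))// mulr_natl mulr2n lerD// hc// in_itv.
  rewrite (@le_trans _ _ (b * (y - x) ^+ 2))//; last by rewrite lerDr ltW.
  rewrite /b -mulrA ler_peMr ?mulr_ge0//.
  rewrite mulrC ler_pdivlMr ?exprn_gt0// mul1r -[leRHS]real_normK ?num_real//.
  by rewrite lerXn2r// nnegrE ltW.
pose n := (Num.bound (b / e)).+1.
have n0 : 0 < n%:R :> R by rewrite ltr0n.
have nb : b / n%:R <= e.
  rewrite ler_pdivrMr// mulrC -ler_pdivrMr//.
  have : b / e < (Num.bound (b / e))%:R by rewrite archi_boundP// divr_ge0// ltW.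
  by move/ltW/le_trans; apply; rewrite ler_nat.
exists (bernstein n (fun k => h (k%:R / n%:R))) => y y01.
have /andP[y0 y1] := y01.
pose q := b / n%:R ^+ 2.
have q0 : 0 <= q by rewrite divr_ge0// sqr_ge0.
have kb k : (k <= n)%N ->
    `|h y - h (k%:R / n%:R)| <= e / 2 + q * (k%:R + - (n%:R * y)) ^+ 2.
  move=> kn; have k01 : 0 <= (k%:R / n%:R : R) <= 1.
    by rewrite divr_ge0//= ler_pdivrMr// mul1r ler_nat.
  apply: (le_trans (ptw _ _ k01 y01)).
  by rewrite lerD2l /q; apply/eqW; field; rewrite gt_eqF.
have var : q * ((n%:R * y - n%:R * y) ^+ 2 + n%:R * (y * (1 - y))) <= e / 2.
  rewrite subrr expr0n/= add0r (_ : q * _ = b / n%:R * (y * (1 - y))); last first.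
    by rewrite /q; field; rewrite gt_eqF.
  have yy : y * (1 - y) <= 2^-1.
    rewrite -subr_ge0 (_ : _ - _ = (y - 2^-1) ^+ 2 + 4^-1); last by field.
    by rewrite addr_ge0 ?sqr_ge0.
  have yy0 : 0 <= y * (1 - y) by rewrite mulr_ge0// subr_ge0.
  by rewrite ler_pM// divr_ge0// ltW.
rewrite ler_norml; apply/andP; split.
  rewrite lerNl opprB lerBlDr.
  have := @bernstein_le n (fun k => h (k%:R / n%:R))
    (fun k => (h y + e / 2) + q * (k%:R + - (n%:R * y)) ^+ 2) y y01.
  rewrite bernstein_quadratic => /(_ _)/wrap[k kn|].
    have := kb k kn; rewrite ler_norml => /andP[+ _].
    by move: (h y) (h _) (q * _) => u v w; lra.
  by move/le_trans; apply; move: var; move: (h y) (q * _) => u w; lra.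
have := @bernstein_le n (fun k => (h y - e / 2) + (- q) * (k%:R + - (n%:R * y)) ^+ 2)
  (fun k => h (k%:R / n%:R)) y y01.
rewrite bernstein_quadratic => /(_ _)/wrap[k kn|].
  have := kb k kn; rewrite ler_norml mulNr => /andP[_].
  by move: (h y) (h _) (q * _) => u v w; lra.
rewrite mulNr; move: var; move: (h y) (q * _) (_.[y]) => u w z; lra.
Qed.

End Bernstein.

(** * Test functions on [0, oo] in the variable e^(-x) *)

Section TestFunctions.
Context {R : realType}.
Variable g : \bar R -> R.
Hypothesis cg : {within [set y | (0 <= y)%E], continuous g}.

Lemma test_fun_continuous_fin (x e : R) : 0 <= x -> 0 < e ->
  \forall y \near x, 0 <= y -> `|g x%:E - g y%:E| <= e.
Proof.
move=> x0 e0; have /subspace_continuousP/(_ x%:E) := cg.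
rewrite /= lee_fin => /(_ x0)/cvgrPdist_le/(_ e e0) h.
have {}h : \forall y \near x%:E, (0 <= y)%E -> `|g x%:E - g y| <= e by exact: h.
by move/nbhs_EFin : h; apply: filterS => y hy y0; apply: hy; rewrite lee_fin.
Qed.

Lemma test_fun_continuous_pinfty (e : R) : 0 < e ->
  exists A : R, forall y, A < y -> 0 <= y -> `|g +oo%E - g y%:E| <= e.
Proof.
move=> e0; have /subspace_continuousP/(_ +oo%E) := cg.
rewrite /= => /(_ (leey _))/cvgrPdist_le/(_ e e0) h.
have [A [_ hA]] : \forall y \near +oo%E, (0 <= y)%E -> `|g +oo%E - g y| <= e by exact: h.
by exists A => y Ay y0; apply: hA; rewrite ?lee_fin// lte_fin.
Qed.

Lemma test_fun_pos_continuous : continuous (fun x : R => g (Num.max x 0)%:E).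
Proof.
move=> x; apply/cvgrPdist_le => e e0.
have m0 : 0 <= Num.max x 0 by rewrite le_max lexx orbT.
have h := test_fun_continuous_fin m0 e0.
have cm : {for x, continuous (fun x : R => Num.max x 0)}.
  by apply: continuous_max; [exact: cvg_id|exact: cvg_cst].
near=> y.
have : 0 <= Num.max y 0 by rewrite le_max lexx orbT.
by near: y; exact: cm _ h.
Unshelve. all: by end_near. Qed.

(** The test function read in y = e^(-x) and extended by constants below 0 and above 1, so as to be
    continuous on the whole line. Continuity at y = 0 is that of [g] at +oo. *)
Lemma test_fun_exp_continuous : continuous (fun y : R =>
  if y <= 0 then g +oo%E else g (Num.max (- ln y) 0)%:E).
Proof.
move=> y; have [y0|y0|y0] := ltgtP y 0.
- apply: (near_cst_continuous (g +oo%E)); near=> z.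
  have -> // : z <= 0.
  by apply: ltW; near: z; exact: (@lt_nbhsl _ y 0).
- rewrite /continuous_at leNgt y0/=.
  have : (g (Num.max (- ln z) 0)%:E) @[z --> y] --> g (Num.max (- ln y) 0)%:E.
    apply: (@continuous_comp _ _ _ (fun z => - ln z) (fun x : R => g (Num.max x 0)%:E)).
      by apply: continuousN; exact: continuous_ln.
    exact: test_fun_pos_continuous.
  apply: cvg_trans; apply: near_eq_cvg; near=> z.
  by rewrite leNgt; have -> : 0 < z by near: z; exact: lt_nbhsr.
- apply/cvgrPdist_le => e e0; rewrite y0 lexx.
  have [A hA] := test_fun_continuous_pinfty e0.
  near=> z; have [z0|z0] := leP z 0; first by rewrite subrr normr0 ltW.
  apply: hA; last by rewrite le_max lexx orbT.
  rewrite lt_max ltrNr -ltr_expR lnK ?posrE//.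
  apply/orP; left; near: z; exact: (@lt_nbhsl _ 0 _ (expR_gt0 _)).
Unshelve. all: by end_near. Qed.

Lemma test_fun_exp_approx (e : R) : 0 < e ->
  exists p : {poly R}, forall x : R, 0 <= x -> `|g x%:E - p.[expR (- x)]| <= e.
Proof.
move=> e0; have [p hp] := bernstein_approx test_fun_exp_continuous e0.
exists p => x x0; have := hp (expR (- x)).
rewrite expR_ge0 -[X in _ <= X]expR0 ler_expR oppr_le0 x0 => /(_ isT).
by rewrite [expR _ <= 0]leNgt expR_gt0/= expRK opprK max_l.
Qed.

End TestFunctions.

(** * Alternating Taylor bounds for e^(-x) *)

Section ExpTaylor.
Context {R : realType}.

Definition expN_taylor (K : nat) (x : R) : R := \sum_(k < K) (- x) ^+ k / k`!%:R.

Lemma ge0_derive_from0 (f df : R -> R) (x : R) :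
  (forall t : R, is_derive t 1 f (df t)) -> f 0 = 0 -> (forall t, 0 <= t -> 0 <= df t) ->
  0 <= x -> 0 <= f x.
Proof.
move=> fd f0 df0 x0.
have [|c] := MVT_segment x0 (fun t _ => fd t).
  apply: continuous_subspaceT => t; apply: differentiable_continuous.
  by apply/derivable1_diffP; have [] := fd t.
rewrite in_itv/= f0 subr0 subr0 => /andP[c0 _] ->.
by rewrite mulr_ge0// df0.
Qed.

Lemma is_derive_expN_taylor k (t : R) :
  is_derive t 1 (expN_taylor k.+1) (- expN_taylor k t).
Proof.
elim: k => [|k IHk].
  rewrite /expN_taylor big_ord0 oppr0 (_ : (fun _ => _) = cst 1).
    exact: is_derive_cst.
  by apply/funext => z; rewrite big_ord_recr big_ord0/= add0r expr0 divr1.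
have d1 := is_deriveZ ((k.+1)`!%:R^-1) (is_deriveX k.+1 (is_deriveNid t (1 : R))).
have := is_deriveD IHk d1.
rewrite (_ : expN_taylor k.+1 + _ = expN_taylor k.+2); last first.
  apply/funext => z; rewrite /expN_taylor [in RHS]big_ord_recr/=.
  by rewrite !fctE/= /GRing.scale/= [X in _ + X]mulrC.
move=> h; apply: is_derive_eq; rewrite /expN_taylor big_ord_recr/=.
rewrite /GRing.scale/= factS natrM.
by field; rewrite gt_eqF ?ltr0n ?fact_gt0//= addrC natr1 pnatr_eq0.
Qed.

(** With the sign (-1)^K the remainder of order K + 1 vanishes at 0 and has the remainder of order K
    as derivative, so both bounds pass from K to K + 1. *)
Lemma expN_taylor_bounds (K : nat) (x : R) : 0 <= x ->
  0 <= (-1) ^+ K * (expR (- x) - expN_taylor K x) <= x ^+ K / K`!%:R.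
Proof.
elim: K x => [|K IH] x x0.
  by rewrite /expN_taylor big_ord0 subr0 !expr0 mul1r divr1 expR_ge0/= -expR0 ler_expR oppr_le0.
pose r K (x : R) : R := (-1) ^+ K * (expR (- x) - expN_taylor K x).
have dr (t : R) : is_derive t 1 (r K.+1) (r K t).
  have d1 := is_deriveZ ((-1) ^+ K.+1)
    (is_deriveB (is_derive_expRN t) (is_derive_expN_taylor K t)).
  have := d1; rewrite (_ : _ \*: _ = r K.+1); last by apply/funext.
  by move=> h; apply: is_derive_eq; rewrite /r /GRing.scale/= exprS; ring.
have r0 : r K.+1 0 = 0.
  rewrite /r oppr0 expR0 /expN_taylor big_ord_recl/= expr0 divr1 big1; last first.
    by move=> i _; rewrite oppr0 expr0n/= mul0r.
  by rewrite addr0 subrr mulr0.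
apply/andP; split.
  by apply: (@ge0_derive_from0 (r K.+1) (r K)) => // t t0; have /andP[] := IH t t0.
rewrite -subr_ge0.
apply: (@ge0_derive_from0 (fun x => x ^+ K.+1 / (K.+1)`!%:R - r K.+1 x)
  (fun x => x ^+ K / K`!%:R - r K x)) => //.
- move=> t.
  have d1 := is_deriveZ ((K.+1)`!%:R^-1) (is_deriveX K.+1 (is_derive_id t (1 : R))).
  have := is_deriveB d1 (dr t).
  rewrite (_ : _ \*: _ - _ = (fun x => x ^+ K.+1 / (K.+1)`!%:R - r K.+1 x)); last first.
    by apply/funext => z; rewrite !fctE/= /GRing.scale/= mulrC.
  move=> h; apply: is_derive_eq; rewrite /GRing.scale/= factS natrM; congr (_ - _).
  by field; rewrite gt_eqF ?ltr0n ?fact_gt0//= addrC natr1 pnatr_eq0.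
- by rewrite expr0n/= mul0r r0 subrr.
- by move=> t t0; rewrite subr_ge0; have /andP[] := IH t t0.
Qed.

End ExpTaylor.

(** * From moments to Laplace transforms *)

Section MomentTransfer.
Context {R : realType}.

(** [x n p j] stands for the moment of order p damped by e^(-j del F). A Taylor step from j to j + 1
    involves all higher orders at j, hence the induction over every p at once. The remainder is
    bounded by undamped moments, at j = 0, so the step length need not shrink. *)
Lemma moment_transfer (x : nat -> nat -> nat -> R) (y : nat -> nat -> R) (del : R) :
  0 <= del ->
  (forall n p j K, `|x n p j.+1 - \sum_(k < K) (- del) ^+ k / k`!%:R * x n (p + k)%N j|
     <= del ^+ K / K`!%:R * x n (p + K)%N 0%N) ->
  (forall p j K, `|y p j.+1 - \sum_(k < K) (- del) ^+ k / k`!%:R * y (p + k)%N j|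
     <= del ^+ K / K`!%:R * y (p + K)%N 0%N) ->
  (forall p, x n p 0%N @[n --> \oo] --> y p 0%N) ->
  (forall p, del ^+ K / K`!%:R * y (p + K)%N 0%N @[K --> \oo] --> (0 : R)) ->
  forall j p, x n p j @[n --> \oo] --> y p j.
Proof.
move=> del0 hx hy h0 hK; elim=> [|j IH] p; first exact: h0.
apply/cvgrPdist_le => /= e e0.
have e4 : 0 < e / 4 by rewrite divr_gt0.
have /cvgrPdist_le/(_ _ e4)[K _ hKe] := hK p.
have {}hKe := hKe K (leqnn K).
have c1 : \sum_(k < K) (- del) ^+ k / k`!%:R * x n (p + k)%N j @[n --> \oo] -->
    \sum_(k < K) (- del) ^+ k / k`!%:R * y (p + k)%N j.
  by apply: cvg_sum_ord => i; apply: cvgMr; exact: IH.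
have c2 : del ^+ K / K`!%:R * x n (p + K)%N 0%N @[n --> \oo] -->
    del ^+ K / K`!%:R * y (p + K)%N 0%N.
  by apply: cvgMr; exact: h0.
have bE : del ^+ K / K`!%:R * y (p + K)%N 0%N <= e / 4.
  by move: hKe; rewrite /= sub0r normrN; apply: le_trans; exact: ler_norm.
near=> n.
have h1 := hx n p j K; have h2 := hy p j K.
have h3 : `|\sum_(k < K) (- del) ^+ k / k`!%:R * y (p + k)%N j -
    \sum_(k < K) (- del) ^+ k / k`!%:R * x n (p + k)%N j| <= e / 4.
  by near: n; move/cvgrPdist_le : c1; apply.
have h4 : `|del ^+ K / K`!%:R * y (p + K)%N 0%N -
    del ^+ K / K`!%:R * x n (p + K)%N 0%N| <= e / 4.
  by near: n; move/cvgrPdist_le : c2; apply.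
move: h1 h2 h3 h4 bE.
move: (\sum_(k < K) _ * x _ _ _) (\sum_(k < K) _ * y _ _) (_ * x _ _ 0%N) (_ * y _ 0%N).
move: (x n p j.+1) (y p j.+1) => X Y SX SY BX BY.
rewrite !ler_norml => /andP[a1 a2] /andP[b1 b2] /andP[c3 c4] /andP[d1 d2] f1.
by apply/andP; split; lra.
Unshelve. all: by end_near. Qed.

Lemma factorial_growth_cvg0 (y : nat -> R) (C D del : R) p :
  0 <= C -> 0 <= del -> 4 * C * del <= 1 -> (forall q, 0 <= y q <= D * (q`!%:R * C ^+ q)) ->
  del ^+ K / K`!%:R * y (p + K)%N @[K --> \oo] --> (0 : R).
Proof.
move=> C0 del0 Cdel yb.
have D0 : 0 <= D.
  by have /andP[+ h] := yb 0%N; move/le_trans => /(_ _ h); rewrite fact0 expr0 !mulr1.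
pose A : R := D * (p`!%:R * 2 ^+ p * C ^+ p).
apply: (@squeeze_cvgr _ _ _ _ (cst 0) (fun K : nat => A * (2^-1) ^+ K)).
- near=> K; have /andP[yl yu] := yb (p + K)%N.
  have dk : 0 <= del ^+ K / K`!%:R by rewrite divr_ge0 ?exprn_ge0.
  rewrite mulr_ge0//=; apply: (le_trans (ler_wpM2l dk yu)).
  have fK : 0 < K`!%:R :> R by rewrite ltr0n fact_gt0.
  (* A binomial coefficient is at most 2^(p + K). This factor is why 4 C del <= 1 is asked: it
     leaves (2 C del)^K <= 2^(-K). *)
  have h1 : (p + K)`!%:R <= K`!%:R * (p`!%:R * 2 ^+ (p + K)) :> R.
    rewrite -natrX -!natrM ler_nat.
    have := @bin_fact (p + K) p (leq_addr _ _).
    rewrite addKn => <-.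
    rewrite mulnA (mulnC _ K`!) leq_mul2l (mulnC p`!) leq_mul2r.
    suff -> : ('C(p + K, p) <= 2 ^ (p + K))%N by rewrite !orbT.
    rewrite (_ : 2 = 1 + 1)%N// expnDn (bigD1 (Ordinal (leq_addr K p : p < (p + K).+1)%N))//=.
    by rewrite !exp1n !muln1 leq_addr.
  have h2 : (C * del * 2) ^+ K <= 2^-1 ^+ K.
    by apply: lerXn2r; rewrite ?nnegrE ?mulr_ge0//; lra.
  apply: (@le_trans _ _ (del ^+ K / K`!%:R * (D * (K`!%:R * (p`!%:R * 2 ^+ (p + K)) * C ^+ (p + K))))).
    by rewrite ler_wpM2l// ler_wpM2l// ler_wpM2r// exprn_ge0.
  rewrite (_ : _ * _ = A * (C * del * 2) ^+ K).
    by rewrite ler_wpM2l// /A !mulr_ge0// ?exprn_ge0.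
  rewrite /A !exprD !exprMn; field; exact: lt0r_neq0.
- exact: cvg_cst.
- rewrite -[X in _ --> X](mulr0 A); apply: cvgMr; apply: cvg_expr.
  by rewrite ger0_norm ?invr_ge0// invf_lt1// ltr1n.
Unshelve. all: by end_near. Qed.

End MomentTransfer.

Section WeightedLaplace.
Context {R : realType} (d : measure_display) (T : measurableType d)
  (mu : {measure set T -> \bar R}) (u F : T -> R).
Hypothesis u0 : forall x, 0 <= u x.
Hypothesis F0 : forall x, 0 <= F x.
Hypothesis mF : measurable_fun [set: T] F.
Hypothesis iF : forall p : nat, mu.-integrable [set: T] (EFin \o (fun x => u x * F x ^+ p)).

Lemma integrable_laplace (p : nat) (s : R) : 0 <= s ->
  mu.-integrable [set: T] (EFin \o (fun x => u x * F x ^+ p * expR (- (s * F x)))).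
Proof.
move=> s0; apply: (le_integrable _ _ _ (iF p)) => //.
- apply/measurable_EFinP; apply: measurable_funM.
    by apply/measurable_EFinP; exact: measurable_int (iF p).
  apply: measurableT_comp => //; apply: measurableT_comp => //.
  exact: measurable_funM.
- move=> x _; rewrite /= lee_fin !normrM ler_piMr//.
  by rewrite ger0_norm ?expR_ge0// -expR0 ler_expR oppr_le0 mulr_ge0.
Qed.

Lemma laplace_taylor (p K : nat) (s del : R) : 0 <= s -> 0 <= del ->
  `|\int[mu]_x (u x * F x ^+ p * expR (- ((s + del) * F x))) -
    \sum_(k < K) (- del) ^+ k / k`!%:R *
      \int[mu]_x (u x * F x ^+ (p + k) * expR (- (s * F x)))|
  <= del ^+ K / K`!%:R * \int[mu]_x (u x * F x ^+ (p + K)).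
Proof.
move=> s0 del0.
have sumE : \sum_(k < K) (- del) ^+ k / k`!%:R *
      \int[mu]_x (u x * F x ^+ (p + k) * expR (- (s * F x))) =
    \int[mu]_x (u x * F x ^+ p * expR (- (s * F x)) * expN_taylor K (del * F x)) /\
    mu.-integrable [set: T] (EFin \o (fun x =>
      u x * F x ^+ p * expR (- (s * F x)) * expN_taylor K (del * F x))).
  elim: K => [|K [IH1 IH2]].
    rewrite big_ord0 /expN_taylor.
    under [X in _ = X /\ _]eq_Rintegral do rewrite big_ord0 mulr0.
    rewrite Rintegral_cst// mul0r; split => //.
    rewrite (_ : _ \o _ = cst 0%E); first exact: integrable0.
    by apply/funext => x /=; rewrite big_ord0 mulr0.
  have E : (fun x => u x * F x ^+ p * expR (- (s * F x)) * expN_taylor K.+1 (del * F x)) =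
     (fun x => (u x * F x ^+ p * expR (- (s * F x)) * expN_taylor K (del * F x)) +
      (- del) ^+ K / K`!%:R * (u x * F x ^+ (p + K) * expR (- (s * F x)))).
    apply/funext => x; rewrite /expN_taylor big_ord_recr/= mulrDr; congr (_ + _).
    by rewrite -(mulNr del) exprMn exprD; ring.
  have iK : mu.-integrable [set: T] (EFin \o (fun x => (- del) ^+ K / K`!%:R *
      (u x * F x ^+ (p + K) * expR (- (s * F x))))).
    have := integrableZl measurableT ((- del) ^+ K / K`!%:R) (integrable_laplace (p + K) s0).
    by apply: eq_integrable => // x _; rewrite /= -EFinM.
  rewrite E big_ord_recr/= IH1; split.
    by rewrite RintegralD// RintegralZl//; exact: integrable_laplace.
  exact: (integrableD measurableT IH2 iK).
have [-> iS] := sumE.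
have iL := integrable_laplace p (addr_ge0 s0 del0).
rewrite -RintegralB// -RintegralZl//.
apply: (le_trans (le_normr_Rintegral _ _)) => //.
  exact: (integrableB measurableT iL iS).
apply: le_Rintegral => //.
- by have := integrable_abse (integrableB measurableT iL iS).
- have := integrableZl measurableT (del ^+ K / K`!%:R) (iF (p + K)).
  by apply: eq_integrable => // x _; rewrite /= -EFinM.
- move=> x _; rewrite mulrDl opprD expRD.
  have -> : u x * F x ^+ p * (expR (- (s * F x)) * expR (- (del * F x))) -
     u x * F x ^+ p * expR (- (s * F x)) * expN_taylor K (del * F x) =
     u x * F x ^+ p * expR (- (s * F x)) * (expR (- (del * F x)) - expN_taylor K (del * F x)).
    by ring.
  have dF : 0 <= del * F x by rewrite mulr_ge0.
  have /andP[b1 b2] := expN_taylor_bounds K dF.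
  rewrite normrM.
  have -> : `|expR (- (del * F x)) - expN_taylor K (del * F x)| =
     (-1) ^+ K * (expR (- (del * F x)) - expN_taylor K (del * F x)).
    by rewrite -[RHS]ger0_norm// normrM normrX normrN1 expr1n mul1r.
  have w0 : 0 <= u x * F x ^+ p by rewrite mulr_ge0// exprn_ge0.
  rewrite normrM (ger0_norm w0) ger0_norm ?expR_ge0//.
  have e1 : expR (- (s * F x)) <= 1 by rewrite -expR0 ler_expR oppr_le0 mulr_ge0.
  apply: (@le_trans _ _ (u x * F x ^+ p * ((del * F x) ^+ K / K`!%:R))).
    by apply: ler_pM => //; [rewrite mulr_ge0 ?expR_ge0|rewrite ler_piMr].
  by apply/eqW; rewrite exprMn exprD; ring.
Qed.

End WeightedLaplace.

Section LaplaceOfMoments.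
Context {R : realType} (d : measure_display) (T : measurableType d)
  (mu : {measure set T -> \bar R}) (u : T -> R) (F : nat -> T -> R)
  (d' : measure_display) (T' : measurableType d')
  (nu : {measure set T' -> \bar R}) (v G : T' -> R) (C D : R).

Lemma laplace_of_moments :
  (forall x, 0 <= u x) -> (forall n x, 0 <= F n x) ->
  (forall n, measurable_fun [set: T] (F n)) ->
  (forall n p, mu.-integrable [set: T] (EFin \o (fun x => u x * F n x ^+ p))) ->
  (forall x, 0 <= v x) -> (forall x, 0 <= G x) ->
  measurable_fun [set: T'] G ->
  (forall p, nu.-integrable [set: T'] (EFin \o (fun x => v x * G x ^+ p))) ->
  0 <= C -> (forall p, \int[nu]_x (v x * G x ^+ p) <= D * (p`!%:R * C ^+ p)) ->
  (forall p, \int[mu]_x (u x * F n x ^+ p) @[n --> \oo] --> \int[nu]_x (v x * G x ^+ p)) ->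
  forall s, 0 <= s -> \int[mu]_x (u x * expR (- (s * F n x))) @[n --> \oo] -->
    \int[nu]_x (v x * expR (- (s * G x))).
Proof.
move=> u0 F0 mF iF v0 G0 mG iG C0 Gb cm s s0.
(* The number of Taylor steps from 0 to s, large enough that 4 C (s / J) <= 1. *)
pose J := (Num.bound (4 * C * s)).+1.
have J0 : 0 < J%:R :> R by rewrite ltr0n.
pose del := s / J%:R.
have del0 : 0 <= del by rewrite divr_ge0// ltW.
have Cdel : 4 * C * del <= 1.
  rewrite /del mulrA ler_pdivrMr// mul1r.
  have : 4 * C * s < (Num.bound (4 * C * s))%:R by rewrite archi_boundP// !mulr_ge0.
  by move/ltW/le_trans; apply; rewrite ler_nat.
have jd0 (j : nat) : 0 <= j%:R * del by rewrite mulr_ge0.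
pose x n p j := \int[mu]_z (u z * F n z ^+ p * expR (- (j%:R * del * F n z))).
pose y p j := \int[nu]_z (v z * G z ^+ p * expR (- (j%:R * del * G z))).
have x0E n p : x n p 0%N = \int[mu]_z (u z * F n z ^+ p).
  by apply: eq_Rintegral => z _; rewrite !mul0r oppr0 expR0 mulr1.
have y0E p : y p 0%N = \int[nu]_z (v z * G z ^+ p).
  by apply: eq_Rintegral => z _; rewrite !mul0r oppr0 expR0 mulr1.
have h := @moment_transfer R x y del del0.
have {h} : forall j p, x n p j @[n --> \oo] --> y p j.
  apply: h.
  - move=> n p j K; rewrite x0E /x -natr1 mulrDl mul1r.
    by apply: laplace_taylor.
  - move=> p j K; rewrite y0E /y -natr1 mulrDl mul1r.
    by apply: laplace_taylor.
  - by move=> p; rewrite y0E; under eq_fun do rewrite x0E; exact: cm.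
  - move=> p; under eq_fun do rewrite y0E.
    apply: (@factorial_growth_cvg0 _ (fun p => \int[nu]_z (v z * G z ^+ p)) C D) => // q.
    by rewrite Gb andbT Rintegral_ge0// => z _; rewrite mulr_ge0// exprn_ge0.
have JE : J%:R * del = s by rewrite /del mulrCA divff ?mulr1// gt_eqF.
move=> /(_ J 0%N); rewrite /x /y JE.
under eq_fun do under eq_Rintegral do rewrite expr0 mulr1.
by under eq_Rintegral do rewrite expr0 mulr1.
Qed.

End LaplaceOfMoments.

(** * Birkhoff sums and the transfer operator *)

Section BoundedMeasurable.
Context {R : realType} (d : measure_display) (X : measurableType d).
Implicit Types f g phi : X -> R.

Definition bounded_measurable phi :=
  measurable_fun [set: X] phi /\ exists M : R, forall x, `|phi x| <= M.

Lemma bounded_measurableD phi psi : bounded_measurable phi -> bounded_measurable psi ->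
  bounded_measurable (fun x => phi x + psi x).
Proof.
move=> [m1 [M1 h1]] [m2 [M2 h2]]; split; first exact: measurable_funD.
by exists (M1 + M2) => x; rewrite (le_trans (ler_normD _ _))// lerD.
Qed.

Lemma bounded_measurableM phi psi : bounded_measurable phi -> bounded_measurable psi ->
  bounded_measurable (fun x => phi x * psi x).
Proof.
move=> [m1 [M1 h1]] [m2 [M2 h2]]; split; first exact: measurable_funM.
by exists (M1 * M2) => x; rewrite normrM ler_pM.
Qed.

Lemma bounded_measurable_cst (c : R) : bounded_measurable (fun _ => c).
Proof. by split; [exact: measurable_cst|exists `|c|]. Qed.

Lemma bounded_measurableX phi n : bounded_measurable phi ->
  bounded_measurable (fun x => phi x ^+ n).
Proof.
move=> h; elim: n => [|n IH].
  by under eq_fun do rewrite expr0; exact: bounded_measurable_cst.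
by under eq_fun do rewrite exprS; exact: bounded_measurableM.
Qed.

Lemma bounded_measurable_sum n (phi : nat -> X -> R) :
  (forall i, bounded_measurable (phi i)) ->
  bounded_measurable (fun x => \sum_(i < n) phi i x).
Proof.
move=> h; elim: n => [|n IH].
  by under eq_fun do rewrite big_ord0; exact: bounded_measurable_cst.
by under eq_fun do rewrite big_ord_recr/=; exact: bounded_measurableD.
Qed.

Lemma bounded_measurable_indic (A : set X) : measurable A ->
  bounded_measurable (\1_A : X -> R).
Proof.
move=> mA; split; first exact: measurable_indic.
by exists 1 => x; rewrite indicE; case: (_ \in _); rewrite ?normr1 ?normr0.
Qed.

Lemma bounded_measurable_comp phi (S : X -> X) : measurable_fun [set: X] S ->
  bounded_measurable phi -> bounded_measurable (fun x => phi (S x)).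
Proof.
move=> mS [mp [M h]]; split; last by exists M => x.
exact: (measurableT_comp mp mS).
Qed.

Lemma indic_bool (b : X -> bool) x : \1_[set x | b x] x = (b x)%:R :> R.
Proof. by rewrite indicE; congr (nat_of_bool _)%:R; apply/idP/idP; rewrite inE. Qed.

Variable m : {measure set X -> \bar R}.

Lemma is_L1M_bounded f phi : is_L1 m f -> bounded_measurable phi ->
  is_L1 m (fun x => f x * phi x).
Proof.
move=> fL [mp [M h]].
have := @integrableMr _ _ _ m setT measurableT phi (EFin \o f) mp _ fL.
move=> /(_ _)/wrap[].
  exists M; split; first exact: num_real.
  by move=> y My x _; exact: (le_trans (h x) (ltW My)).
by apply: eq_integrable => // x _; rewrite /= -EFinM mulrC.
Qed.

Lemma is_L1D f g : is_L1 m f -> is_L1 m g -> is_L1 m (fun x => f x + g x).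
Proof. by move=> fL gL; exact: (integrableD measurableT fL gL). Qed.

Lemma is_L1_measurable f : is_L1 m f -> measurable_fun [set: X] f.
Proof. by move=> fL; apply/measurable_EFinP; exact: measurable_int fL. Qed.

Lemma is_L1_cst0 : is_L1 m (fun _ => 0).
Proof. by have := @integrable0 _ _ _ m [set: X]; apply: eq_integrable. Qed.

Lemma is_L1_sum n (f : nat -> X -> R) : (forall i, is_L1 m (f i)) ->
  is_L1 m (fun x => \sum_(i < n) f i x).
Proof.
move=> h; elim: n => [|n IH].
  by under eq_fun do rewrite big_ord0; exact: is_L1_cst0.
by under eq_fun do rewrite big_ord_recr/=; exact: is_L1D.
Qed.

Lemma Rintegral_sum n (f : nat -> X -> R) : (forall i, is_L1 m (f i)) ->
  \int[m]_x (\sum_(i < n) f i x) = \sum_(i < n) \int[m]_x f i x.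
Proof.
move=> h; elim: n => [|n IH].
  by under eq_Rintegral do rewrite big_ord0; rewrite big_ord0 Rintegral_cst ?mul0r.
under eq_Rintegral do rewrite big_ord_recr/=.
have i1 := is_L1_sum n h; have i2 := h n.
by rewrite big_ord_recr/= -IH RintegralD.
Qed.

Lemma Rintegral_indic f (A : set X) : measurable A -> is_L1 m f ->
  \int[m]_x (f x * \1_A x) = \int[m]_(x in A) f x.
Proof.
move=> mA fL; rewrite [RHS]Rintegral_mkcond; apply: eq_Rintegral => x _.
by rewrite patchE indicE; case: (x \in A); rewrite ?mulr1 ?mulr0.
Qed.

Lemma EFin_Rintegral f : is_L1 m f -> ((\int[m]_x f x)%R%:E = \int[m]_x (f x)%:E)%E.
Proof. by move=> fL; rewrite /Rintegral fineK//; exact: integrable_fin_num. Qed.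

(** The sum counts the j with j + 1 <= n y, so it is the integer part of n y. Applied to values of a
    function, this approximates it uniformly by indicators of superlevel sets. *)
Lemma floor_staircase (y : R) (n N : nat) : (0 < n)%N -> 0 <= y <= N%:R ->
  `|y - n%:R^-1 * \sum_(j < n * N) (nat_of_bool (j.+1%:R <= n%:R * y))%:R| <= n%:R^-1.
Proof.
move=> n0 /andP[y0 yN].
have nR : 0 < n%:R :> R by rewrite ltr0n.
have ny0 : 0 <= n%:R * y by rewrite mulr_ge0// ltW.
have tN : (Num.truncn (n%:R * y) <= n * N)%N.
  by rewrite -(@natrK R (n * N)) le_truncn// natrM ler_wpM2l// ltW.
have -> : \sum_(j < n * N) (nat_of_bool (j.+1%:R <= n%:R * y))%:R = (Num.truncn (n%:R * y))%:R :> R.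
  under eq_bigr do rewrite -truncn_gt_nat.
  rewrite -natr_sum; congr _%:R.
  rewrite -[RHS]card_ord -sum1_card (big_ord_widen _ (fun=> 1%N) tN) [RHS]big_mkcond/=.
  by apply: eq_bigr => j _; case: ltnP.
have /andP[t1 t2] := truncn_itv ny0.
have -> : y - n%:R^-1 * (Num.truncn (n%:R * y))%:R =
    n%:R^-1 * (n%:R * y - (Num.truncn (n%:R * y))%:R).
  by field; rewrite gt_eqF.
rewrite normrM ger0_norm ?invr_ge0 ?(ltW nR)// ler_piMr ?invr_ge0 ?(ltW nR)//.
by rewrite ger0_norm ?subr_ge0// lerBlDl natr1 ltW.
Qed.

(** Since [u] and [h] may change sign, the passage from sets to functions uses uniform rather than
    monotone approximation: replacing [phi] by its staircase costs at most 1/n times an L^1 norm.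
    Adding a constant reduces to nonnegative [phi]. *)
Lemma Rintegral_image (u h : X -> R) (S : X -> X) : measurable_fun [set: X] S ->
  is_L1 m u -> is_L1 m h ->
  (forall A, measurable A -> \int[m]_(x in A) h x = \int[m]_(x in S @^-1` A) u x) ->
  forall phi, bounded_measurable phi ->
  \int[m]_x (h x * phi x) = \int[m]_x (u x * phi (S x)).
Proof.
move=> mS uL hL hu.
suff pos phi (N : nat) : measurable_fun [set: X] phi -> (forall x, 0 <= phi x <= N%:R) ->
    \int[m]_x (h x * phi x) = \int[m]_x (u x * phi (S x)).
  move=> phi [mphi [M hM]].
  have M0 : 0 <= M by rewrite (le_trans _ (hM point)).
  pose N := Num.bound M.
  have MN : M <= N%:R by rewrite ltW// archi_boundP.
  have b1 : bounded_measurable (fun _ : X => N%:R : R) by exact: bounded_measurable_cst.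
  have bphi : bounded_measurable phi by split => //; exists M.
  have bphiS := bounded_measurable_comp mS bphi.
  have e1 := pos (fun x => phi x + N%:R) (2 * N)%N.
  have e2 := pos (fun x => N%:R) N.
  have {}e1 : \int[m]_x (h x * phi x + h x * N%:R) = \int[m]_x (u x * phi (S x) + u x * N%:R).
    under eq_Rintegral do rewrite -mulrDr.
    rewrite e1.
    - by apply: eq_Rintegral => x _; rewrite mulrDr.
    - exact: measurable_funD.
    - move=> x; have := hM x; rewrite ler_norml => /andP[l1 l2].
      by rewrite natrM; clear e1 e2; apply/andP; split; lra.
  have {}e2 : \int[m]_x (h x * N%:R) = \int[m]_x (u x * N%:R).
    by apply: e2 => // x; rewrite ler0n lexx.
  move: e1; rewrite !RintegralD//; last 4 first.
  - exact: (is_L1M_bounded uL bphiS).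
  - exact: (is_L1M_bounded uL b1).
  - exact: (is_L1M_bounded hL bphi).
  - exact: (is_L1M_bounded hL b1).
  by rewrite e2 => /addIr.
move=> mphi phi01.
pose st n x : R := n%:R^-1 * \sum_(j < n * N) \1_[set x | j.+1%:R <= n%:R * phi x] x.
have mlev n j : measurable [set x | j.+1%:R <= n%:R * phi x].
  rewrite -[X in measurable X]setTI; apply: measurable_fun_le => //.
  exact: measurable_funM.
have bst n : bounded_measurable (st n).
  apply: bounded_measurableM; first exact: bounded_measurable_cst.
  apply: (@bounded_measurable_sum (n * N)
    (fun j => \1_[set x0 | j.+1%:R <= n%:R * phi x0])) => j.
  exact: bounded_measurable_indic.
have bphi : bounded_measurable phi.
  by split => //; exists N%:R => x; have /andP[p0 pN] := phi01 x; rewrite ger0_norm.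
have stE n : \int[m]_x (h x * st n x) = \int[m]_x (u x * st n (S x)).
  have aux (w : X -> R) (V : X -> X) : measurable_fun [set: X] V -> is_L1 m w ->
      \int[m]_x (w x * st n (V x)) = n%:R^-1 * \sum_(j < n * N)
        \int[m]_(x in V @^-1` [set x | j.+1%:R <= n%:R * phi x]) w x.
    move=> mV wL.
    have mVA (A : set X) : measurable A -> measurable (V @^-1` A).
      by move=> mA; rewrite -[X in measurable X]setTI; exact: mV.
    have iw (A : set X) : measurable A -> is_L1 m (fun x => w x * \1_A x).
      by move=> mA; apply: is_L1M_bounded => //; exact: bounded_measurable_indic.
    transitivity (\int[m]_x (n%:R^-1 * \sum_(j < n * N)
        (w x * \1_(V @^-1` [set x | j.+1%:R <= n%:R * phi x]) x))).
      by apply: eq_Rintegral => x _; rewrite /st mulrCA mulr_sumr.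
    have iw' (j : nat) : is_L1 m (fun x => w x *
        \1_(V @^-1` [set x | j.+1%:R <= n%:R * phi x]) x) by apply: iw; exact: mVA.
    rewrite RintegralZl//; last exact: (is_L1_sum (n * N) iw').
    rewrite (Rintegral_sum (n * N) iw'); congr (_ * _); apply: eq_bigr => j _.
    by rewrite Rintegral_indic//; exact: mVA.
  rewrite (aux h id)// (aux u S)//; congr (_ * _); apply: eq_bigr => j _.
  by rewrite -hu.
have close (w : X -> R) (V : X -> X) n : (0 < n)%N -> measurable_fun [set: X] V -> is_L1 m w ->
    `|\int[m]_x (w x * phi (V x)) - \int[m]_x (w x * st n (V x))| <=
    n%:R^-1 * \int[m]_x `|w x|.
  move=> n0 mV wL.
  have bV := bounded_measurable_comp mV bphi.
  have bsV := bounded_measurable_comp mV (bst n).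
  have i1 := is_L1M_bounded wL bV; have i2 := is_L1M_bounded wL bsV.
  have iB : is_L1 m (fun x => w x * phi (V x) - w x * st n (V x)).
    exact: (integrableB measurableT i1 i2).
  have iA : is_L1 m (fun x => `|w x|) by exact: (integrable_abse wL).
  rewrite -RintegralB// -RintegralZl//.
  apply: (le_trans (le_normr_Rintegral _ _)) => //.
  apply: le_Rintegral => //.
  - exact: (integrable_abse iB).
  - by have := integrableZl measurableT n%:R^-1 iA; apply: eq_integrable.
  - move=> x _; rewrite -mulrBr normrM mulrC ler_wpM2r//.
    have := floor_staircase n0 (phi01 (V x)).
    by rewrite /st; under [in X in _ -> X]eq_bigr do rewrite indic_bool.
apply/eqP; rewrite -subr_eq0 -normr_eq0 eq_le normr_ge0 andbT.
pose A := \int[m]_x `|h x| + \int[m]_x `|u x|.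
have A0 : 0 <= A by rewrite addr_ge0// Rintegral_ge0.
apply/ler_addgt0Pr => e e0; rewrite add0r.
pose n := (Num.bound (A / e)).+1.
have n0 : 0 < n%:R :> R by rewrite ltr0n.
apply: (@le_trans _ _ (n%:R^-1 * A)); last first.
  rewrite mulrC ler_pdivrMr// mulrC -ler_pdivrMr//.
  have : A / e < (Num.bound (A / e))%:R by rewrite archi_boundP// divr_ge0// ltW.
  by move/ltW/le_trans; apply; rewrite ler_nat.
have c1 := close h id n isT (@measurable_id _ _ _) hL.
have c2 := close u S n isT mS uL.
move: c1 c2; rewrite stE /A mulrDr.
move: (\int[m]_x (u x * phi (S x))) (\int[m]_x (u x * st n (S x))) => y2 z.
rewrite !ler_norml => /andP[a1 a2] /andP[b1 b2].
by apply/andP; split; lra.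
Qed.

End BoundedMeasurable.

(** * Birkhoff sums *)

Section BirkhoffSums.
Context {R : realType} (d : measure_display) (X : measurableType d) (T : {mfun X >-> X}).
Implicit Types f phi : X -> R.

Lemma measurable_iter k : measurable_fun [set: X] (iter k T).
Proof.
elim: k => [|k IH]; first exact: measurable_id.
by apply: measurableT_comp.
Qed.

Lemma measurable_iter_preimage k (A : set X) : measurable A -> measurable (iter k T @^-1` A).
Proof. by move=> mA; rewrite -[X in measurable X]setTI; exact: measurable_iter. Qed.

Lemma birkhoff_sum0 f x : birkhoff_sum T f 0 x = 0.
Proof. by rewrite /birkhoff_sum big_ord0. Qed.

Lemma birkhoff_sumSl f n x : birkhoff_sum T f n.+1 x = f x + birkhoff_sum T f n (T x).
Proof.
rewrite /birkhoff_sum big_ord_recl/=; congr (_ + _).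
by apply: eq_bigr => i _; rewrite add0n -iterS iterSr.
Qed.

Lemma birkhoff_sumSr f n x : birkhoff_sum T f n.+1 x = birkhoff_sum T f n x + f (iter n T x).
Proof. by rewrite /birkhoff_sum big_ord_recr. Qed.

Lemma birkhoff_sum_comp f n x :
  birkhoff_sum T (fun x => f (T x)) n x = birkhoff_sum T f n (T x).
Proof. by apply: eq_bigr => i _; rewrite -iterS iterSr. Qed.

Lemma birkhoff_sumD f g n x :
  birkhoff_sum T (fun x => f x + g x) n x = birkhoff_sum T f n x + birkhoff_sum T g n x.
Proof. by rewrite /birkhoff_sum -big_split. Qed.

Lemma birkhoff_sum_ge0 f n x : (forall x, 0 <= f x) -> 0 <= birkhoff_sum T f n x.
Proof. by move=> f0; apply: sumr_ge0. Qed.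

Lemma birkhoff_sum_le f g n x : (forall x, f x <= g x) ->
  birkhoff_sum T f n x <= birkhoff_sum T g n x.
Proof. by move=> fg; apply: ler_sum. Qed.

Lemma birkhoff_sum_nondecreasing f x : (forall x, 0 <= f x) ->
  nondecreasing_seq (fun n => birkhoff_sum T f n x).
Proof.
by move=> f0; apply/nondecreasing_seqP => n; rewrite birkhoff_sumSr lerDl.
Qed.

Lemma measurable_birkhoff_sum f n : measurable_fun [set: X] f ->
  measurable_fun [set: X] (birkhoff_sum T f n).
Proof.
move=> mf; elim: n => [|n IH].
  rewrite (_ : birkhoff_sum T f 0 = cst 0); first exact: measurable_cst.
  by apply/funext => x; exact: birkhoff_sum0.
rewrite (_ : birkhoff_sum T f n.+1 = (fun x => birkhoff_sum T f n x + f (iter n T x))).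
  apply: measurable_funD => //; exact: (measurableT_comp mf (measurable_iter n)).
by apply/funext => x; exact: birkhoff_sumSr.
Qed.

Lemma bounded_measurable_birkhoff_sum f n : bounded_measurable f ->
  bounded_measurable (birkhoff_sum T f n).
Proof.
move=> bf; have := @bounded_measurable_sum _ _ _ n (fun k x => f (iter k T x)).
by apply=> k; apply: bounded_measurable_comp => //; exact: measurable_iter.
Qed.

End BirkhoffSums.

(** * Duality and the maximum principle *)

Section MeasurePreserving.
Context {R : realType} (d : measure_display) (X : measurableType d)
  (m : {sigma_finite_measure set X -> \bar R}) (T : {mfun X >-> X}).
Hypothesis mp : measure_preserving m T.
Implicit Types f u v phi psi : X -> R.

Lemma measure_preserving_iter k (A : set X) : measurable A -> m (iter k T @^-1` A) = m A.
Proof.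
move=> mA; elim: k => [//|k IH].
rewrite -[RHS]IH -[RHS]mp; last exact: measurable_iter_preimage.
by congr (m _); apply/funext => x; rewrite /preimage/= -iterS iterSr.
Qed.

Lemma transfer_spec f : is_L1 m f -> is_transfer m T f (transfer m T f).
Proof. by move=> fL; apply: transferP => // A mA; rewrite mp. Qed.

Lemma iter_transfer_spec k f : is_L1 m f -> is_L1 m (iter k (transfer m T) f) /\
  forall A, measurable A ->
    \int[m]_(x in A) iter k (transfer m T) f x = \int[m]_(x in iter k T @^-1` A) f x.
Proof.
move=> fL; elim: k => [|k [IH1 IH2]]; first by split.
have [h1 h2] := transfer_spec IH1; split => // A mA.
rewrite iterS h2// IH2.
  by congr (Rintegral m _ _); apply/funext => x; rewrite /preimage/= -iterS.
exact: (measurable_iter_preimage T 1).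
Qed.

Lemma transfer_sum_dual n f phi : is_L1 m f -> bounded_measurable phi ->
  \int[m]_x ((\sum_(k < n) iter k (transfer m T) f x) * phi x) =
  \int[m]_x (f x * birkhoff_sum T phi n x).
Proof.
move=> fL bphi.
have i1 k : is_L1 m (fun x => iter k (transfer m T) f x * phi x).
  by apply: is_L1M_bounded => //; have [] := iter_transfer_spec k fL.
have i2 k : is_L1 m (fun x => f x * phi (iter k T x)).
  apply: is_L1M_bounded => //; apply: bounded_measurable_comp => //.
  exact: measurable_iter.
under eq_Rintegral do rewrite mulr_suml.
under [RHS]eq_Rintegral do rewrite mulr_sumr.
rewrite (Rintegral_sum n i1) (Rintegral_sum n i2); apply: eq_bigr => k _.
have [h1 h2] := iter_transfer_spec k fL.
exact: (Rintegral_image (measurable_iter T k) fL h1 h2).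
Qed.

Lemma integral_comp_preserving phi : measurable_fun [set: X] phi -> (forall x, 0 <= phi x) ->
  (\int[m]_x (phi (T x))%:E = \int[m]_x (phi x)%:E)%E.
Proof.
move=> mphi phi0.
have mT : measurable_fun [set: X] T by [].
have mephi : measurable_fun [set: X] (EFin \o phi) by exact/measurable_EFinP.
have := @ge0_integral_pushforward _ _ _ _ _ _ mT m setT _ measurableT mephi.
rewrite preimage_setT => /(_ _)/wrap[|<-].
  by move=> y _; rewrite lee_fin.
apply: eq_measure_integral => A mA _.
exact: mp.
Qed.

Lemma integral_birkhoff_sumD u phi psi n : measurable_fun [set: X] u ->
  (forall x, 0 <= u x) -> measurable_fun [set: X] phi -> measurable_fun [set: X] psi ->
  (forall x, 0 <= phi x) -> (forall x, 0 <= psi x) ->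
  (\int[m]_x (u x * birkhoff_sum T (fun x => phi x + psi x)%R n x)%:E =
   \int[m]_x (u x * birkhoff_sum T phi n x)%:E +
   \int[m]_x (u x * birkhoff_sum T psi n x)%:E)%E.
Proof.
move=> mu u0 mphi mpsi phi0 psi0.
rewrite -ge0_integralD//.
- by apply: eq_integral => x _; rewrite -EFinD birkhoff_sumD mulrDr.
- by move=> x _; rewrite lee_fin mulr_ge0// birkhoff_sum_ge0.
- apply/measurable_EFinP; apply: measurable_funM => //.
  exact: measurable_birkhoff_sum.
- by move=> x _; rewrite lee_fin mulr_ge0// birkhoff_sum_ge0.
- apply/measurable_EFinP; apply: measurable_funM => //.
  exact: measurable_birkhoff_sum.
Qed.

(* Dual form of [\sum_(k < n) T^^k u <= M] on [D]. *)
Definition dual_bound (D : set X) u n (M : R) :=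
  forall phi, measurable_fun [set: X] phi -> (forall x, 0 <= phi x) ->
    (forall x, ~ D x -> phi x = 0) ->
    (\int[m]_x (u x * birkhoff_sum T phi n x)%:E <= M%:E * \int[m]_x (phi x)%:E)%E.

Lemma dual_boundW D u v n (M : R) : measurable_fun [set: X] u -> measurable_fun [set: X] v ->
  (forall x, 0 <= u x <= v x) -> dual_bound D v n M -> dual_bound D u n M.
Proof.
move=> mu mv uv h phi mphi phi0 phiD; apply: (le_trans _ (h _ mphi phi0 phiD)).
have mS : measurable_fun [set: X] (birkhoff_sum T phi n) by exact: measurable_birkhoff_sum.
apply: ge0_le_integral => //.
- by move=> x _; rewrite lee_fin mulr_ge0 ?birkhoff_sum_ge0//; case/andP: (uv x).
- by apply/measurable_EFinP; exact: measurable_funM.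
- by apply/measurable_EFinP; exact: measurable_funM.
- move=> x _; rewrite lee_fin ler_wpM2r ?birkhoff_sum_ge0//.
  by case/andP: (uv x).
Qed.

(* Mass in the complement of the support [D] of [u] at time [j + 1]
   already was somewhere at time [j], so the bound propagates from [D] to the space. *)
Lemma dual_bound_maximum_principle (D : set X) u n (M : R) : measurable D -> 0 <= M ->
  measurable_fun [set: X] u -> (forall x, 0 <= u x) -> (forall x, ~ D x -> u x = 0) ->
  dual_bound D u n M -> dual_bound setT u n M.
Proof.
move=> mD M0 mu u0 uD h.
suff H j : (j <= n)%N -> dual_bound setT u j M by exact: H.
elim: j => [_|j IH jn] phi mphi phi0 _.
  under eq_integral do rewrite birkhoff_sum0 mulr0.
  by rewrite integral0 mule_ge0 ?lee_fin// integral_ge0// => x _; rewrite lee_fin.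
pose p1 x := phi x * \1_D x; pose p2 x := phi x * \1_(~` D) x.
have mp1 : measurable_fun [set: X] p1 by apply: measurable_funM => //; exact: measurable_indic.
have mp2 : measurable_fun [set: X] p2.
  by apply: measurable_funM => //; apply: measurable_indic; exact: measurableC.
have p10 x : 0 <= p1 x by rewrite mulr_ge0// indicE.
have p20 x : 0 <= p2 x by rewrite mulr_ge0// indicE.
have phiE : phi = (fun x => p1 x + p2 x).
  apply/funext => x; rewrite /p1 /p2 -mulrDr !indicE in_setC.
  by case: (x \in D); rewrite ?addr0 ?add0r mulr1.
have intE : (\int[m]_x (phi x)%:E = \int[m]_x (p1 x)%:E + \int[m]_x (p2 x)%:E)%E.
  rewrite {1}phiE; under eq_integral do rewrite EFinD.
  by rewrite ge0_integralD//; [move=> x _; rewrite lee_fin|apply/measurable_EFinP|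
    move=> x _; rewrite lee_fin|apply/measurable_EFinP].
rewrite intE {1}phiE integral_birkhoff_sumD// ge0_muleDr; last 2 first.
- by rewrite integral_ge0// => x _; rewrite lee_fin.
- by rewrite integral_ge0// => x _; rewrite lee_fin.
apply: leeD.
  apply: (@le_trans _ _ (\int[m]_x (u x * birkhoff_sum T p1 n x)%:E)%E).
    have mS k : measurable_fun [set: X] (birkhoff_sum T p1 k) by exact: measurable_birkhoff_sum.
    apply: ge0_le_integral => //.
    - by move=> x _; rewrite lee_fin mulr_ge0// birkhoff_sum_ge0.
    - by apply/measurable_EFinP; exact: measurable_funM.
    - by apply/measurable_EFinP; exact: measurable_funM.
    - by move=> x _; rewrite lee_fin ler_wpM2l// birkhoff_sum_nondecreasing.
  apply: h => // x nDx; rewrite /p1 indicE memNset// mulr0//.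
(* [p2] vanishes on D and [u] off D, so the time 0 term of the sum drops out. What remains is a sum
   of length j for [p2 o T], which has the same integral as [p2]. *)
rewrite -(integral_comp_preserving mp2 p20).
have mp2T : measurable_fun [set: X] (fun x => p2 (T x)) by exact: measurableT_comp.
apply: le_trans (IH (ltnW jn) _ mp2T (fun x => p20 (T x)) _) => //; last by move=> x [].
apply/eqW; apply: eq_integral => x _; congr EFin.
rewrite birkhoff_sumSl birkhoff_sum_comp mulrDr.
have [Dx|nDx] := pselect (D x); last by rewrite uD// !mul0r addr0.
by rewrite /p2 indicE memNset ?mulr0 ?mul0r ?add0r//; apply/mem_set; exact.
Qed.

(** Duality is available for bounded test functions; truncation and monotone convergence give the
    rest. If [phi] has infinite integral the right side is +oo, because M > 0. *)
Lemma dual_bound_of_transfer (D : set X) f n (M : R) : measurable D -> 0 < M ->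
  is_L1 m f -> (forall x, 0 <= f x) ->
  (forall x, D x -> \sum_(k < n) iter k (transfer m T) f x <= M) ->
  dual_bound D f n M.
Proof.
move=> mD M0 fL f0 fM phi mphi phi0 phiD.
have mf := is_L1_measurable fL.
have phi_ge0 : (0 <= \int[m]_x (phi x)%:E)%E.
  by rewrite integral_ge0// => x _; rewrite lee_fin.
have [phiL|] := ltP (\int[m]_x (phi x)%:E)%E +oo%E; last first.
  by rewrite leye_eq => /eqP ->; rewrite gt0_muley ?leey// lte_fin.
have iphi : is_L1 m phi.
  apply/integrableP; split; first exact/measurable_EFinP.
  by under eq_integral do rewrite /= ger0_norm//.
pose phiN N x := Num.min (phi x) N%:R.
have phiN0 N x : 0 <= phiN N x by rewrite le_min phi0 ler0n.
have phiNle N x : phiN N x <= phi x by rewrite ge_min lexx.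
have mphiN N : measurable_fun [set: X] (phiN N) by exact: measurable_minr.
have bphiN N : bounded_measurable (phiN N).
  by split => //; exists N%:R => x; rewrite ger0_norm// ge_min lexx orbT.
have bndN N : (\int[m]_x (f x * birkhoff_sum T (phiN N) n x)%:E <=
    M%:E * \int[m]_x (phi x)%:E)%E.
  have iL : is_L1 m (fun x => f x * birkhoff_sum T (phiN N) n x).
    by apply: is_L1M_bounded => //; exact: bounded_measurable_birkhoff_sum.
  rewrite -EFin_Rintegral// -transfer_sum_dual// -EFin_Rintegral// -EFinM lee_fin.
  rewrite -RintegralZl//; apply: le_Rintegral => //.
  - apply: is_L1M_bounded => //; apply: (is_L1_sum n) => k.
    by have [] := iter_transfer_spec k fL.
  - by have := integrableZl measurableT M iphi; apply: eq_integrable.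
  - move=> x _; have [Dx|nDx] := pselect (D x).
      apply: (@le_trans _ _ (M * phiN N x)); first by rewrite ler_wpM2r// fM.
      by rewrite ler_wpM2l// ltW.
    have -> : phiN N x = 0 by apply/eqP; rewrite eq_le phiN0 andbT -(phiD x nDx).
    by rewrite mulr0 mulr_ge0// ltW.
pose gN N x := (f x * birkhoff_sum T (phiN N) n x)%:E.
have limE x : limn (gN^~ x) = (f x * birkhoff_sum T phi n x)%:E.
  apply/cvg_lim => //; apply: cvg_near_cst.
  have hN n' : exists N0 : nat, forall k, (k < n')%N -> phi (iter k T x) <= N0%:R.
    elim: n' => [|k [N1 h1]]; first by exists 0%N.
    exists (maxn N1 (Num.bound (phi (iter k T x)))) => i.
    rewrite ltnS leq_eqVlt => /predU1P[->|ik].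
      rewrite (@le_trans _ _ (Num.bound (phi (iter k T x)))%:R)//.
        by rewrite ltW// archi_boundP.
      by rewrite ler_nat leq_maxr.
    by rewrite (le_trans (h1 _ ik))// ler_nat leq_maxl.
  have [N0 hN0] := hN n.
  exists N0 => // N /= N0N; rewrite /gN; congr ((_ * _)%:E).
  apply: eq_bigr => k _; rewrite /phiN; apply/min_idPl.
  by rewrite (le_trans (hN0 k _))// ler_nat.
under eq_integral do rewrite -limE.
rewrite monotone_convergence//.
- apply: lime_le; last by near=> N; exact: bndN.
  apply: ereal_nondecreasing_is_cvgn => N1 N2 N12; apply: ge0_le_integral => //.
  - by move=> x _; rewrite lee_fin mulr_ge0// birkhoff_sum_ge0.
  - by apply/measurable_EFinP; apply: measurable_funM => //; exact: measurable_birkhoff_sum.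
  - by apply/measurable_EFinP; apply: measurable_funM => //; exact: measurable_birkhoff_sum.
  - move=> x _; rewrite lee_fin ler_wpM2l// birkhoff_sum_le// => y.
    by rewrite /phiN le_min ge_min lexx/= ge_min ler_nat N12 orbT.
- by move=> N; apply/measurable_EFinP; apply: measurable_funM => //;
    exact: measurable_birkhoff_sum.
- by move=> N x _; rewrite lee_fin mulr_ge0// birkhoff_sum_ge0.
- move=> x _ N1 N2 N12; rewrite lee_fin ler_wpM2l// birkhoff_sum_le// => y.
  by rewrite /phiN le_min ge_min lexx/= ge_min ler_nat N12 orbT.
Unshelve. all: by end_near. Qed.

End MeasurePreserving.

(** * Powers of Birkhoff sums *)

Section BirkhoffPowers.
Context {R : realType} (d : measure_display) (X : measurableType d) (T : {mfun X >-> X}).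
Variable f : X -> R.
Hypothesis f0 : forall x, 0 <= f x.
Local Notation S := (birkhoff_sum T f).

Lemma expr_increment_bounds (y z : R) q : 0 <= y -> 0 <= z ->
  q.+1%:R * z * y ^+ q <= (y + z) ^+ q.+1 - y ^+ q.+1 <= q.+1%:R * z * (y + z) ^+ q.
Proof.
move=> y0 z0; have yz0 : 0 <= y + z by rewrite addr_ge0.
elim: q => [|q /andP[IH1 IH2]]; first by rewrite !expr0 !expr1 !mulr1 mul1r addrC addKr lexx.
have -> : (y + z) ^+ q.+2 - y ^+ q.+2 =
    (y + z) * ((y + z) ^+ q.+1 - y ^+ q.+1) + z * y ^+ q.+1.
  by rewrite [_ ^+ q.+2]exprS [y ^+ q.+2]exprS; ring.
have ypow : y ^+ q.+1 <= (y + z) ^+ q.+1 by apply: lerXn2r; rewrite ?nnegrE// lerDl.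
apply/andP; split.
  apply: (@le_trans _ _ (y * (q.+1%:R * z * y ^+ q) + z * y ^+ q.+1)).
    by rewrite -[q.+2%:R]natr1 exprS; apply/eqW; ring.
  rewrite lerD2r ler_pM// ?lerDl// mulr_ge0 ?exprn_ge0// mulr_ge0//.
apply: (@le_trans _ _ ((y + z) * (q.+1%:R * z * (y + z) ^+ q) + z * (y + z) ^+ q.+1)).
  by rewrite lerD// ler_wpM2l.
by rewrite -[q.+2%:R]natr1 exprS; apply/eqW; ring.
Qed.

(** S (n - k) at T^k x is the part of S n x from time k on. As k grows its power q + 1 decreases to
    0, in steps of about q + 1 times these summands. *)
Definition birkhoff_diag q n x := \sum_(k < n) f (iter k T x) * S (n - k) (iter k T x) ^+ q.

Lemma birkhoff_diagS q n x :
  birkhoff_diag q n.+1 x = f x * S n.+1 x ^+ q + birkhoff_diag q n (T x).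
Proof.
rewrite /birkhoff_diag big_ord_recl/= subn0; congr (_ + _).
by apply: eq_bigr => k _; rewrite add0n subSS -iterS iterSr.
Qed.

Lemma birkhoff_sum_pow_le q n x : S n x ^+ q.+1 <= q.+1%:R * birkhoff_diag q n x.
Proof.
elim: n x => [|n IH] x.
  by rewrite birkhoff_sum0 expr0n/= /birkhoff_diag big_ord0 mulr0.
have Sn0 : 0 <= S n (T x) by exact: birkhoff_sum_ge0.
have /andP[_] := expr_increment_bounds q Sn0 (f0 x).
rewrite birkhoff_diagS birkhoff_sumSl (addrC (f x)) mulrDr mulrA lerBlDr => h.
by apply: (le_trans h); rewrite lerD2l.
Qed.

(** The loss in each step is the difference of q-th powers before and after adding [f x <= K], at
    most q K S^(q-1). After summation the error has total degree q in [f], one less than the main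
    term. At q = 0 its coefficient is 0. *)
Lemma birkhoff_sum_pow_ge q n x (K : R) : (forall x, f x <= K) ->
  q.+1%:R * birkhoff_diag q n x <= S n x ^+ q.+1 +
    q.+1%:R * q%:R * K * birkhoff_sum T (fun y => f y * S n y ^+ q.-1) n x.
Proof.
move=> fK.
have K0 : 0 <= K by rewrite (le_trans (f0 x)).
(* The induction passes to T x and lowers n, so the length of the sum inside the error term is first
   frozen at some N >= n. *)
suff H N : (n <= N)%N -> q.+1%:R * birkhoff_diag q n x <= S n x ^+ q.+1 +
    q.+1%:R * q%:R * K * birkhoff_sum T (fun y => f y * S N y ^+ q.-1) n x by exact: H.
elim: n x => [|n IH] x nN.
  by rewrite !birkhoff_sum0 /birkhoff_diag big_ord0 !mulr0 addr0 expr0n.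
rewrite birkhoff_diagS [X in _ <= _ + _ * X]birkhoff_sumSl.
have Sn0 : 0 <= S n (T x) by exact: birkhoff_sum_ge0.
have {}IH := IH (T x) (ltnW nN).
have /andP[h _] := expr_increment_bounds q Sn0 (f0 x).
have SSE : S n.+1 x = S n (T x) + f x by rewrite birkhoff_sumSl addrC.
have h2 : S n.+1 x ^+ q <= S n (T x) ^+ q + q%:R * f x * S n.+1 x ^+ q.-1.
  case: q {IH h} => [|q]; first by rewrite !expr0 !mul0r addr0.
  have /andP[_] := expr_increment_bounds q Sn0 (f0 x).
  by rewrite -SSE lerBlDl.
have h3 : S n.+1 x ^+ q.-1 <= S N x ^+ q.-1.
  by apply: lerXn2r; rewrite ?nnegrE ?birkhoff_sum_ge0// birkhoff_sum_nondecreasing.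
have h4 : q.+1%:R * (f x * S n.+1 x ^+ q) <=
    q.+1%:R * f x * S n (T x) ^+ q + q.+1%:R * q%:R * K * (f x * S N x ^+ q.-1).
  apply: (@le_trans _ _ (q.+1%:R * (f x * (S n (T x) ^+ q + q%:R * f x * S n.+1 x ^+ q.-1)))).
    by rewrite !ler_wpM2l.
  rewrite mulrDr mulrDr mulrA lerD2l.
  rewrite (_ : q.+1%:R * q%:R * K * (f x * S N x ^+ q.-1) =
    q.+1%:R * (f x * (q%:R * K * S N x ^+ q.-1))); last by ring.
  rewrite !ler_wpM2l// ler_pM ?mulr_ge0 ?exprn_ge0 ?birkhoff_sum_ge0//.
  by rewrite ler_wpM2l.
move: h4 h IH; rewrite -SSE [X in _ <= _ + X * _ -> _]mulrC.
rewrite [q.+1%:R * (_ + _)]mulrDr.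
move: (S n.+1 x ^+ q.+1) (S n (T x) ^+ q.+1) => A B.
move: (birkhoff_sum _ _ _ _) => W.
rewrite mulrDr.
move: (f x * S N x ^+ q.-1) (q.+1%:R * f x * S n (T x) ^+ q) => Z V.
move: (q.+1%:R * (f x * S n.+1 x ^+ q)) (q.+1%:R * birkhoff_diag q n (T x)) => P Q.
have -> : K * (q.+1%:R * q%:R) = q.+1%:R * q%:R * K by ring.
by move: (q.+1%:R * q%:R * K * Z) (q.+1%:R * q%:R * K * W) => U1 U2; lra.
Qed.

Lemma birkhoff_diag_le q n x :
  birkhoff_diag q n x <= birkhoff_sum T (fun y => f y * S n y ^+ q) n x.
Proof.
apply: ler_sum => k _; rewrite ler_wpM2l//; apply: lerXn2r;
  rewrite ?nnegrE ?birkhoff_sum_ge0//.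
by apply: birkhoff_sum_nondecreasing => //; exact: leq_subr.
Qed.

End BirkhoffPowers.

(** * Nice functions and their density *)

Section NiceFunctions.
Context {R : realType} (d : measure_display) (X : measurableType d)
  (m : {sigma_finite_measure set X -> \bar R}) (T : {mfun X >-> X}).
Hypothesis mp : measure_preserving m T.
Variable a : nat -> R.
Hypothesis ra : return_sequence m T a.
Implicit Types f u phi : X -> R.

(** [nice_bound] is the dual form of a bound on transfer sums by C a_n. [nice_supp] turns
    convergence in measure into smallness of the exceptional set for [m] restricted to a
    finite-measure set, and [nice_le] bounds the lower-order terms. *)
Record nice u : Prop := Nice {
  nice_measurable : measurable_fun [set: X] u;
  nice_ge0 : forall x, 0 <= u x;
  nice_L1 : is_L1 m u;
  nice_int_gt0 : 0 < \int[m]_x u x;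
  nice_le : exists K : R, forall x, u x <= K;
  nice_supp : exists2 E, measurable E /\ (m E < +oo)%E & forall x, ~ E x -> u x = 0;
  nice_bound : exists2 C, 0 <= C &
    forall n, (0 < n)%N -> dual_bound m T setT u n (C * a n) }.

Lemma return_sequence_gt0 n : (0 < n)%N -> 0 < a n. Proof. by case: ra => + _; apply. Qed.

Lemma nice_L1plus u : nice u -> is_L1plus m u.
Proof. by move=> nu; split; [exact: nice_L1|apply: aeW; exact: nice_ge0|exact: nice_int_gt0]. Qed.

Lemma nice_bounded_measurable u : nice u -> bounded_measurable u.
Proof.
move=> nu; split; first exact: nice_measurable.
have [K uK] := nice_le nu; exists K => x.
by rewrite ger0_norm//; exact: nice_ge0.
Qed.

Definition transfer_sum f n x := \sum_(k < n) iter k (transfer m T) f x.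

Lemma transfer_sum_L1 f n : is_L1 m f -> is_L1 m (transfer_sum f n).
Proof. by move=> fL; apply: (is_L1_sum n) => k; have [] := iter_transfer_spec mp k fL. Qed.

Lemma limn_esup_bounded (v : nat -> R) (l : R) : limn_esup (EFin \o v) = l%:E ->
  exists B : nat, forall n, v n <= B%:R.
Proof.
move=> vl; have : (limn_esup (EFin \o v) < +oo)%E by rewrite vl ltry.
move=> /ereal_inf_lt[_ [V [N _ NV] <-]] supV.
have [B hB] : exists B : nat, forall n, (N <= n)%N -> v n <= B%:R.
  have h n : (N <= n)%N -> ((v n)%:E <= ereal_sup [set (EFin \o v) x | x in V])%E.
    by move=> Nn; apply: ereal_sup_ubound; exists n => //; exact: NV.
  move: supV h; case: (ereal_sup _) => [r _ h|//|_ h].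
    exists (Num.bound `|r|) => n /h; rewrite lee_fin => /le_trans; apply.
    by rewrite (le_trans (ler_norm _))// ltW// archi_boundP.
  by exists 0%N => n /h.
have [B' hB'] : exists B' : nat, forall n, (n < N)%N -> v n <= B'%:R.
  elim: N {NV hB} => [|N [B' h]]; first by exists 0%N.
  exists (maxn B' (Num.bound `|v N|)) => n.
  rewrite ltnS leq_eqVlt => /predU1P[->|nN].
    apply: (@le_trans _ _ (Num.bound `|v N|)%:R); last by rewrite ler_nat leq_maxr.
    by rewrite (le_trans (ler_norm _))// ltW// archi_boundP.
  by rewrite (le_trans (h _ nN))// ler_nat leq_maxl.
exists (maxn B B') => n; have [nN|Nn] := ltnP n N.
  by rewrite (le_trans (hB' _ nN))// ler_nat leq_maxr.
by rewrite (le_trans (hB _ Nn))// ler_nat leq_maxl.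
Qed.

(** The three conditions provide, for [f] restricted to this set, a pointwise bound, finite measure
    of the support by Markov's inequality, and the transfer bound on the set itself. *)
Definition good_set f (j : nat) : set X :=
  [set x | f x <= j.+1%:R] `&` [set x | 1 <= j.+1%:R * f x] `&`
  \bigcap_(n in [set n | (0 < n)%N]) [set x | transfer_sum f n x <= j.+1%:R * a n].

Lemma measurable_good_set f j : is_L1 m f -> measurable (good_set f j).
Proof.
move=> fL; have mf := is_L1_measurable fL.
apply: measurableI; first apply: measurableI.
- by rewrite -[X in measurable X]setTI; exact: measurable_fun_le.
- rewrite -[X in measurable X]setTI; apply: measurable_fun_le => //.
  exact: measurable_funM.
- apply: bigcap_measurable; first by exists 1%N.
  move=> n _; rewrite -[X in measurable X]setTI; apply: measurable_fun_le => //.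
  by apply: is_L1_measurable; exact: transfer_sum_L1.
Qed.

Lemma good_set_fin f j : is_L1 m f -> (forall x, 0 <= f x) -> (m (good_set f j) < +oo)%E.
Proof.
move=> fL f0; have mE := measurable_good_set j fL.
rewrite -(setIT (good_set f j)) -integral_indic//.
have jL : is_L1 m (fun x => j.+1%:R * f x).
  by have := integrableZl measurableT j.+1%:R fL; apply: eq_integrable.
apply: (@le_lt_trans _ _ (\int[m]_x (j.+1%:R * f x)%:E)%E).
  apply: ge0_le_integral => //.
  - by apply/measurable_EFinP; exact: measurable_indic.
  - exact: measurable_int jL.
  - move=> x _; rewrite lee_fin indicE; case: (boolP (x \in _)) => [|_].
      by rewrite inE => -[[_]].
    by rewrite mulr_ge0.
by have := integrable_fin_num measurableT jL; rewrite fin_numE ltey => /andP[].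
Qed.

(** A finite limsup at x bounds all normalised transfer sums at x, so a point with f x > 0 lies in
    every late good set. *)
Lemma good_set_cvg f : is_L1 m f -> (forall x, 0 <= f x) -> 0 < \int[m]_x f x ->
  {ae m, forall x, (f x * \1_(good_set f j) x)%:E @[j --> \oo] --> (f x)%:E}.
Proof.
move=> fL f0 fpos; have [_ /(_ f)] := ra.
move=> /(_ _)/wrap[|[_]].
  by split => //; exact: aeW.
apply: filterS => x hx.
have [B hB] := limn_esup_bounded hx.
have [fx0|fx0] := eqVneq (f x) 0.
  by under eq_fun do rewrite fx0 mul0r; rewrite fx0; exact: cvg_cst.
have fx : 0 < f x by rewrite lt_def fx0 f0.
apply: cvg_near_cst; near=> j.
rewrite indicE mem_set ?mulr1//; split; first split => /=.
- apply: (@le_trans _ _ j%:R); last by rewrite ler_nat.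
  by near: j; exact: nbhs_infty_ger.
- rewrite -ler_pdivrMr// (@le_trans _ _ j%:R)//; last by rewrite ler_nat.
  by near: j; exact: nbhs_infty_ger.
- move=> n /= n0; have := hB n.
  rewrite ler_pdivrMr ?return_sequence_gt0// => /le_trans; apply.
  rewrite ler_wpM2r ?(ltW (return_sequence_gt0 n0))// ler_nat.
  by apply: leqW; near: j; exact: nbhs_infty_ge.
Unshelve. all: by end_near. Qed.

Lemma nice_dense f (e : R) : is_L1 m f -> (forall x, 0 <= f x) -> 0 < \int[m]_x f x ->
  0 < e -> exists u, [/\ nice u, (forall x, u x <= f x) & \int[m]_x (f x - u x) <= e].
Proof.
move=> fL f0 fpos e0.
have mf := is_L1_measurable fL.
pose u j x := f x * \1_(good_set f j) x.
have mE j := measurable_good_set j fL.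
have uf j x : 0 <= u j x <= f x.
  by rewrite /u indicE; case: (_ \in _); rewrite ?mulr1 ?mulr0 f0 lexx.
have uL j : is_L1 m (u j).
  by apply: is_L1M_bounded => //; exact: bounded_measurable_indic.
have fuL j : is_L1 m (fun x => f x - u j x) by exact: (integrableB measurableT fL (uL j)).
have cv : \int[m]_x (f x - u j x) @[j --> \oo] --> (0 : R).
  have [||||| _ + _] := @dominated_convergence _ _ _ m setT measurableT
      (fun j x => (u j x)%:E) (EFin \o f) (EFin \o f).
  - by move=> j; exact: measurable_int (uL j).
  - exact: measurable_int fL.
  - by apply: filterS (good_set_cvg fL f0 fpos) => x hx _.
  - exact: fL.
  - apply: aeW => x j _; rewrite lee_fin ger0_norm; by case/andP: (uf j x).
  rewrite -[X in _ --> X -> _]/(0%:E) => /fine_cvg/=; apply: cvg_trans.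
  apply: near_eq_cvg; near=> j.
  rewrite /Rintegral; congr fine; apply: eq_integral => x _ /=.
  by rewrite distrC ger0_norm// subr_ge0; case/andP: (uf j x).
(* The second bound leaves [u] at least half of the integral of [f], hence a positive integral. *)
pose e' := Num.min e (\int[m]_x f x / 2).
have e'0 : 0 < e' by rewrite lt_min e0 divr_gt0.
have /cvgrPdist_le/(_ _ e'0)[j _ /(_ j (leqnn j))] := cv.
rewrite /= sub0r normrN => hj0.
have hj : \int[m]_x (f x - u j x) <= e' by exact: le_trans (ler_norm _) hj0.
exists (u j); split; last 2 first.
- by move=> x; case/andP: (uf j x).
- by rewrite (le_trans hj)// ge_min lexx.
have u0 x : 0 <= u j x by case/andP: (uf j x).
have uD x : ~ good_set f j x -> u j x = 0.
  by move=> nE; rewrite /u indicE memNset// mulr0.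
have mu := is_L1_measurable (uL j).
split => //.
- have : \int[m]_x (f x - u j x) <= \int[m]_x f x / 2.
    by rewrite (le_trans hj)// ge_min lexx orbT.
  rewrite RintegralB//; last exact: uL.
  by move: (\int[m]_x f x) (\int[m]_x u j x) fpos => A B A0; lra.
- exists j.+1%:R => x; rewrite /u indicE; case: (boolP (x \in _)).
    by rewrite inE mulr1 => -[[]].
  by rewrite mulr0.
- by exists (good_set f j) => //; split => //; exact: good_set_fin.
- exists j.+1%:R => // n n0.
  have ja0 : 0 < j.+1%:R * a n by rewrite mulr_gt0// return_sequence_gt0.
  (* The inequality u <= f transfers the bound for [f], but only on the good set; the maximum
     principle extends it to the whole space because [u] is supported there. *)
  apply: (dual_bound_maximum_principle mp (mE j)) => //; first exact: ltW.
  apply: (@dual_boundW _ _ _ _ _ _ _ f) => //.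
  apply: (dual_bound_of_transfer mp (mE j)) => // x [_].
  by apply.
Unshelve. all: by end_near. Qed.

Lemma nice_dual u : nice u -> exists2 C, 0 <= C & forall n, (0 < n)%N ->
  forall phi, bounded_measurable phi -> (forall x, 0 <= phi x) -> is_L1 m phi ->
  \int[m]_x (u x * birkhoff_sum T phi n x) <= C * a n * \int[m]_x phi x.
Proof.
move=> nu; have [C C0 h] := nice_bound nu; exists C => // n n0 phi bphi phi0 phiL.
have := h n n0 phi (is_L1_measurable phiL) phi0 (fun x nI => False_ind _ (nI I)).
rewrite -!EFin_Rintegral// ?lee_fin//.
apply: is_L1M_bounded; first exact: nice_L1.
exact: bounded_measurable_birkhoff_sum.
Qed.

End NiceFunctions.

(** * Moments of Birkhoff sums *)

Section TransferEstimate.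
Context {R : realType} (d : measure_display) (X : measurableType d)
  (m : {sigma_finite_measure set X -> \bar R}) (T : {mfun X >-> X}).
Hypothesis mp : measure_preserving m T.
Variable a : nat -> R.
Hypothesis ra : return_sequence m T a.
Implicit Types u phi g : X -> R.
Local Notation nice := (nice m T a).

Definition bad_set u k (eta : R) : set X :=
  [set x | eta < `|transfer_sum m T u k x / a k - \int[m]_x u x|].

Lemma measurable_bad_set u k eta : is_L1 m u -> measurable (bad_set u k eta).
Proof.
move=> uL; rewrite -[X in measurable X]setTI.
apply: measurable_fun_ltr => //.
have mU : measurable_fun [set: X] (transfer_sum m T u k).
  by apply: is_L1_measurable; exact: transfer_sum_L1.
apply: measurableT_comp => //; apply: measurable_funB => //.
exact: measurable_funM.
Qed.

Lemma bad_set_cvg u eta (E : set X) : nice u -> 0 < eta -> measurable E -> (m E < +oo)%E ->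
  fine (m (bad_set u k eta `&` E)) @[k --> \oo] --> (0 : R).
Proof.
move=> nu eta0 mE Efin.
have [_ /(_ _ (nice_L1plus nu))/=[cm _]] := ra.
pose nu0 : {finite_measure set X -> \bar R} := mfrestr mE Efin.
have dom : nu0 `<< m.
  apply/null_content_dominatesP => A mA mA0.
  apply/eqP; rewrite eq_le measure_ge0 andbT -mA0 /nu0/= /mfrestr /mrestr.
  by apply: le_measure; rewrite ?inE//; exact: measurableI.
have := cm nu0 dom eta eta0.
by rewrite -[X in _ --> X -> _]/(0%:E) => /fine_cvg.
Qed.

(** Off the bad set the transfer sum is within eta a_k of its limit; on it the dual bound of [u] is
    available, with a constant free of k and eta. The mass of [g] on the bad set stays explicit
    because [g] will vary with a second time. *)
Lemma transfer_estimate u : nice u -> exists2 C, 0 <= C & forall k eta g, (0 < k)%N ->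
  0 < eta -> bounded_measurable g -> (forall x, 0 <= g x) -> is_L1 m g ->
  `|\int[m]_x (u x * birkhoff_sum T g k x) - (\int[m]_x u x) * a k * \int[m]_x g x| <=
  a k * (eta * \int[m]_x g x + C * \int[m]_x (g x * \1_(bad_set u k eta) x)).
Proof.
move=> nu; have [C0 C00 dual] := nice_dual nu.
have uL := nice_L1 nu.
set M := \int[m]_x u x; have M0 : 0 <= M by exact: ltW (nice_int_gt0 nu).
exists (C0 + M) => [|k eta g k0 eta0 bg g0 gL]; first by rewrite addr_ge0.
have ak0 := return_sequence_gt0 ra k0.
have mB := measurable_bad_set k eta uL.
set B := bad_set u k eta in mB *.
have bB : bounded_measurable (\1_B : X -> R) by exact: bounded_measurable_indic.
have bBc : bounded_measurable (\1_(~` B) : X -> R).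
  by apply: bounded_measurable_indic; exact: measurableC.
pose g1 x := g x * \1_B x; pose g2 x := g x * \1_(~` B) x.
have bg1 : bounded_measurable g1 by exact: bounded_measurableM.
have bg2 : bounded_measurable g2 by exact: bounded_measurableM.
have g1L : is_L1 m g1 by exact: is_L1M_bounded.
have g2L : is_L1 m g2 by exact: is_L1M_bounded.
have g10 x : 0 <= g1 x by rewrite mulr_ge0// indicE.
have g20 x : 0 <= g2 x by rewrite mulr_ge0// indicE.
have gE x : g x = g1 x + g2 x.
  by rewrite /g1 /g2 -mulrDr !indicE in_setC; case: (x \in B); rewrite ?addr0 ?add0r mulr1.
have intg : \int[m]_x g x = \int[m]_x g1 x + \int[m]_x g2 x.
  by rewrite -RintegralD//; apply: eq_Rintegral => x _; exact: gE.
have bS g' : bounded_measurable g' -> is_L1 m (fun x => u x * birkhoff_sum T g' k x).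
  by move=> bg'; apply: is_L1M_bounded => //; exact: bounded_measurable_birkhoff_sum.
have intS : \int[m]_x (u x * birkhoff_sum T g k x) =
    \int[m]_x (u x * birkhoff_sum T g1 k x) + \int[m]_x (u x * birkhoff_sum T g2 k x).
  rewrite -RintegralD//; [|exact: bS|exact: bS].
  apply: eq_Rintegral => x _; rewrite -mulrDr -birkhoff_sumD.
  by congr (_ * _); apply: eq_bigr => i _; exact: gE.
have h1 : 0 <= \int[m]_x (u x * birkhoff_sum T g1 k x) <= C0 * a k * \int[m]_x g1 x.
  rewrite dual// andbT Rintegral_ge0// => x _.
  by rewrite mulr_ge0 ?(nice_ge0 nu)// birkhoff_sum_ge0.
have h2 : `|\int[m]_x (u x * birkhoff_sum T g2 k x) - M * a k * \int[m]_x g2 x| <=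
    eta * a k * \int[m]_x g2 x.
  have UL := transfer_sum_L1 mp k uL.
  have i1 : is_L1 m (fun x => transfer_sum m T u k x * g2 x) by exact: is_L1M_bounded.
  have i2 c : is_L1 m (fun x => c * g2 x).
    by have := integrableZl measurableT c g2L; apply: eq_integrable.
  have i3 : is_L1 m (fun x => transfer_sum m T u k x * g2 x - M * a k * g2 x).
    exact: (integrableB measurableT i1 (i2 _)).
  rewrite -transfer_sum_dual// -!RintegralZl// -RintegralB//; last exact: i2.
  apply: (le_trans (le_normr_Rintegral _ _)) => //.
  apply: le_Rintegral => //; [exact: (integrable_abse i3)|exact: i2|].
  move=> x _; rewrite -mulrBl normrM (ger0_norm (g20 x)).
  have [Bx|nBx] := pselect (B x).
    by rewrite /g2 indicE memNset ?mulr0//; apply.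
  rewrite ler_wpM2r//.
  have : `|transfer_sum m T u k x / a k - M| <= eta by rewrite leNgt; apply/negP.
  have -> : `|transfer_sum m T u k x - M * a k| = `|transfer_sum m T u k x / a k - M| * a k.
    by rewrite -[X in _ = _ * X](ger0_norm (ltW ak0)) -normrM mulrBl divfK ?gt_eqF.
  by rewrite ler_pM2r.
have I1 : 0 <= \int[m]_x g1 x by rewrite Rintegral_ge0.
have I2 : 0 <= \int[m]_x g2 x by rewrite Rintegral_ge0.
rewrite intS intg.
rewrite (_ : _ - _ = (\int[m]_x (u x * birkhoff_sum T g1 k x) - M * a k * \int[m]_x g1 x) +
  (\int[m]_x (u x * birkhoff_sum T g2 k x) - M * a k * \int[m]_x g2 x)); last by ring.
apply: (le_trans (ler_normD _ _)).
have h1' : `|\int[m]_x (u x * birkhoff_sum T g1 k x) - M * a k * \int[m]_x g1 x| <=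
    (C0 + M) * a k * \int[m]_x g1 x.
  move: h1; have : 0 <= M * a k * \int[m]_x g1 x by rewrite !mulr_ge0// ltW.
  have : 0 <= C0 * a k * \int[m]_x g1 x by rewrite !mulr_ge0// ltW.
  have -> : (C0 + M) * a k * \int[m]_x g1 x =
    C0 * a k * \int[m]_x g1 x + M * a k * \int[m]_x g1 x by ring.
  move: (C0 * _ * _) (M * a k * _) (\int[m]_x (u x * _)) => p q r p0 q0 /andP[r0 rp].
  by rewrite ler_norml; apply/andP; split; lra.
apply: (le_trans (lerD h1' h2)).
rewrite -/g1 -subr_ge0.
rewrite (_ : _ - _ = a k * (eta * \int[m]_x g1 x)); last by ring.
by rewrite !mulr_ge0// ltW.
Qed.

Variable f : X -> R.
Hypothesis nf : nice f.
Local Notation S := (birkhoff_sum T f).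

Lemma bounded_measurable_power n q : bounded_measurable (fun x => S n x ^+ q).
Proof.
apply: bounded_measurableX; apply: bounded_measurable_birkhoff_sum.
exact: (nice_bounded_measurable nf).
Qed.

Lemma power_ge0 n q x : 0 <= S n x ^+ q.
Proof. by rewrite exprn_ge0// birkhoff_sum_ge0//; exact: nice_ge0 nf. Qed.

Lemma nice_power_L1 u n q : nice u -> is_L1 m (fun x => u x * S n x ^+ q).
Proof.
by move=> nu; apply: is_L1M_bounded (nice_L1 nu) _; exact: bounded_measurable_power.
Qed.

Lemma bounded_measurable_weight n q : bounded_measurable (fun x => f x * S n x ^+ q).
Proof.
by apply: bounded_measurableM; [exact: nice_bounded_measurable nf|exact: bounded_measurable_power].
Qed.

(** Each power costs one dual bound C a_n for the current weight, and the remaining factor is a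
    moment against the weight [f]; hence the induction over all nice weights. *)
Lemma moment_bound q u : nice u -> exists2 D, 0 <= D &
  forall n, (0 < n)%N -> \int[m]_x (u x * S n x ^+ q) <= D * a n ^+ q.
Proof.
have f0 := nice_ge0 nf.
elim: q u => [|q IH] u nu.
  exists (\int[m]_x u x); first exact: ltW (nice_int_gt0 nu).
  by move=> n _; rewrite expr0 mulr1; under eq_Rintegral do rewrite expr0 mulr1.
have [D D0 hD] := IH f nf.
have [C C0 dual] := nice_dual nu.
exists (q.+1%:R * (C * D)); first by rewrite !mulr_ge0.
move=> n n0; have an0 := return_sequence_gt0 ra n0.
have gL : is_L1 m (fun x => f x * S n x ^+ q) by exact: nice_power_L1.
have g0 x : 0 <= f x * S n x ^+ q by rewrite mulr_ge0// power_ge0.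
have bg := bounded_measurable_weight n q.
have i1 : is_L1 m (fun x => u x * birkhoff_sum T (fun x => f x * S n x ^+ q) n x).
  apply: is_L1M_bounded (nice_L1 nu) _; exact: bounded_measurable_birkhoff_sum.
apply: (@le_trans _ _ (q.+1%:R *
    \int[m]_x (u x * birkhoff_sum T (fun x => f x * S n x ^+ q) n x))).
  rewrite -RintegralZl//; apply: le_Rintegral => //.
  - exact: nice_power_L1.
  - by have := integrableZl measurableT q.+1%:R i1; apply: eq_integrable.
  - move=> x _; rewrite mulrCA ler_wpM2l ?(nice_ge0 nu)//.
    apply: (le_trans (birkhoff_sum_pow_le T f0 _ _ _)).
    by rewrite ler_wpM2l// birkhoff_diag_le.
rewrite -mulrA ler_wpM2l// (le_trans (dual n n0 _ bg g0 gL))//.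
apply: (@le_trans _ _ (C * a n * (D * a n ^+ q))).
  by rewrite ler_wpM2l ?hD// mulr_ge0// ltW.
by rewrite exprS; apply/eqW; ring.
Qed.

(** The point is that N does not depend on j. The mass of f S_j^q on the bad set is split into a
    small multiple of the moment of order 2q and a multiple of the measure of the bad set inside the
    support of [f], a quantity free of j. *)
Lemma weighted_transfer_cvg q u (e : R) : nice u -> 0 < e ->
  exists N, forall k j, (N <= k)%N -> (0 < j)%N ->
  `|\int[m]_x (u x * birkhoff_sum T (fun x => f x * S j x ^+ q) k x) -
    (\int[m]_x u x) * a k * \int[m]_x (f x * S j x ^+ q)| <= e * (a k * a j ^+ q).
Proof.
move=> nu e0; have f0 := nice_ge0 nf.
have [C C0 est] := transfer_estimate nu.
have [D D0 hD] := moment_bound q nf.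
have [D' D'0 hD'] := moment_bound (q + q) nf.
have [E [mE Efin] fE] := nice_supp nf.
have [K fK] := nice_le nf.
have K0 : 0 <= K by rewrite (le_trans (f0 point)).
(* Three shares of e/3: eta against the moment of order q, del against that of order 2q, and the
   measure of the bad set. The added 1 guards against vanishing constants. *)
pose eta := e / 3 / (D + 1).
have D1 : 0 < D + 1 by rewrite ltr_wpDl.
have eta0 : 0 < eta by rewrite !divr_gt0.
pose del := e / 3 / (C * D' + 1).
have CD1 : 0 < C * D' + 1 by rewrite ltr_wpDl// mulr_ge0.
have del0 : 0 < del by rewrite !divr_gt0.
have frac (x y : R) : 0 <= x -> 0 <= y -> x / (y + 1) * y <= x.
  move=> x0 y0; rewrite -mulrA ler_piMr// mulrC ler_pdivrMr ?ltr_wpDl//.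
  by rewrite mul1r lerDl.
have etaD : eta * D <= e / 3 by apply: frac; rewrite // divr_ge0// ltW.
have delD : C * D' * del <= e / 3.
  by rewrite mulrC; apply: frac; [rewrite divr_ge0// ltW|exact: mulr_ge0].
pose be k := fine (m (bad_set u k eta `&` E)).
have be_cvg : C * (K / del) * be k @[k --> \oo] --> (0 : R).
  rewrite -[X in _ --> X](mulr0 (C * (K / del))); apply: cvgMr.
  exact: bad_set_cvg.
have e30 : 0 < e / 3 by rewrite divr_gt0.
have /cvgrPdist_le/(_ _ e30)[N _ hN] := be_cvg.
exists N.+1 => k j Nk j0.
have k0 : (0 < k)%N by exact: leq_trans Nk.
have ak0 := return_sequence_gt0 ra k0; have aj0 := return_sequence_gt0 ra j0.
have gL : is_L1 m (fun x => f x * S j x ^+ q) by exact: nice_power_L1.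
have g0 x : 0 <= f x * S j x ^+ q by rewrite mulr_ge0// power_ge0.
have bg := bounded_measurable_weight j q.
apply: (le_trans (est k eta _ k0 eta0 bg g0 gL)).
rewrite mulrCA ler_pM2l//.
set B := bad_set u k eta.
have mB : measurable B := measurable_bad_set k eta (nice_L1 nu).
have bB : bounded_measurable (\1_B : X -> R) by exact: bounded_measurable_indic.
have mBE : measurable (B `&` E) by exact: measurableI.
have BEfin : (m (B `&` E) < +oo)%E.
  by apply: le_lt_trans Efin; apply: le_measure; rewrite ?inE.
have iBE : is_L1 m (\1_(B `&` E)).
  apply/integrableP; split; first by apply/measurable_EFinP; exact: measurable_indic.
  under eq_integral do rewrite /= ger0_norm//.
  by rewrite integral_indic// setIT.
have intBE : \int[m]_x (\1_(B `&` E) x) = be k.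
  by rewrite /Rintegral integral_indic// setIT.
set A := a j ^+ q; have A0 : 0 < A by rewrite exprn_gt0.
have ip := nice_power_L1 j (q + q) nf.
have ptw x : f x * S j x ^+ q * \1_B x <=
    del / A * (f x * S j x ^+ (q + q)) + A * (K / del) * \1_(B `&` E) x.
  rewrite exprD; have := power_ge0 j q x; move: (S j x ^+ q) => s s0.
  rewrite !indicE; have [Bx|nBx] := pselect (B x); last first.
    have dA : 0 <= del / A by rewrite divr_ge0// ltW.
    have Kd : 0 <= A * (K / del) by rewrite mulr_ge0 ?(ltW A0)// divr_ge0// ltW.
    rewrite memNset// mulr0; apply: addr_ge0; last by rewrite mulr_ge0.
    by rewrite (mulr_ge0 dA)// mulr_ge0// mulr_ge0.
  rewrite mem_set// mulr1.
  have [Ex|nEx] := pselect (E x); last by rewrite fE// !mul0r mulr0 add0r memNset ?mulr0// => -[].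
  rewrite mem_set// mulr1.
  (* With s = S_j(x)^q and A = a_j^q, the scaling by A makes both terms of order A after
     integration. *)
  have amgm : s <= del / A * (s * s) + A / del.
    have h : 0 <= del / A * (s - A / del) ^+ 2.
      by rewrite mulr_ge0 ?sqr_ge0// divr_ge0 ?ltW.
    rewrite -subr_ge0; apply: (le_trans (addr_ge0 h s0)).
    by apply/eqW; field; rewrite !gt_eqF.
  apply: (@le_trans _ _ (f x * (del / A * (s * s) + A / del))).
    by rewrite ler_wpM2l.
  rewrite mulrDr lerD//; first by apply/eqW; ring.
  rewrite (_ : A * (K / del) = K * (A / del)); last by ring.
  by rewrite ler_wpM2r// divr_ge0 ?ltW.
have intB : \int[m]_x (f x * S j x ^+ q * \1_B x) <=
    A * (del * D' + K / del * be k).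
  have i1 : is_L1 m (fun x => del / A * (f x * S j x ^+ (q + q))).
    by have := integrableZl measurableT (del / A) ip; apply: eq_integrable.
  have i2 : is_L1 m (fun x => A * (K / del) * \1_(B `&` E) x).
    by have := integrableZl measurableT (A * (K / del)) iBE; apply: eq_integrable.
  apply: (@le_trans _ _ (\int[m]_x (del / A * (f x * S j x ^+ (q + q)) +
      A * (K / del) * \1_(B `&` E) x))).
    apply: le_Rintegral => //.
    - exact: is_L1M_bounded.
    - exact: is_L1D.
  rewrite RintegralD// !RintegralZl// intBE.
  rewrite mulrDr (mulrA A (K / del)) lerD2r.
  apply: (@le_trans _ _ (del / A * (D' * a j ^+ (q + q)))).
    by rewrite ler_wpM2l ?hD'// divr_ge0 ?ltW.
  by rewrite exprD -/A; apply/eqW; field; rewrite gt_eqF.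
have h1 : eta * \int[m]_x (f x * S j x ^+ q) <= e / 3 * A.
  apply: (@le_trans _ _ (eta * (D * A))); first by rewrite ler_wpM2l ?hD// ltW.
  by rewrite mulrA ler_wpM2r// ltW.
have h2 : C * \int[m]_x (f x * S j x ^+ q * \1_B x) <= (e / 3 + e / 3) * A.
  apply: (le_trans (ler_wpM2l C0 intB)).
  rewrite (_ : C * _ = (C * D' * del + C * (K / del) * be k) * A); last by ring.
  rewrite ler_wpM2r ?(ltW A0)// lerD//.
  have := hN k (ltnW Nk); rewrite /= sub0r normrN; apply: le_trans.
  exact: ler_norm.
apply: (le_trans (lerD h1 h2)).
by rewrite -mulrDl ler_wpM2r ?(ltW A0)//; lra.
Qed.

End TransferEstimate.

(** * Divergence and regularity of the return sequence *)

Section Recurrence.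
Context {R : realType} (d : measure_display) (X : measurableType d)
  (m : {sigma_finite_measure set X -> \bar R}) (T : {mfun X >-> X}).
Hypothesis mp : measure_preserving m T.
Hypothesis cons : conservative m T.

(* Borel-Cantelli leaves only points of [A] with a last visit to [A]; the set of
   points of [A] which never return is wandering. *)
Lemma conservative_return_sum (A : set X) : measurable A ->
  (\sum_(0 <= k <oo) m (A `&` iter k T @^-1` A) < +oo)%E -> m A = 0%E.
Proof.
move=> mA sumF.
have mTA k := measurable_iter_preimage T k mA.
have mF k : measurable (A `&` iter k T @^-1` A) by exact: measurableI.
have limsup0 := lim_sup_set_cvg0 mF sumF.
pose W := A `&` \bigcap_(l in [set l | (0 < l)%N]) ~` (iter l T @^-1` A).
have mW : measurable W.
  apply: measurableI => //; apply: bigcap_measurable; first by exists 1%N.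
  by move=> l _; exact: measurableC.
have W0 : m W = 0%E.
  apply: cons => // i j _ _ [x [Wi Wj]].
  have aux (p q : nat) : (p < q)%N -> W (iter p T x) -> W (iter q T x) -> False.
    move=> pq [_ /(_ (q - p)%N)] + [Aq _]; rewrite /= subn_gt0 => /(_ pq); apply.
    by rewrite /= -iterD subnK// ltnW.
  by case: (ltngtP i j) => // ij; [case: (aux _ _ ij Wi Wj)|case: (aux _ _ ij Wj Wi)].
have cover : A `<=` lim_sup_set (fun k => A `&` iter k T @^-1` A) `|`
    \bigcup_k (iter k T @^-1` W).
  move=> x Ax; have [inf|/existsNP[n hn]] := pselect (forall n, exists j, (n <= j)%N /\ A (iter j T x)).
    left => n _; have [j [nj Aj]] := inf n; exists j => //.
  right; have {}hn j : (n <= j)%N -> ~ A (iter j T x) by move=> nj Aj; apply: hn; exists j.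
  elim: n hn => [|n IH] hn; first by case: (hn 0%N (leqnn _)).
  have [An|nAn] := pselect (A (iter n T x)).
    exists n => //; split => // l /= l0; rewrite /= -iterD; apply: hn.
    by rewrite -[n.+1]add1n leq_add2r.
  by apply: IH => j; rewrite leq_eqVlt => /predU1P[<-//|]; exact: hn.
apply/negligibleP => //; apply: negligibleS cover _; apply: negligibleU.
  apply/negligibleP => //; apply: bigcap_measurable; first by exists 0%N.
  by move=> n _; apply: bigcup_measurable => k _; exact: mF.
apply: negligible_bigcup => k; apply/negligibleP; first exact: measurable_iter_preimage.
exact: etrans (measure_preserving_iter mp k mW) W0.
Qed.

Variable a : nat -> R.
Hypothesis ra : return_sequence m T a.
Variable f : X -> R.
Hypothesis nf : nice m T a f.

(** A comparison sequence for a_n that is monotone with bounded increments by construction. *)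
Definition autocorrelation n := \int[m]_x (f x * birkhoff_sum T f n x).

Lemma autocorrelation_L1 n : is_L1 m (fun x => f x * birkhoff_sum T f n x).
Proof.
apply: is_L1M_bounded (nice_L1 nf) _; apply: bounded_measurable_birkhoff_sum.
exact: nice_bounded_measurable nf.
Qed.

Lemma autocorrelation_nondecreasing : nondecreasing_seq autocorrelation.
Proof.
have f0 := nice_ge0 nf.
move=> n n' nn'; apply: le_Rintegral => //; try exact: autocorrelation_L1.
by move=> x _; rewrite ler_wpM2l// birkhoff_sum_nondecreasing.
Qed.

Lemma autocorrelation_cvg : autocorrelation n / a n @[n --> \oo] --> (\int[m]_x f x) ^+ 2.
Proof.
apply/cvgrPdist_le => e e0.
have [N hN] := weighted_transfer_cvg mp ra nf 0 nf e0.
near=> n.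
have n0 : (0 < n)%N by near: n; exact: nbhs_infty_gt.
have an0 := return_sequence_gt0 ra n0.
have Nn : (N <= n)%N by near: n; exact: nbhs_infty_ge.
have := hN n 1%N Nn isT; rewrite expr0 mulr1.
have fE : (fun x => f x * birkhoff_sum T f 1 x ^+ 0) = f.
  by apply/funext => x; rewrite expr0 mulr1.
rewrite fE -/(autocorrelation n) distrC => h.
rewrite -(ler_pM2r an0) -[X in _ * X <= _](ger0_norm (ltW an0)) -normrM mulrBl.
by rewrite divfK ?gt_eqF// expr2 mulrAC.
Unshelve. all: by end_near. Qed.

(** A bound M would give, for A = {f >= 1/j}, return probabilities m(A and T^(-k) A) summing to at
    most j^2 M. By conservativity every such A would be null, contradicting the positive integral of
    [f]. *)
Lemma autocorrelation_unbounded (M : R) : exists n, M < autocorrelation n.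
Proof.
apply: contrapT => /forallNP hM.
have {}hM n : autocorrelation n <= M by rewrite leNgt; apply/negP; exact: hM.
have f0 := nice_ge0 nf; have mf := nice_measurable nf.
pose A (j : nat) : set X := [set x | 1 <= j%:R * f x].
have mA j : measurable (A j).
  rewrite -[X in measurable X]setTI; apply: measurable_fun_le => //.
  exact: measurable_funM.
have A0 j : m (A j) = 0%E.
  apply: conservative_return_sum => //.
  have mF k : measurable (A j `&` iter k T @^-1` A j).
    by apply: measurableI => //; exact: measurable_iter_preimage.
  apply: (@le_lt_trans _ _ (j%:R * j%:R * M)%:E); last exact: ltry.
  apply: lime_le; first exact: is_cvg_nneseries.
  apply: nearW => n; rewrite big_mkord.
  have h k : (m (A j `&` iter k T @^-1` A j) <=
      \int[m]_x (j%:R * j%:R * (f x * f (iter k T x)))%:E)%E.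
    rewrite -(setIT (A j `&` _)) -integral_indic//.
    apply: ge0_le_integral => //.
    - by apply/measurable_EFinP; exact: measurable_indic.
    - apply/measurable_EFinP; apply: measurable_funM => //; apply: measurable_funM => //.
      exact: (measurableT_comp mf (measurable_iter T k)).
    - move=> x _; rewrite lee_fin indicE; case: (boolP (x \in _)) => [|_].
        rewrite inE /A/= => -[h1 h2].
        rewrite mulrACA (le_trans h1)// ler_peMr// mulr_ge0//.
      by rewrite !mulr_ge0.
  apply: (@le_trans _ _ (\sum_(k < n) \int[m]_x (j%:R * j%:R * (f x * f (iter k T x)))%:E)%E).
    by apply: lee_sum => k _; exact: h.
  rewrite -ge0_integral_sum//; last 2 first.
  - move=> k; apply/measurable_EFinP; apply: measurable_funM => //; apply: measurable_funM => //.
    exact: (measurableT_comp mf (measurable_iter T k)).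
  - by move=> k x _; rewrite lee_fin !mulr_ge0.
  under eq_integral do rewrite sumEFin -mulr_sumr -mulr_sumr EFinM.
  rewrite integralZl//; last exact: (autocorrelation_L1 n).
  rewrite [leRHS]EFinM lee_wpmul2l ?lee_fin ?mulr_ge0//.
  rewrite -(EFin_Rintegral (autocorrelation_L1 n)) lee_fin.
  exact: hM.
have : \int[m]_x f x = 0.
  rewrite /Rintegral.
  rewrite (@ae_eq_integral _ _ _ m setT (cst 0%E))//.
  - by rewrite integral_cst// mul0e.
  - exact/measurable_EFinP.
  - have : {ae m, forall x j, ~ A j x}.
      apply/ae_foralln => j; exists (A j); split; [exact: mA|exact: A0|].
      by move=> x /= /contrapT.
    apply: filterS => x hx _; congr EFin; apply/eqP; rewrite eq_le f0 andbT leNgt.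
    apply/negP => fx; apply: (hx (Num.bound (f x)^-1)); rewrite /A/=.
    rewrite -ler_pdivrMr// mul1r ltW// archi_boundP// invr_ge0 ltW//.
by move=> fint; have := nice_int_gt0 nf; rewrite fint ltxx.
Qed.

Lemma autocorrelation_dvg : autocorrelation n @[n --> \oo] --> +oo.
Proof.
apply/cvgryPge => M; have [N hN] := autocorrelation_unbounded M.
by exists N => // n /= Nn; rewrite (le_trans (ltW hN))// autocorrelation_nondecreasing.
Qed.

Lemma return_sequence_dvg : a n @[n --> \oo] --> +oo.
Proof.
set L := (\int[m]_x f x) ^+ 2.
have L0 : 0 < L by rewrite exprn_gt0// (nice_int_gt0 nf).
have L1 : 0 < L + 1 by rewrite addr_gt0.
apply/cvgryPge => M.
have h : \forall n \near \oo, autocorrelation n / a n <= L + 1.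
  by apply: (cvgr_le _ autocorrelation_cvg); rewrite ltrDl.
have h2 : \forall n \near \oo, `|M| * (L + 1) <= autocorrelation n.
  by move/cvgryPge : autocorrelation_dvg; apply.
near=> n.
have n0 : (0 < n)%N by near: n; exact: nbhs_infty_gt.
have an0 := return_sequence_gt0 ra n0.
rewrite (le_trans (ler_norm _))// -(ler_pM2r L1) (le_trans (_ : _ <= autocorrelation n))//.
  by near: n.
by rewrite mulrC -ler_pdivrMr//; near: n.
Unshelve. all: by end_near. Qed.

(** The autocorrelation grows by at most K times the integral of [f] per step while it diverges, so
    its consecutive ratios tend to 1; [a] inherits this. *)
Lemma return_sequence_ratio_cvg : a n.+1 / a n @[n --> \oo] --> (1 : R).
Proof.
set L := (\int[m]_x f x) ^+ 2.
have L0 : 0 < L by rewrite exprn_gt0// (nice_int_gt0 nf).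
have f0 := nice_ge0 nf.
have [K fK] := nice_le nf.
have K0 : 0 <= K by rewrite (le_trans (f0 point)).
have fL := nice_L1 nf.
have incr n : autocorrelation n.+1 <= autocorrelation n + K * \int[m]_x f x.
  have i1 : is_L1 m (fun x => K * f x).
    by have := integrableZl measurableT K fL; apply: eq_integrable.
  have i2 := autocorrelation_L1 n.
  rewrite -RintegralZl// -RintegralD//.
  apply: le_Rintegral => //; [exact: autocorrelation_L1|exact: is_L1D|].
  by move=> x _; rewrite birkhoff_sumSr mulrDr lerD2l mulrC ler_wpM2r.
have bdvg := autocorrelation_dvg.
have b0 : \forall n \near \oo, 0 < autocorrelation n by move/cvgryPgt : bdvg; apply.
have bV : (autocorrelation n)^-1 @[n --> \oo] --> (0 : R) by apply/gtr0_cvgV0.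
have ratio : autocorrelation n.+1 / autocorrelation n @[n --> \oo] --> (1 : R).
  apply: (@squeeze_cvgr _ _ _ _ (cst 1)
    (fun n => 1 + K * \int[m]_x f x * (autocorrelation n)^-1)).
  - near=> n; have bn : 0 < autocorrelation n by near: n.
    rewrite ler_pdivlMr// mul1r autocorrelation_nondecreasing//=.
    by rewrite ler_pdivrMr// mulrDl mul1r divfK ?gt_eqF.
  - exact: cvg_cst.
  - rewrite -[X in _ --> X]addr0; apply: cvgD; first exact: cvg_cst.
    by rewrite -[X in _ --> X](mulr0 (K * \int[m]_x f x)); apply: cvgMr.
have c1 := autocorrelation_cvg.
have c2 : autocorrelation n.+1 / a n.+1 @[n --> \oo] --> L.
  by have := c1; rewrite -(cvg_shiftS (fun n => autocorrelation n / a n)).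
have c2V : (autocorrelation n.+1 / a n.+1)^-1 @[n --> \oo] --> L^-1.
  by apply: cvgV => //; rewrite gt_eqF.
have c3 : autocorrelation n.+1 / autocorrelation n * (autocorrelation n / a n) *
    (autocorrelation n.+1 / a n.+1)^-1 @[n --> \oo] --> 1 * L * L^-1.
  by apply: cvgM => //; apply: cvgM.
move: c3; rewrite mul1r divff ?gt_eqF//; apply: cvg_trans; apply: near_eq_cvg.
near=> n.
have n0 : (0 < n)%N by near: n; exact: nbhs_infty_gt.
have an0 := return_sequence_gt0 ra n0; have an1 := return_sequence_gt0 ra (ltn0Sn n).
have bn : 0 < autocorrelation n by near: n.
have bn1 : 0 < autocorrelation n.+1.
  by rewrite (lt_le_trans bn)// autocorrelation_nondecreasing.
move: (autocorrelation n) (autocorrelation n.+1) (a n) (a n.+1) an0 an1 bn bn1.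
by move=> x y z t x0 y0 z0 t0; field; rewrite !gt_eqF.
Unshelve. all: by end_near. Qed.

End Recurrence.

(** * Convergence of moments *)

Section MomentLimit.
Context {R : realType} (d : measure_display) (X : measurableType d)
  (m : {sigma_finite_measure set X -> \bar R}) (T : {mfun X >-> X}).
Hypothesis mp : measure_preserving m T.
Hypothesis cons : conservative m T.
Variable a : nat -> R.
Hypothesis ra : return_sequence m T a.
Variable gamma : R.
Hypothesis gamma01 : 0 <= gamma <= 1.
Hypothesis rva : regularly_varying a gamma.
Variable f : X -> R.
Hypothesis nf : nice m T a f.
Local Notation S := (birkhoff_sum T f).

Lemma regularly_varying_grid L i : (0 < L)%N -> (0 < i)%N ->
  a (i * N)%N / a (L * N)%N @[N --> \oo] --> ((i%:R / L%:R : R) `^ gamma).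
Proof.
move=> L0 i0.
have LR : 0 < L%:R :> R by rewrite ltr0n.
have c0 : 0 < (i%:R / L%:R : R) by rewrite divr_gt0// ltr0n.
have := cvg_comp _ _ (muln_cvgy L0) (rva c0).
apply: cvg_trans; apply: near_eq_cvg; near=> N => /=.
suff -> : Num.truncn (i%:R / L%:R * (L * N)%:R : R) = (i * N)%N by [].
rewrite natrM mulrA divfK ?gt_eqF// -natrM; exact: natrK.
Unshelve. all: by end_near. Qed.

Lemma cvg_exprn (v : nat -> R) (l : R) q : v n @[n --> \oo] --> l ->
  v n ^+ q @[n --> \oo] --> l ^+ q.
Proof.
move=> vl; elim: q => [|q IH].
  by under eq_fun do rewrite expr0; rewrite expr0; exact: cvg_cst.
by under eq_fun do rewrite exprS; rewrite exprS; exact: cvgM.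
Qed.

Definition mittag_leffler_moment q : R :=
  q`!%:R * Gamma (1 + gamma) ^+ q / Gamma (1 + q%:R * gamma).

Lemma mittag_leffler_moment0 : mittag_leffler_moment 0 = 1.
Proof.
have G1 : Gamma (1 + 0) = 1 :> R by exact: (Gamma1D_nat 0).
by rewrite /mittag_leffler_moment !mul0r G1 fact0 expr0 mulr1 divr1.
Qed.

(** The recursion produced by the block argument with exponents al = gamma and be = q gamma. *)
Lemma mittag_leffler_momentS q : mittag_leffler_moment q.+1 =
  q.+1%:R * (mittag_leffler_moment q * conv_limit gamma (q%:R * gamma)).
Proof.
have /andP[g0 _] := gamma01.
rewrite /mittag_leffler_moment /conv_limit factS natrM.
have -> : 1 + (gamma + q%:R * gamma) = 1 + q.+1%:R * gamma by rewrite -natr1; ring.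
have h1 : 0 < Gamma (1 + q%:R * gamma) by rewrite Gamma1D_gt0// mulr_ge0.
have h2 : 0 < Gamma (1 + q.+1%:R * gamma) by rewrite Gamma1D_gt0// mulr_ge0.
move: (Gamma (1 + gamma)) (Gamma (1 + q%:R * gamma)) (Gamma (1 + q.+1%:R * gamma)) h1 h2.
by move=> x y z y0 z0; rewrite exprS; field; rewrite !gt_eqF.
Qed.

(** At q = 0 and j = 0 the integral would not vanish, since S_0^0 = 1. The value 0 agrees with
    [grid_pow] and keeps monotonicity in j; the diagonal has j = n - k > 0 and is unaffected. *)
Definition shifted_weight u q (k j : nat) : R :=
  if j == 0%N then 0 else \int[m]_x (u x * (f (iter k T x) * S j (iter k T x) ^+ q)).

Lemma shifted_weight_L1 u q k j : nice m T a u ->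
  is_L1 m (fun x => u x * (f (iter k T x) * S j (iter k T x) ^+ q)).
Proof.
move=> nu; apply: is_L1M_bounded (nice_L1 nu) _.
exact: (bounded_measurable_comp (measurable_iter T k) (bounded_measurable_weight nf j q)).
Qed.

Lemma conv_rect_shifted_weight u q n j : nice m T a u -> (0 < j)%N ->
  conv_rect (shifted_weight u q) n j =
  \int[m]_x (u x * birkhoff_sum T (fun x => f x * S j x ^+ q) n x).
Proof.
move=> nu; rewrite lt0n => /negbTE j0.
rewrite /conv_rect /shifted_weight j0.
rewrite -(Rintegral_sum n (fun k => shifted_weight_L1 q k j nu)).
by apply: eq_Rintegral => x _; rewrite mulr_sumr.
Qed.

Lemma conv_diag_shifted_weight u q n : nice m T a u ->
  conv_diag (shifted_weight u q) n = \int[m]_x (u x * birkhoff_diag T f q n x) /\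
  is_L1 m (fun x => u x * birkhoff_diag T f q n x).
Proof.
move=> nu.
have E : (fun x => u x * birkhoff_diag T f q n x) =
    (fun x => \sum_(k < n) u x * (f (iter k T x) * S (n - k)%N (iter k T x) ^+ q)).
  by apply/funext => x; rewrite mulr_sumr.
have i1 k := shifted_weight_L1 q k (n - k)%N nu.
split; last by rewrite E; exact: (is_L1_sum n i1).
rewrite E (Rintegral_sum n i1); apply: eq_bigr => k _.
by rewrite /shifted_weight subn_eq0 leqNgt ltn_ord.
Qed.

Lemma conv_rect_shifted_weight_cvg u q L i j : nice m T a u ->
  \int[m]_x (f x * S n x ^+ q) / a n ^+ q @[n --> \oo] -->
    (\int[m]_x f x) * ((\int[m]_x f x) ^+ q * mittag_leffler_moment q) ->
  (0 < L)%N ->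
  conv_rect (shifted_weight u q) (i * N) (j * N) / a (L * N)%N ^+ q.+1 @[N --> \oo] -->
    (\int[m]_x u x) * ((\int[m]_x f x) * ((\int[m]_x f x) ^+ q * mittag_leffler_moment q)) *
    (grid_pow gamma L i * grid_pow (q%:R * gamma) L j).
Proof.
move=> nu hq L0.
have [i0|i0] := posnP i.
  rewrite i0 /grid_pow eqxx mul0r mulr0.
  under eq_fun do rewrite mul0n /conv_rect big_ord0 mul0r.
  exact: cvg_cst.
have [j0|j0] := posnP j.
  rewrite j0 [grid_pow _ _ 0]/grid_pow eqxx !mulr0.
  under eq_fun do rewrite mul0n /conv_rect /shifted_weight eqxx big1// mul0r.
  exact: cvg_cst.
set c := (\int[m]_x f x) * _ in hq *.
set M := \int[m]_x u x.
pose W n := \int[m]_x (f x * S n x ^+ q).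
(* The normalised error of dual ergodicity with k = i N and j = j N; it tends to 0 since
   [weighted_transfer_cvg] is uniform in the second time. *)
pose Z N := (\int[m]_x (u x * birkhoff_sum T (fun x => f x * S (j * N)%N x ^+ q) (i * N) x) -
   M * a (i * N)%N * W (j * N)%N) / (a (i * N)%N * a (j * N)%N ^+ q).
have Z0 : Z N @[N --> \oo] --> (0 : R).
  apply/cvgrPdist_le => e e0.
  have [N0 hN0] := weighted_transfer_cvg mp ra nf q nu e0.
  near=> N.
  have N1 : (0 < N)%N by near: N; exact: nbhs_infty_gt.
  have iN : (0 < i * N)%N by rewrite muln_gt0 i0.
  have jN : (0 < j * N)%N by rewrite muln_gt0 j0.
  have p0 : 0 < a (i * N)%N * a (j * N)%N ^+ q.
    by rewrite mulr_gt0 ?exprn_gt0// (return_sequence_gt0 ra).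
  have N0N : (N0 <= i * N)%N.
    by rewrite (leq_trans (_ : _ <= N)%N) ?leq_pmull//; near: N; exact: nbhs_infty_ge.
  rewrite sub0r normrN /Z normrM normfV (ger0_norm (ltW p0)) ler_pdivrMr//.
  exact: hN0.
have Wj : W (j * N)%N / a (j * N)%N ^+ q @[N --> \oo] --> c.
  exact: (cvg_comp _ _ (muln_cvgy j0) hq).
have ri := regularly_varying_grid L0 i0.
have rj := cvg_exprn (q := q) (regularly_varying_grid L0 j0).
have main : (a (i * N)%N / a (L * N)%N) * (a (j * N)%N / a (L * N)%N) ^+ q *
    (Z N + M * (W (j * N)%N / a (j * N)%N ^+ q)) @[N --> \oo] -->
    ((i%:R / L%:R : R) `^ gamma) * (((j%:R / L%:R : R) `^ gamma) ^+ q) * (0 + M * c).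
  apply: cvgM; first exact: cvgM.
  by apply: cvgD => //; exact: cvgMr.
have -> : M * c * (grid_pow gamma L i * grid_pow (q%:R * gamma) L j) =
    ((i%:R / L%:R : R) `^ gamma) * (((j%:R / L%:R : R) `^ gamma) ^+ q) * (0 + M * c).
  rewrite /grid_pow !gtn_eqF// (mulrC q%:R) powRrM powR_mulrn ?powR_ge0//.
  by rewrite add0r mulrC.
apply: cvg_trans main; apply: near_eq_cvg; near=> N.
have N1 : (0 < N)%N by near: N; exact: nbhs_infty_gt.
have iN : (0 < i * N)%N by rewrite muln_gt0 i0.
have jN : (0 < j * N)%N by rewrite muln_gt0 j0.
have LN : (0 < L * N)%N by rewrite muln_gt0 L0.
have ai := return_sequence_gt0 ra iN; have aj := return_sequence_gt0 ra jN; have aL := return_sequence_gt0 ra LN.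
rewrite conv_rect_shifted_weight// /Z.
have ajq : 0 < a (j * N)%N ^+ q by exact: exprn_gt0.
have aLq : 0 < a (L * N)%N ^+ q by exact: exprn_gt0.
rewrite exprMn exprVn exprS.
move: (\int[m]_x (u x * _)) (W _) (a (j * N)%N ^+ q) (a (L * N)%N ^+ q) ajq aLq => I V x y x0 y0.
by move: (a _) (a _) ai aL => z t z0 t0; field; rewrite !gt_eqF.
Unshelve. all: by end_near. Qed.

Lemma moment_recursion_le q u n : nice m T a u ->
  \int[m]_x (u x * S n x ^+ q.+1) <= q.+1%:R * conv_diag (shifted_weight u q) n.
Proof.
move=> nu; have f0 := nice_ge0 nf; have u0 := nice_ge0 nu.
have [-> diagL] := conv_diag_shifted_weight q n nu.
rewrite -(RintegralZl q.+1%:R measurableT diagL); apply: le_Rintegral => //.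
- exact: (nice_power_L1 nf n q.+1 nu).
- by have := integrableZl measurableT q.+1%:R diagL; apply: eq_integrable.
- by move=> x _; rewrite mulrCA ler_wpM2l// birkhoff_sum_pow_le.
Qed.

(** In the error term the dual bound gives a factor a_n and the moment of order q - 1 gives
    a_n^(q-1): one power less than the main order a_n^(q+1). *)
Lemma moment_recursion_ge q u : nice m T a u -> exists E : R, forall n, (0 < n)%N ->
  q.+1%:R * conv_diag (shifted_weight u q) n <=
  \int[m]_x (u x * S n x ^+ q.+1) + E * a n ^+ q.
Proof.
move=> nu; have f0 := nice_ge0 nf; have u0 := nice_ge0 nu.
have [K fK] := nice_le nf.
have K0 : 0 <= K by rewrite (le_trans (f0 point)).
have [C C0 dual] := nice_dual nu.
have [D D0 hD] := moment_bound ra nf q.-1 nf.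
exists (q.+1%:R * q%:R * K * (C * D)) => n n0.
have an0 := return_sequence_gt0 ra n0.
have [-> diagL] := conv_diag_shifted_weight q n nu.
have powL := nice_power_L1 nf n q.+1 nu.
pose g x := f x * S n x ^+ q.-1.
have bg : bounded_measurable g by exact: (bounded_measurable_weight nf n q.-1).
have gL : is_L1 m g by exact: (nice_power_L1 nf n q.-1 nf).
have g_ge0 x : 0 <= g x by apply: mulr_ge0 => //; apply: exprn_ge0; exact: birkhoff_sum_ge0.
have errL : is_L1 m (fun x => u x * birkhoff_sum T g n x).
  by apply: is_L1M_bounded (nice_L1 nu) _; exact: bounded_measurable_birkhoff_sum.
set c := q.+1%:R * q%:R * K.
have errL' : is_L1 m (fun x => c * (u x * birkhoff_sum T g n x)).
  by have := integrableZl measurableT c errL; apply: eq_integrable.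
have diagL' : is_L1 m (fun x => q.+1%:R * (u x * birkhoff_diag T f q n x)).
  by have := integrableZl measurableT q.+1%:R diagL; apply: eq_integrable.
apply: (@le_trans _ _ (\int[m]_x (u x * S n x ^+ q.+1) +
    c * \int[m]_x (u x * birkhoff_sum T g n x))).
  rewrite -(RintegralZl q.+1%:R measurableT diagL) -(RintegralZl c measurableT errL).
  rewrite -(RintegralD measurableT powL errL').
  apply: le_Rintegral; [exact: measurableT|exact: diagL'|exact: is_L1D|].
  move=> x _; rewrite mulrCA [c * _]mulrCA -mulrDr; apply: ler_wpM2l => //.
  exact: birkhoff_sum_pow_ge.
rewrite lerD2l.
have [q0|q0] := posnP q; first by rewrite /c q0 mulr0 !mul0r.
rewrite -mulrA; apply: ler_wpM2l; first by rewrite /c !mulr_ge0.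
apply: (le_trans (dual n n0 g bg g_ge0 gL)).
have CA : 0 <= C * a n by rewrite mulr_ge0// ltW.
apply: (le_trans (ler_wpM2l CA (hD n n0))).
by rewrite -[in leRHS](prednK q0) exprS; apply/eqW; ring.
Qed.

(** The induction ranges over all nice weights, since the rectangles for [u] at order q + 1 need the
    limit at order q for the weight [f]. *)
Lemma moment_cvg q u : nice m T a u ->
  \int[m]_x (u x * S n x ^+ q) / a n ^+ q @[n --> \oo] -->
  (\int[m]_x u x) * ((\int[m]_x f x) ^+ q * mittag_leffler_moment q).
Proof.
have f0 := nice_ge0 nf; have /andP[g0 g1] := gamma01.
elim: q u => [|q IH] u nu.
  rewrite mittag_leffler_moment0 expr0 !mulr1.
  rewrite (_ : (fun n => _) = cst (\int[m]_x u x)); first exact: cvg_cst.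
  apply/funext => n; rewrite expr0 divr1; apply: eq_Rintegral => x _.
  by rewrite expr0 mulr1.
have u0 := nice_ge0 nu.
pose B := shifted_weight u q.
set M := \int[m]_x u x; set F := \int[m]_x f x.
have M0 : 0 < M by exact: nice_int_gt0 nu.
have F0 : 0 < F by exact: nice_int_gt0 nf.
have s0 n : (0 < n)%N -> 0 < a n ^+ q.+1 by move=> n0; rewrite exprn_gt0// (return_sequence_gt0 ra).
have ml0 : 0 <= mittag_leffler_moment q.
  rewrite /mittag_leffler_moment divr_ge0 ?mulr_ge0 ?exprn_ge0 ?ltW// Gamma1D_gt0//.
  by rewrite mulr_ge0.
have w0 k j x : 0 <= u x * (f (iter k T x) * S j (iter k T x) ^+ q).
  by rewrite !mulr_ge0// exprn_ge0// birkhoff_sum_ge0.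
have B0 k j : 0 <= B k j.
  by rewrite /B /shifted_weight; case: ifP => // _; rewrite Rintegral_ge0.
have Bnd k : nondecreasing_seq (B k).
  move=> j j' jj'; rewrite /B /shifted_weight.
  case: (eqVneq j 0%N) => [_|j0]; first by case: ifP => // _; rewrite Rintegral_ge0.
  have -> : j' == 0%N = false by apply/negbTE; rewrite -lt0n (leq_trans _ jj')// lt0n.
  apply: le_Rintegral => //; [exact: shifted_weight_L1|exact: shifted_weight_L1|].
  move=> x _; rewrite !ler_wpM2l//; apply: lerXn2r; rewrite ?nnegrE ?birkhoff_sum_ge0//.
  exact: birkhoff_sum_nondecreasing.
have sr : a n.+1 ^+ q.+1 / a n ^+ q.+1 @[n --> \oo] --> (1 : R).
  have := cvg_exprn (q := q.+1) (return_sequence_ratio_cvg mp cons ra nf).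
  by rewrite expr1n; under eq_fun do rewrite exprMn exprVn.
have diag : conv_diag B n / a n ^+ q.+1 @[n --> \oo] -->
    M * (F * (F ^+ q * mittag_leffler_moment q)) * conv_limit gamma (q%:R * gamma).
  apply: conv_diag_cvg => //.
  - by rewrite mulr_ge0.
  - by move=> ->; rewrite mulr0.
  - have [M0' F0'] := (ltW M0, ltW F0).
    by apply: mulr_ge0 => //; apply: mulr_ge0 => //; apply: mulr_ge0 => //; exact: exprn_ge0.
  - by move=> L i j L0 _ _; apply: conv_rect_shifted_weight_cvg => //; exact: IH.
have limE : M * (F ^+ q.+1 * mittag_leffler_moment q.+1) = q.+1%:R *
    (M * (F * (F ^+ q * mittag_leffler_moment q)) * conv_limit gamma (q%:R * gamma)).
  by rewrite mittag_leffler_momentS exprS; ring.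
have diag' : q.+1%:R * (conv_diag B n / a n ^+ q.+1) @[n --> \oo] -->
    M * (F ^+ q.+1 * mittag_leffler_moment q.+1).
  by rewrite limE; apply: cvgMr.
have [E0 hE0] := moment_recursion_ge q nu.
have aV : (a n)^-1 @[n --> \oo] --> (0 : R).
  have adv := return_sequence_dvg mp cons ra nf.
  by apply/gtr0_cvgV0 => //; move/cvgryPgt : adv; apply.
have low : q.+1%:R * (conv_diag B n / a n ^+ q.+1) - E0 * (a n)^-1 @[n --> \oo] -->
    M * (F ^+ q.+1 * mittag_leffler_moment q.+1).
  rewrite -[X in _ --> X]subr0; apply: cvgB => //.
  by rewrite -[X in _ --> X](mulr0 E0); apply: cvgMr.
apply: (squeeze_cvgr _ low diag').
near=> n.
have n0 : (0 < n)%N by near: n; exact: nbhs_infty_gt.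
have an0 := return_sequence_gt0 ra n0; have sn0 := s0 n n0.
apply/andP; split; last first.
  by rewrite mulrA ler_pM2r ?invr_gt0//; exact: moment_recursion_le.
rewrite mulrA lerBlDr ler_pdivrMr// mulrDl divfK ?gt_eqF//.
apply: (le_trans (hE0 n n0)); rewrite lerD2l exprS.
by rewrite mulrA divfK ?gt_eqF.
Unshelve. all: by end_near. Qed.

End MomentLimit.

(** * From moments to strong convergence *)

Section NullSet.
Context {R : realType} (d : measure_display) (X : measurableType d)
  (mu : {measure set X -> \bar R}).

Import HBNNSimple.

Lemma ge0_integral_off_null_le (N : set X) (f g : X -> \bar R) : measurable N ->
  mu N = 0%E -> (forall x, 0 <= f x)%E -> (forall x, 0 <= g x)%E ->
  (forall x, ~ N x -> f x = g x) -> (\int[mu]_x f x <= \int[mu]_x g x)%E.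
Proof.
move=> mN N0 f0 g0 fg; rewrite !ge0_integralTE//.
apply: ge_ereal_sup => _ [h /= hf <-].
pose k := proj_nnsfun h (measurableC mN).
have -> : sintegral mu h = sintegral mu k.
  rewrite -!integralT_nnsfun; apply: ae_eq_integral => //.
  - by apply/measurable_EFinP; exact: measurable_funP.
  - by apply/measurable_EFinP; exact: measurable_funP.
  - exists N; split=> // x /=; apply: contra_notP => Nx _.
    by rewrite /k/= mindicE mem_set// mulr1.
apply: ereal_sup_ubound; exists k => //= x.
rewrite /k/= mindicE; have [Nx|Nx] := pselect (N x).
  by rewrite memNset ?mulr0//; apply.
by rewrite mem_set// mulr1 -fg.
Qed.

(* The two integrands need not be measurable. *)
Lemma integral_off_null (N : set X) (f g : X -> \bar R) : measurable N -> mu N = 0%E ->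
  (forall x, ~ N x -> f x = g x) -> (\int[mu]_x f x = \int[mu]_x g x)%E.
Proof.
move=> mN N0 fg; rewrite integralE [RHS]integralE.
by congr (_ - _)%E; apply/eqP; rewrite eq_le; apply/andP; split;
  apply: (@ge0_integral_off_null_le N) => // x Nx; rewrite ?funeposE ?funenegE ?fg.
Qed.

End NullSet.

(** * The Mittag-Leffler law *)

Section MittagLeffler.
Context {R : realType}.

Lemma ler_dist3 (x y z t e1 e2 e3 : R) : `|x - y| <= e1 -> `|y - z| <= e2 ->
  `|z - t| <= e3 -> `|x - t| <= e1 + e2 + e3.
Proof.
move=> h1 h2 h3; have -> : x - t = (x - y) + (y - z) + (z - t) by ring.
apply: (le_trans (ler_normD _ _)); apply: lerD => //.
by apply: (le_trans (ler_normD _ _)); apply: lerD.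
Qed.

(** Log-convexity up to the next integer gives (n + 1)! <= Gamma(1 + s) (n + 2), and n + 2 <= 2 (n +
    1)!. A bound uniform in s yields moments of growth p! C^p. *)
Lemma Gamma1D_ge (s : R) : 0 <= s -> 1 <= 2 * Gamma (1 + s).
Proof.
move=> s0; pose n := Num.truncn s.
have /andP[ns sn] : n%:R <= s < n.+1%:R by exact: truncn_itv.
have th01 : 0 <= n.+1%:R - s <= 1.
  by rewrite subr_ge0 ltW//= lerBlDl -natr1 lerD2r.
have := Gamma1D_log_convex s0 th01.
rewrite [s + _]addrC subrK Gamma1D_nat => h.
have G0 := Gamma1D_gt0 s0.
have pw : (s + 1) `^ (n.+1%:R - s) <= n.+2%:R.
  apply: (@le_trans _ _ (s + 1)).
    rewrite -[leRHS]powRr1 ?addr_ge0//; apply: ler_powR; first by rewrite lerDr.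
    by case/andP: th01.
  by rewrite -[n.+2%:R]natr1 lerD2r ltW.
have fn : n.+2%:R <= 2 * n.+1`!%:R :> R.
  rewrite -natrM ler_nat factS.
  apply: (@leq_trans (2 * n.+1)); first by rewrite mul2n -addnn addnS ltnS leq_addr.
  by rewrite leq_mul2l leq_pmulr ?fact_gt0.
rewrite -(@ler_pM2r _ n.+2%:R) ?ltr0n// mul1r.
apply: (le_trans fn); rewrite -mulrA ler_pM2l// (le_trans h)//.
by rewrite ler_pM2l.
Qed.

Variables (gamma : R) (d : measure_display) (W : measurableType d) (P : probability W R)
  (Y : {RV P >-> R}).
Hypothesis gamma0 : 0 <= gamma.
Hypothesis mlY : mittag_leffler gamma Y.
Local Notation Yp := (fun w => Num.max (Y w) 0).

Lemma mittag_leffler_null : P (Y @^-1` `]-oo, 0[) = 0%E.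
Proof.
have [Y1 _] := mlY.
have m0 : measurable (Y @^-1` `[0, +oo[).
  by rewrite -[X in measurable X]setTI; exact: measurable_funP.
have -> : Y @^-1` `]-oo, 0[ = ~` (Y @^-1` `[0, +oo[).
  by apply/seteqP; split=> w /=; rewrite !in_itv/= andbT ltNge => /negP.
have PE : P (Y @^-1` `[0, +oo[) = 1%E by rewrite -Y1.
by rewrite probability_setC// PE subee.
Qed.

Lemma measurable_mittag_leffler_null : measurable (Y @^-1` `]-oo, 0[).
Proof. by rewrite -[X in measurable X]setTI; exact: measurable_funP. Qed.

Lemma measurable_pos_part : measurable_fun [set: W] Yp.
Proof. by apply: measurable_maxr => //; exact: measurable_cst. Qed.

Lemma pos_part_ge0 w : 0 <= Yp w. Proof. by rewrite le_max lexx orbT. Qed.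

Lemma pos_part_off_null w : ~ (Y @^-1` `]-oo, 0[) w -> Y w = Yp w.
Proof.
rewrite /= in_itv/= => /negP; rewrite -leNgt => h.
by rewrite max_l.
Qed.

Lemma mittag_leffler_momentE p :
  P.-integrable [set: W] (EFin \o (fun w => Yp w ^+ p)) /\
  \int[P]_w (Yp w ^+ p) = mittag_leffler_moment gamma p.
Proof.
have [_ /(_ p) hp] := mlY.
have E : (\int[P]_w (Yp w ^+ p)%:E = (mittag_leffler_moment gamma p)%:E)%E.
  rewrite -hp unlock.
  apply: (integral_off_null measurable_mittag_leffler_null mittag_leffler_null).
  by move=> w /pos_part_off_null <-.
split; last by rewrite /Rintegral E.
apply/integrableP; split.
  by apply/measurable_EFinP; apply: measurable_funX; exact: measurable_pos_part.
under eq_integral do rewrite gee0_abs ?lee_fin ?exprn_ge0 ?pos_part_ge0//.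
by rewrite E ltry.
Qed.

Lemma mittag_leffler_moment_le p :
  mittag_leffler_moment gamma p <= 2 * (p`!%:R * Gamma (1 + gamma) ^+ p).
Proof.
have pg : 0 <= p%:R * gamma by rewrite mulr_ge0.
have G1 := Gamma1D_gt0 pg; have G2 := Gamma1D_gt0 gamma0.
rewrite /mittag_leffler_moment ler_pdivrMr// mulrAC -mulrA [leRHS]mulrC mulrA.
have := Gamma1D_ge pg.
have h : 0 <= p`!%:R * Gamma (1 + gamma) ^+ p by apply: mulr_ge0 => //; apply: exprn_ge0; exact: ltW.
move=> /(ler_wpM2l h); rewrite mulr1 => /le_trans; apply.
by apply/eqW; ring.
Qed.

Lemma mittag_leffler_moment1 : mittag_leffler_moment gamma 1 = 1.
Proof.
rewrite /mittag_leffler_moment !mul1r expr1.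
by rewrite divff// gt_eqF// Gamma1D_gt0.
Qed.

Definition mittag_leffler_laplace (t : R) : R := \int[P]_w expR (- (t * Yp w)).

Lemma is_L1_laplace t : 0 <= t -> is_L1 P (fun w => expR (- (t * Yp w))).
Proof.
move=> t0; apply: (@le_integrable _ _ _ P [set: W] measurableT _ (EFin \o cst (1 : R))).
- apply/measurable_EFinP; apply: measurableT_comp; first exact: measurable_expR.
  by apply: measurableT_comp => //; apply: measurable_funM => //; exact: measurable_pos_part.
- by move=> w _ /=; rewrite lee_fin ger0_norm ?expR_ge0// normr1 expR_le1 oppr_le0 mulr_ge0// pos_part_ge0.
- exact: finite_measure_integrable_cst.
Qed.

Lemma expRN_lipschitz (x y : R) : 0 <= x -> 0 <= y -> `|expR (- x) - expR (- y)| <= `|x - y|.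
Proof.
wlog xy : x y / x <= y.
  move=> h x0 y0; have [xy|/ltW yx] := leP x y; first exact: h.
  by rewrite (distrC (expR _)) (distrC x); exact: h.
move=> x0 y0; rewrite ger0_norm ?subr_ge0 ?ler_expR ?lerN2//.
rewrite distrC ger0_norm ?subr_ge0//.
have -> : expR (- x) - expR (- y) = expR (- x) * (1 - expR (- (y - x))).
  by rewrite mulrBr mulr1 -expRD; congr (_ - expR _); ring.
apply: (@le_trans _ _ (1 * (y - x))); last by rewrite mul1r.
apply: ler_pM; rewrite ?expR_ge0 ?subr_ge0 ?expR_le1 ?oppr_le0 ?subr_ge0//.
by have := expR_ge1Dx (- (y - x)); lra.
Qed.

(** The Lipschitz constant is the first moment, normalised to 1. *)
Lemma mittag_leffler_laplace_lipschitz s t : 0 <= s -> 0 <= t ->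
  `|mittag_leffler_laplace s - mittag_leffler_laplace t| <= `|s - t|.
Proof.
move=> s0 t0; have [Y1 EY1] := mittag_leffler_momentE 1.
have [sL tL] := (is_L1_laplace s0, is_L1_laplace t0).
rewrite /mittag_leffler_laplace -(RintegralB measurableT sL tL).
have dL : is_L1 P (fun w => expR (- (s * Yp w)) - expR (- (t * Yp w))).
  exact: (integrableB measurableT sL tL).
apply: (le_trans (le_normr_Rintegral measurableT dL)).
have Y1' : is_L1 P (fun w => `|s - t| * Yp w ^+ 1).
  by have := integrableZl measurableT `|s - t| Y1; apply: eq_integrable.
apply: (@le_trans _ _ (\int[P]_w (`|s - t| * Yp w ^+ 1))).
  apply: le_Rintegral => //; first exact: integrable_norm.
  move=> w _ /=; rewrite expr1; have Y0 := pos_part_ge0 w.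
  apply: (le_trans (expRN_lipschitz _ _)); try exact: mulr_ge0.
  by rewrite -mulrBl normrM (ger0_norm Y0).
by rewrite (RintegralZl _ measurableT Y1) EY1 mittag_leffler_moment1 mulr1.
Qed.

End MittagLeffler.

(** * Laplace transforms for general weights and observables *)

Section Laplace.
Context {R : realType} (d : measure_display) (X : measurableType d)
  (m : {sigma_finite_measure set X -> \bar R}) (T : {mfun X >-> X}).
Hypothesis mp : measure_preserving m T.
Hypothesis cons : conservative m T.
Variable a : nat -> R.
Hypothesis ra : return_sequence m T a.
Variable gamma : R.
Hypothesis gamma01 : 0 <= gamma <= 1.
Hypothesis rva : regularly_varying a gamma.
Variables (dW : measure_display) (W : measurableType dW) (P : probability W R)
  (Y : {RV P >-> R}).
Hypothesis mlY : mittag_leffler gamma Y.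
Local Notation Yp := (fun w => Num.max (Y w) 0).
Local Notation L := (mittag_leffler_laplace Y).

Lemma birkhoff_ratio_ge0 f n x : (forall x, 0 <= f x) -> 0 <= birkhoff_sum T f n x / a n.
Proof.
move=> f0; case: n => [|n]; first by rewrite birkhoff_sum0 mul0r.
by rewrite divr_ge0 ?birkhoff_sum_ge0// ltW// (return_sequence_gt0 ra).
Qed.

Lemma measurable_birkhoff_ratio f n : measurable_fun [set: X] f ->
  measurable_fun [set: X] (fun x => birkhoff_sum T f n x / a n).
Proof.
by move=> mf; apply: measurable_funM => //; exact: measurable_birkhoff_sum.
Qed.

Lemma bounded_measurable_laplace (f : X -> R) n (s : R) : measurable_fun [set: X] f ->
  (forall x, 0 <= f x) -> 0 <= s ->
  bounded_measurable (fun x => expR (- (s * (birkhoff_sum T f n x / a n)))).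
Proof.
move=> mf f0 s0; split.
  apply: measurableT_comp; first exact: measurable_expR.
  apply: measurableT_comp => //; apply: measurable_funM => //.
  exact: measurable_birkhoff_ratio.
exists 1 => x; rewrite ger0_norm ?expR_ge0// expR_le1 oppr_le0 mulr_ge0//.
exact: birkhoff_ratio_ge0.
Qed.

Lemma laplace_cvg_nice u f (s : R) : nice m T a u -> nice m T a f -> 0 <= s ->
  \int[m]_x (u x * expR (- (s * (birkhoff_sum T f n x / a n)))) @[n --> \oo] -->
  (\int[m]_x u x) * L (s * \int[m]_x f x).
Proof.
move=> nu nf s0.
have f0 := nice_ge0 nf; have u0 := nice_ge0 nu; have /andP[g0 g1] := gamma01.
set M := \int[m]_x u x; set c := \int[m]_x f x.
have M0 : 0 < M by exact: nice_int_gt0 nu.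
have c0 : 0 < c by exact: nice_int_gt0 nf.
have YL p := (mittag_leffler_momentE mlY p).1.
have YE p := (mittag_leffler_momentE mlY p).2.
have GI p : \int[P]_w (M * (c * Yp w) ^+ p) = M * (c ^+ p * mittag_leffler_moment gamma p).
  under eq_Rintegral do rewrite exprMn mulrA.
  by rewrite (RintegralZl _ measurableT (YL p)) YE mulrA.
have -> : M * L (s * c) = \int[P]_w (M * expR (- (s * (c * Yp w)))).
  rewrite /L -(RintegralZl _ measurableT (is_L1_laplace Y _)); last first.
    by rewrite mulr_ge0// ltW.
  by apply: eq_Rintegral => w _; rewrite mulrA.
(* The growth constants come from [mittag_leffler_moment_le]: the limit moments are at most 2 M p!
   (Gamma(1 + gamma) c)^p. *)
apply: (@laplace_of_moments _ _ _ _ _ _ _ _ P _ _ (Gamma (1 + gamma) * c) (2 * M)) => //.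
- by move=> n x; exact: birkhoff_ratio_ge0.
- by move=> n; apply: measurable_birkhoff_ratio; exact: nice_measurable nf.
- move=> n p; have := integrableZl measurableT ((a n)^-1 ^+ p) (nice_power_L1 nf n p nu).
  by apply: eq_integrable => // x _ /=; congr EFin; rewrite exprMn; ring.
- by move=> w; exact: ltW.
- by move=> w; rewrite mulr_ge0 ?(ltW c0)// pos_part_ge0.
- by apply: measurable_funM => //; exact: measurable_pos_part.
- move=> p; have := integrableZl measurableT (M * c ^+ p) (YL p).
  by apply: eq_integrable => // x _ /=; congr EFin; rewrite exprMn; ring.
- by rewrite mulr_ge0 ?(ltW c0)// ltW// Gamma1D_gt0.
- move=> p; rewrite GI.
  apply: (@le_trans _ _ (M * (c ^+ p * (2 * (p`!%:R * Gamma (1 + gamma) ^+ p))))).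
    apply: ler_wpM2l; first exact: ltW.
    apply: ler_wpM2l; first exact/exprn_ge0/ltW.
    exact: mittag_leffler_moment_le.
  by rewrite exprMn; apply/eqW; ring.
- move=> p; rewrite GI.
  have := moment_cvg mp cons ra gamma01 rva nf (q := p) nu.
  apply: cvg_trans; apply: near_eq_cvg; near=> n.
  rewrite mulrC -(RintegralZl _ measurableT (nice_power_L1 nf n p nu)).
  by apply: eq_Rintegral => x _; rewrite exprMn exprVn; ring.
Unshelve. all: by end_near. Qed.

(** [phi] may be unbounded here; integrability is itself a consequence of the dual bound. *)
Lemma nice_dual_L1 u phi : nice m T a u -> is_L1 m phi -> (forall x, 0 <= phi x) ->
  forall n, is_L1 m (fun x => u x * birkhoff_sum T phi n x).
Proof.
move=> nu phiL phi0 n.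
have mphi := is_L1_measurable phiL; have u0 := nice_ge0 nu.
case: n => [|n].
  have := is_L1_cst0 m; apply: eq_integrable => // x _ /=.
  by rewrite birkhoff_sum0 mulr0.
have [C C0 h] := nice_bound nu.
apply/integrableP; split.
  apply/measurable_EFinP; apply: measurable_funM; first exact: nice_measurable nu.
  exact: measurable_birkhoff_sum.
under eq_integral do rewrite gee0_abs ?lee_fin ?mulr_ge0 ?birkhoff_sum_ge0//.
have := h n.+1 isT phi mphi phi0 (fun x nI => False_ind _ (nI I)).
by move=> /le_lt_trans; apply; rewrite -EFin_Rintegral// -EFinM ltry.
Qed.

Lemma nice_dual_le u : nice m T a u -> exists2 C, 0 <= C & forall phi,
  is_L1 m phi -> (forall x, 0 <= phi x) -> forall n, (0 < n)%N ->
  \int[m]_x (u x * birkhoff_sum T phi n x) <= C * a n * \int[m]_x phi x.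
Proof.
move=> nu; have [C C0 h] := nice_bound nu; exists C => // phi phiL phi0 n n0.
have := h n n0 phi (is_L1_measurable phiL) phi0 (fun x nI => False_ind _ (nI I)).
by rewrite -!EFin_Rintegral// ?lee_fin//; exact: nice_dual_L1.
Qed.

(** e^(-x) is 1-Lipschitz on [0, oo), and the dual bound of [u] cancels the normalisation a_n: the
    error is proportional to the L^1 distance, uniformly in n. *)
Lemma laplace_perturbation u : nice m T a u -> exists2 C, 0 <= C &
  forall (f f1 : X -> R) (s : R) n, is_L1 m f -> is_L1 m f1 -> (forall x, 0 <= f1 x <= f x) ->
  0 <= s -> (0 < n)%N ->
  `|\int[m]_x (u x * expR (- (s * (birkhoff_sum T f1 n x / a n)))) -
    \int[m]_x (u x * expR (- (s * (birkhoff_sum T f n x / a n))))| <=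
  s * (C * \int[m]_x (f x - f1 x)).
Proof.
move=> nu; have u0 := nice_ge0 nu; have [C C0 dual] := nice_dual_le nu.
exists C => // f f1 s n fL f1L f1f s0 n0.
have an0 := return_sequence_gt0 ra n0.
have f10 x : 0 <= f1 x by case/andP: (f1f x).
have d0 x : 0 <= f x - f1 x by rewrite subr_ge0; case/andP: (f1f x).
have f0 x : 0 <= f x by case/andP: (f1f x) => ?; exact: le_trans.
have dL : is_L1 m (fun x => f x - f1 x) by exact: (integrableB measurableT fL f1L).
have PL h : is_L1 m h -> (forall x, 0 <= h x) ->
    is_L1 m (fun x => u x * expR (- (s * (birkhoff_sum T h n x / a n)))).
  move=> hL h0; apply: is_L1M_bounded (nice_L1 nu) _.
  by apply: bounded_measurable_laplace => //; exact: is_L1_measurable hL.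
have P1 := PL _ fL f0; have P2 := PL _ f1L f10.
rewrite -(RintegralB measurableT P2 P1).
set D := fun x => _ - _; have P21 : is_L1 m D.
  exact: (integrableB measurableT P2 P1).
apply: (le_trans (le_normr_Rintegral measurableT P21)).
have DL := nice_dual_L1 nu dL d0 n.
have DL' : is_L1 m (fun x => s / a n * (u x * birkhoff_sum T (fun x => f x - f1 x) n x)).
  by have := integrableZl measurableT (s / a n) DL; apply: eq_integrable.
apply: (@le_trans _ _ (\int[m]_x (s / a n * (u x * birkhoff_sum T (fun x => f x - f1 x) n x)))).
  apply: le_Rintegral; [exact: measurableT|exact: integrable_norm|exact: DL'|].
  move=> x _ /=; rewrite /D -mulrBr normrM (ger0_norm (u0 x)) [leRHS]mulrCA.
  apply: ler_wpM2l => //.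
  have r0 h : (forall x, 0 <= h x) -> 0 <= s * (birkhoff_sum T h n x / a n).
    by move=> h0; apply: mulr_ge0 => //; exact: birkhoff_ratio_ge0.
  apply: (le_trans (expRN_lipschitz (r0 _ f10) (r0 _ f0))).
  have -> : birkhoff_sum T f n x = birkhoff_sum T f1 n x +
      birkhoff_sum T (fun x => f x - f1 x) n x.
    by rewrite -birkhoff_sumD; apply: eq_bigr => k _; rewrite subrKC.
  rewrite -mulrBr -mulrBl opprD addrA subrr sub0r mulNr mulrN normrN.
  rewrite ger0_norm; first by apply/eqW; ring.
  by apply: mulr_ge0 => //; apply: divr_ge0; [exact: birkhoff_sum_ge0|exact: ltW].
rewrite (RintegralZl _ measurableT DL).
apply: (@le_trans _ _ (s / a n * (C * a n * \int[m]_x (f x - f1 x)))).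
  apply: ler_wpM2l; first by apply: divr_ge0 => //; exact: ltW.
  exact: dual.
by apply/eqW; move: (\int[m]_x _) (a n) an0 => z t t0; field; rewrite gt_eqF.
Qed.

(** The order of approximation matters: changing [f] relies on the dual bound of [u], so [f] is made
    general while [u] is still nice. *)
Lemma laplace_cvg_nice_weight u f (s : R) : nice m T a u -> is_L1 m f ->
  (forall x, 0 <= f x) -> 0 < \int[m]_x f x -> 0 <= s ->
  \int[m]_x (u x * expR (- (s * (birkhoff_sum T f n x / a n)))) @[n --> \oo] -->
  (\int[m]_x u x) * L (s * \int[m]_x f x).
Proof.
move=> nu fL f0 fpos s0; apply/cvgrPdist_le => e e0.
have u0 := nice_ge0 nu; have /andP[g0 _] := gamma01.
have [C C0 pert] := laplace_perturbation nu.
set M := \int[m]_x u x.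
have M0 : 0 < M by exact: nice_int_gt0 nu.
(* Half of e pays for M s dlt, the change of the limit, and s C dlt, the perturbation of the
   integrals. *)
pose dlt := (e / 2) / (s * (M + C) + 1).
have den0 : 0 < s * (M + C) + 1 by rewrite ltr_wpDl// mulr_ge0// addr_ge0// ltW.
have dlt0 : 0 < dlt by rewrite divr_gt0// divr_gt0.
have [f1 [nf1 f1f df]] := nice_dense mp ra fL f0 fpos dlt0.
have f10 := nice_ge0 nf1; have f1L := nice_L1 nf1.
have dL : is_L1 m (fun x => f x - f1 x) by exact: (integrableB measurableT fL f1L).
have d0 x : 0 <= f x - f1 x by rewrite subr_ge0.
have dE : \int[m]_x (f x - f1 x) = \int[m]_x f x - \int[m]_x f1 x.
  exact: (RintegralB measurableT fL f1L).
have e20 : 0 < e / 2 by rewrite divr_gt0.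
pose Phi (h : X -> R) n x := expR (- (s * (birkhoff_sum T h n x / a n))).
have /cvgrPdist_le/(_ _ e20) nice_near :
    \int[m]_x (u x * Phi f1 n x) @[n --> \oo] --> M * L (s * \int[m]_x f1 x).
  exact: laplace_cvg_nice nu nf1 s0.
near=> n.
have n0 : (0 < n)%N by near: n; exact: nbhs_infty_gt.
have an0 := return_sequence_gt0 ra n0.
have step1 : `|M * L (s * \int[m]_x f x) - M * L (s * \int[m]_x f1 x)| <= M * (s * dlt).
  rewrite -mulrBr normrM gtr0_norm// ler_wpM2l ?(ltW M0)//.
  have cf : 0 <= \int[m]_x f x by exact: ltW.
  have cf1 : 0 <= \int[m]_x f1 x by exact: (ltW (nice_int_gt0 nf1)).
  apply: (le_trans (mittag_leffler_laplace_lipschitz g0 mlY (mulr_ge0 s0 cf) (mulr_ge0 s0 cf1))).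
  rewrite -mulrBr normrM (ger0_norm s0) ler_wpM2l// -dE ger0_norm//.
  by apply: Rintegral_ge0 => x _.
have step2 : `|\int[m]_x (u x * Phi f1 n x) - \int[m]_x (u x * Phi f n x)| <= s * (C * dlt).
  apply: (le_trans (pert f f1 s n fL f1L _ s0 n0)); first by move=> x; rewrite f10 f1f.
  by rewrite ler_wpM2l// ler_wpM2l.
have step3 : `|M * L (s * \int[m]_x f1 x) - \int[m]_x (u x * Phi f1 n x)| <= e / 2.
  by near: n; exact: nice_near.
have dE2 : M * (s * dlt) + s * (C * dlt) <= e / 2.
  apply: (@le_trans _ _ ((s * (M + C) + 1) * dlt)); last first.
    by rewrite /dlt mulrC divfK ?gt_eqF.
  have -> : M * (s * dlt) + s * (C * dlt) = s * (M + C) * dlt by ring.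
  by rewrite ler_pM2r// lerDl.
apply: (le_trans (ler_dist3 step1 step3 step2)).
by rewrite addrAC [leRHS]splitr lerD2r.
Unshelve. all: by end_near. Qed.

Lemma weight_perturbation (u u1 phi : X -> R) : is_L1 m u -> is_L1 m u1 ->
  (forall x, u1 x <= u x) -> measurable_fun [set: X] phi -> (forall x, 0 <= phi x <= 1) ->
  `|\int[m]_x (u x * phi x) - \int[m]_x (u1 x * phi x)| <= \int[m]_x (u x - u1 x).
Proof.
move=> uL u1L u1u mphi phi01.
have bphi : bounded_measurable phi.
  split=> //; exists 1 => x; case/andP: (phi01 x) => p0 p1.
  by rewrite ger0_norm.
have P1 := is_L1M_bounded uL bphi; have P2 := is_L1M_bounded u1L bphi.
have dL : is_L1 m (fun x => u x - u1 x) by exact: (integrableB measurableT uL u1L).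
have DL : is_L1 m (fun x => u x * phi x - u1 x * phi x) by exact: (integrableB measurableT P1 P2).
rewrite -(RintegralB measurableT P1 P2) (le_trans (le_normr_Rintegral measurableT DL))//.
apply: le_Rintegral => //; first exact: integrable_norm.
move=> x _ /=; case/andP: (phi01 x) => p0 p1.
have d0 : 0 <= u x - u1 x by rewrite subr_ge0.
by rewrite -mulrBl normrM !ger0_norm// ler_piMr.
Qed.

(** The Laplace factors and their limit lie in [0, 1], so replacing [u] by a nice function costs at
    most the L^1 distance on both sides. *)
Lemma laplace_cvg_weight u f (s : R) : is_L1 m u -> (forall x, 0 <= u x) ->
  0 < \int[m]_x u x -> is_L1 m f -> (forall x, 0 <= f x) -> 0 < \int[m]_x f x -> 0 <= s ->
  \int[m]_x (u x * expR (- (s * (birkhoff_sum T f n x / a n)))) @[n --> \oo] -->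
  (\int[m]_x u x) * L (s * \int[m]_x f x).
Proof.
move=> uL u0 upos fL f0 fpos s0; apply/cvgrPdist_le => e e0.
have e30 : 0 < e / 3 by rewrite divr_gt0.
have [u1 [nu1 u1u du]] := nice_dense mp ra uL u0 upos e30.
have u1L := nice_L1 nu1.
pose Phi n x := expR (- (s * (birkhoff_sum T f n x / a n))).
pose l := L (s * \int[m]_x f x).
have c0 : 0 <= s * \int[m]_x f x by rewrite mulr_ge0// ltW.
have l01 : 0 <= l <= 1.
  apply/andP; split; first by apply: Rintegral_ge0 => w _; exact: expR_ge0.
  have -> : 1 = \int[P]_w (cst 1 w) :> R.
    rewrite Rintegral_cst// mul1r; apply/esym; exact: (congr1 fine (probability_setT P)).
  apply: le_Rintegral => //; [exact: is_L1_laplace|exact: finite_measure_integrable_cst|].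
  by move=> w _; rewrite expR_le1 oppr_le0 mulr_ge0// pos_part_ge0.
have /cvgrPdist_le/(_ _ e30) near1 :
    \int[m]_x (u1 x * Phi n x) @[n --> \oo] --> (\int[m]_x u1 x) * l.
  exact: laplace_cvg_nice_weight nu1 fL f0 fpos s0.
near=> n.
have h1 : `|(\int[m]_x u1 x) * l - \int[m]_x (u1 x * Phi n x)| <= e / 3.
  by near: n; exact: near1.
have h2 : `|\int[m]_x (u x * Phi n x) - \int[m]_x (u1 x * Phi n x)| <= e / 3.
  apply: (le_trans _ du); apply: weight_perturbation => //.
    by have [] := @bounded_measurable_laplace f n s (is_L1_measurable fL) f0 s0.
  move=> x; rewrite expR_ge0/= expR_le1 oppr_le0 mulr_ge0//.
  exact: birkhoff_ratio_ge0.
have dE : \int[m]_x (u x - u1 x) = \int[m]_x u x - \int[m]_x u1 x.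
  exact: (RintegralB measurableT uL u1L).
have h3 : `|(\int[m]_x u x) * l - (\int[m]_x u1 x) * l| <= e / 3.
  have d0 : 0 <= \int[m]_x (u x - u1 x) by apply: Rintegral_ge0 => x _; rewrite subr_ge0.
  case/andP: l01 => l0 l1.
  rewrite -mulrBl normrM -dE !ger0_norm//.
  by apply: (le_trans _ du); rewrite ler_piMr.
rewrite distrC in h2.
apply: (le_trans (ler_dist3 h3 h1 h2)).
by apply/eqW; field.
Unshelve. all: by end_near. Qed.

End Laplace.

Section Density.
Context {R : realType} (d : measure_display) (X : measurableType d)
  (m : {sigma_finite_measure set X -> \bar R}) (Q : probability X R).

Lemma probability_density : Q `<< m -> exists u : X -> R,
  [/\ is_L1 m u, forall x, 0 <= u x, \int[m]_x u x = 1 &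
   forall phi : X -> R, measurable_fun [set: X] phi -> (forall x, 0 <= phi x) ->
     \int[Q]_x phi x = \int[m]_x (u x * phi x)].
Proof.
move=> Qm.
pose r := Radon_Nikodym_SigmaFinite.f Q m.
have rfin x : r x \is a fin_num by exact: Radon_Nikodym_SigmaFinite.f_fin_num.
have r0 x : (0 <= r x)%E by exact: Radon_Nikodym_SigmaFinite.f_ge0.
have rE : EFin \o (fun x => fine (r x)) = r by apply/funext => x /=; rewrite fineK.
exists (fun x => fine (r x)); split.
- by rewrite /is_L1 rE; exact: Radon_Nikodym_SigmaFinite.f_integrable.
- by move=> x; rewrite fine_ge0.
- rewrite /Rintegral.
  under eq_integral do rewrite fineK//.
  rewrite -(Radon_Nikodym_SigmaFinite.f_integral Qm measurableT).
  exact: (congr1 fine (probability_setT Q)).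
- move=> phi mphi phi0; rewrite /Rintegral; congr fine.
  rewrite -(Radon_Nikodym_SigmaFinite.change_of_variables Qm (f := EFin \o phi))//; last first.
    exact/measurable_EFinP.
  by apply: eq_integral => x _ /=; rewrite EFinM fineK// muleC.
Qed.

End Density.

(** * Laplace transforms determine convergence on [0, oo] *)

Section Continuity.
Context {R : realType} (d : measure_display) (X : measurableType d) (Q : probability X R)
  (dW : measure_display) (W : measurableType dW) (P : probability W R).
Variables (F : nat -> X -> R) (Z : W -> R).
Hypothesis mF : forall n, measurable_fun [set: X] (F n).
Hypothesis F0 : forall n x, 0 <= F n x.
Hypothesis mZ : measurable_fun [set: W] Z.
Hypothesis Z0 : forall w, 0 <= Z w.
Hypothesis FZ : forall k : nat, \int[Q]_x expR (- (k%:R * F n x)) @[n --> \oo] -->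
  \int[P]_w expR (- (k%:R * Z w)).

Lemma probability_bounded_L1 (d' : measure_display) (X' : measurableType d')
  (Q' : probability X' R) phi : bounded_measurable phi -> is_L1 Q' phi.
Proof.
move=> bphi; have i1 : is_L1 Q' (cst 1) by exact: finite_measure_integrable_cst.
by have := is_L1M_bounded i1 bphi; apply: eq_integrable => // x _ /=; rewrite mul1r.
Qed.

Lemma bounded_measurable_exp_pow (d' : measure_display) (X' : measurableType d')
  (h : X' -> R) i : measurable_fun [set: X'] h -> (forall x, 0 <= h x) ->
  bounded_measurable (fun x => expR (- h x) ^+ i).
Proof.
move=> mh h0; apply: bounded_measurableX; split.
  by apply: measurableT_comp; [exact: measurable_expR|exact: measurableT_comp].
by exists 1 => x; rewrite ger0_norm ?expR_ge0// expR_le1 oppr_le0.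
Qed.

Lemma bounded_measurable_exp_poly (d' : measure_display) (X' : measurableType d')
  (h : X' -> R) (p : {poly R}) : measurable_fun [set: X'] h -> (forall x, 0 <= h x) ->
  bounded_measurable (fun x => p.[expR (- h x)]).
Proof.
move=> mh h0.
under eq_fun do rewrite horner_coef.
apply: (@bounded_measurable_sum _ _ _ _ (fun i x => p`_i * expR (- h x) ^+ i)) => i.
by apply: bounded_measurableM; [exact: bounded_measurable_cst|exact: bounded_measurable_exp_pow].
Qed.

Lemma integral_exp_poly (d' : measure_display) (X' : measurableType d')
  (Q' : probability X' R) (h : X' -> R) (p : {poly R}) : measurable_fun [set: X'] h ->
  (forall x, 0 <= h x) ->
  \int[Q']_x p.[expR (- h x)] = \sum_(i < size p) p`_i * \int[Q']_x expR (- (i%:R * h x)).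
Proof.
move=> mh h0.
have L1p i : is_L1 Q' (fun x => expR (- h x) ^+ i).
  by apply: probability_bounded_L1; exact: bounded_measurable_exp_pow.
under eq_Rintegral do rewrite horner_coef.
rewrite (@Rintegral_sum _ _ _ _ _ (fun i x => p`_i * expR (- h x) ^+ i)); last first.
  by move=> i; have := integrableZl measurableT p`_i (L1p i); apply: eq_integrable.
apply: eq_bigr => i _; rewrite (RintegralZl _ measurableT (L1p i)); congr (_ * _).
by apply: eq_Rintegral => x _; rewrite -expRM_natl mulrN.
Qed.

Lemma test_fun_cvg (g : \bar R -> R) : {within [set y | (0 <= y)%E], continuous g} ->
  \int[Q]_x g (F n x)%:E @[n --> \oo] --> \int[P]_w g (Z w)%:E /\
  (forall n, is_L1 Q (fun x => g (F n x)%:E)) /\ is_L1 P (fun w => g (Z w)%:E).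
Proof.
move=> cg.
have bg (d' : measure_display) (X' : measurableType d') (h : X' -> R) :
    measurable_fun [set: X'] h -> (forall x, 0 <= h x) ->
    bounded_measurable (fun x => g (h x)%:E).
  move=> mh h0; split.
    rewrite (_ : (fun x => _) = (fun y => g (Num.max y 0)%:E) \o h); last first.
      by apply/funext => x /=; rewrite max_l.
    apply: measurableT_comp => //; apply: continuous_measurable_fun.
    exact: test_fun_pos_continuous.
  have [p hp] := test_fun_exp_approx cg (@ltr01 R).
  have [_ [M hM]] := bounded_measurable_exp_poly p mh h0.
  exists (M + 1) => x; rewrite -[g _](subrK p.[expR (- h x)]) addrC.
  by apply: (le_trans (ler_normD _ _)); exact: (lerD (hM x) (hp _ (h0 x))).
have gL (d' : measure_display) (X' : measurableType d') (Q' : probability X' R) (h : X' -> R) :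
    measurable_fun [set: X'] h -> (forall x, 0 <= h x) -> is_L1 Q' (fun x => g (h x)%:E).
  by move=> mh h0; apply: probability_bounded_L1; exact: bg.
split; last by split=> [n|]; exact: gL.
apply/cvgrPdist_le => e e0.
have e30 : 0 < e / 3 by rewrite divr_gt0.
have [p hp] := test_fun_exp_approx cg e30.
have approx (d' : measure_display) (X' : measurableType d') (Q' : probability X' R) (h : X' -> R) :
    measurable_fun [set: X'] h -> (forall x, 0 <= h x) ->
    `|\int[Q']_x g (h x)%:E - \int[Q']_x p.[expR (- h x)]| <= e / 3.
  move=> mh h0; have g1 := gL _ _ Q' h mh h0.
  have p1 : is_L1 Q' (fun x => p.[expR (- h x)]).
    by apply: probability_bounded_L1; exact: bounded_measurable_exp_poly.
  have d1 : is_L1 Q' (fun x => g (h x)%:E - p.[expR (- h x)]).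
    exact: (integrableB measurableT g1 p1).
  rewrite -(RintegralB measurableT g1 p1) (le_trans (le_normr_Rintegral measurableT d1))//.
  apply: (@le_trans _ _ (\int[Q']_x (cst (e / 3) x))).
    apply: le_Rintegral => //; first exact: integrable_norm.
      exact: finite_measure_integrable_cst.
    by move=> x _; exact: hp.
  rewrite Rintegral_cst//; apply: ler_piMr; first exact: ltW.
  by apply: eqW; exact: (congr1 fine (probability_setT Q')).
have /cvgrPdist_le/(_ _ e30) near1 :
    \int[Q]_x p.[expR (- F n x)] @[n --> \oo] --> \int[P]_w p.[expR (- Z w)].
  rewrite (integral_exp_poly P p mZ Z0).
  under eq_fun do rewrite (integral_exp_poly Q p (mF _) (F0 _)).
  apply: cvg_sum_ord => i; apply: cvgMr; exact: FZ.
near=> n.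
have h1 : `|\int[P]_w p.[expR (- Z w)] - \int[Q]_x p.[expR (- F n x)]| <= e / 3.
  by near: n; exact: near1.
have h2 := approx _ _ P Z mZ Z0; have h3 := approx _ _ Q (F n) (mF n) (F0 n).
rewrite distrC in h3.
apply: (le_trans (ler_dist3 h2 h1 h3)).
by apply/eqW; field.
Unshelve. all: by end_near. Qed.

End Continuity.

(** * Null sets and conclusion *)

Section Conclusion.
Context {R : realType} (d : measure_display) (X : measurableType d)
  (m : {sigma_finite_measure set X -> \bar R}) (T : {mfun X >-> X}).
Hypothesis mp : measure_preserving m T.

(** A change of [f] on [N] reaches S_n(f) along orbits, so the exceptional set is the union of all
    preimages of [N], null by invariance of the measure. *)
Lemma birkhoff_off_null (N : set X) : measurable N -> m N = 0%E ->
  let N' := \bigcup_k (iter k T @^-1` N) in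
  [/\ measurable N', m N' = 0%E & forall f g : X -> R, (forall x, ~ N x -> f x = g x) ->
    forall n x, ~ N' x -> birkhoff_sum T f n x = birkhoff_sum T g n x].
Proof.
move=> mN N0 N'; split.
- by apply: bigcup_measurable => k _; exact: measurable_iter_preimage.
- apply: measure_negligible.
    by apply: bigcup_measurable => k _; exact: measurable_iter_preimage.
  apply: negligible_bigcup => k; exists (iter k T @^-1` N).
  by split; [exact: measurable_iter_preimage|exact: etrans (measure_preserving_iter mp k mN) N0|].
- move=> f g fg n x Nx; apply: eq_bigr => k _; apply: fg => Nk.
  by apply: Nx; exists (nat_of_ord k).
Qed.

Lemma strong_cvg_of_ge0 (a : nat -> R) (gamma : R) : conservative m T ->
  return_sequence m T a -> 0 <= gamma <= 1 -> regularly_varying a gamma ->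
  forall f : X -> R, is_L1 m f -> (forall x, 0 <= f x) -> 0 < \int[m]_x f x ->
  forall (dW : measure_display) (W : measurableType dW) (P : probability W R)
    (Y : {RV P >-> R}), mittag_leffler gamma Y ->
  strong_cvg_in_distribution m (fun n x => (birkhoff_sum T f n x / a n)%:E)
    P (fun w => (\int[m]_y f y) * Y w).
Proof.
move=> cons ra gamma01 rva f fL f0 fpos dW W P Y mlY g cg Q Qm.
set c := \int[m]_y f y.
have mf := is_L1_measurable fL.
have [u [uL u0 u1 uQ]] := probability_density Qm.
have upos : 0 < \int[m]_x u x by rewrite u1.
pose F n x := birkhoff_sum T f n x / a n.
pose Z w := c * Num.max (Y w) 0.
have mF n : measurable_fun [set: X] (F n) by exact: measurable_birkhoff_ratio.
have F0 n x : 0 <= F n x by exact: (birkhoff_ratio_ge0 ra).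
have mZ : measurable_fun [set: W] Z.
  by apply: measurable_funM => //; exact: measurable_pos_part.
have Z0 w : 0 <= Z w by rewrite mulr_ge0 ?(ltW fpos)// pos_part_ge0.
have FZ (k : nat) : \int[Q]_x expR (- (k%:R * F n x)) @[n --> \oo] -->
    \int[P]_w expR (- (k%:R * Z w)).
  have k0 : 0 <= k%:R :> R by [].
  have := laplace_cvg_weight mp cons ra gamma01 rva mlY uL u0 upos fL f0 fpos k0.
  rewrite u1 mul1r /mittag_leffler_laplace.
  under [X in _ --> X]eq_Rintegral do rewrite -mulrA.
  under eq_fun => n.
    rewrite -uQ; first over.
      by have [] := bounded_measurable_laplace ra n mf f0 k0.
    by move=> x; exact: expR_ge0.
  by [].
have [cvg1 [gF gZ]] := test_fun_cvg mF F0 mZ Z0 FZ cg.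
have -> : 'E_P[fun w => g (c * Y w)%:E]%E = (\int[P]_w g (Z w)%:E)%:E.
  rewrite (EFin_Rintegral gZ) unlock.
  apply: (integral_off_null (measurable_mittag_leffler_null Y) (mittag_leffler_null mlY)).
  by move=> w /pos_part_off_null ->.
have -> : (fun n => \int[Q]_x (g (birkhoff_sum T f n x / a n)%:E)%:E)%E =
    EFin \o (fun n => \int[Q]_x g (F n x)%:E).
  by apply/funext => n /=; rewrite (EFin_Rintegral (gF n)).
by apply: cvg_EFin => //; exact: nearW.
Qed.

End Conclusion.

Theorem theorem4p1 (R : realType) (d : measure_display) (X : measurableType d)
    (m : {sigma_finite_measure set X -> \bar R}) (T : {mfun X >-> X})
    (a : nat -> R) (gamma : R) :
  measure_preserving m T -> conservative m T -> ergodic m T ->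
  weakly_pointwise_dual_ergodic m T -> return_sequence m T a ->
  0 <= gamma <= 1 -> regularly_varying a gamma ->
  forall f : X -> R, is_L1plus m f ->
  forall (dW : measure_display) (W : measurableType dW) (P : probability W R)
    (Y : {RV P >-> R}), mittag_leffler gamma Y ->
    strong_cvg_in_distribution m
      (fun n x => (birkhoff_sum T f n x / a n)%:E)
      P (fun w => (\int[m]_y f y) * Y w).
Proof.
move=> mp cons _ _ ra gamma01 rva f [fL [N [mN N0 hN]] fpos] dW W P Y mlY g cg Q Qm.
(* [f] is nonnegative only almost everywhere, while the arguments above use nonnegativity at every
   point. Absolute continuity of [Q] makes the change invisible to it. *)
pose f' x := Num.max (f x) 0.
have ff' x : ~ N x -> f x = f' x.
  move=> Nx; rewrite /f' max_l//; apply: contrapT => h; apply: Nx; exact: hN.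
have f'0 x : 0 <= f' x by rewrite le_max lexx orbT.
have intE : \int[m]_x f x = \int[m]_x f' x.
  by rewrite /Rintegral; congr fine; apply: (integral_off_null mN N0) => x /ff' ->.
have f'L : is_L1 m f'.
  apply: (@le_integrable _ _ _ m [set: X] measurableT _ (EFin \o f)) => //.
    apply/measurable_EFinP; apply: measurable_maxr; first exact: is_L1_measurable fL.
    exact: measurable_cst.
  move=> x _ /=; rewrite lee_fin /f'; case: (leP 0 (f x)) => // h.
  by rewrite normr0.
have [mN' N'0 bN] := birkhoff_off_null mp mN N0.
have QN' : Q (\bigcup_k (iter k T @^-1` N)) = 0%E by move/null_content_dominatesP : Qm; exact.
rewrite intE in fpos *.
have := strong_cvg_of_ge0 mp cons ra gamma01 rva f'L f'0 fpos mlY cg Qm.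
apply: cvg_trans; apply: near_eq_cvg; near=> n.
by apply: (integral_off_null mN' QN') => x Nx; rewrite (bN _ _ ff').
Unshelve. all: by end_near. Qed.
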